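(* Let $m,s,r$ be integers with $1\leq s\leq\frac{m}{2}$ and $r\geq 2$, and let $F=(sK_2\cup\overline{K_{m-2s}})\vee T(m(r-1),r-1)$. For all sufficiently large $n$, $K_{s-1}\vee T(n-s+1,r)$ is the unique graph (up to isomorphism) in $\mathrm{SPEX}(n,\{F\})$.
   Context: All graphs are finite, undirected, simple. $K_n$ is the complete graph and $\overline{K_n}$ the edgeless graph on $n$ vertices ($K_0$ and $\overline{K_0}$ are the graph with no vertices); $sH$ is the disjoint union of $s$ copies of $H$; $\cup$ is disjoint union; $G_1\vee G_2$ denotes the join (disjoint union together with all edges between $G_1$ and $G_2$; the paper writes $\prod$). $T(n,r)$ is the Turán graph, i.e. the complete $r$-partite graph on $n$ vertices whose parts each have size $\lfloor n/r\rfloor$ or $\lceil n/r\rceil$, with $T(n,1)=\overline{K_n}$. The spectral radius is the largest eigenvalue of the adjacency matrix. $\mathrm{SPEX}(n,\mathcal{F})$ is the set of graphs with maximum spectral radius among all graphs of order $n$ containing no member of $\mathcal{F}$ as a (not necessarily induced) subgraph. *)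

(* Defs.v *)
From mathcomp Require Import all_boot all_order all_algebra.
From mathcomp Require Import classical_sets reals.

Set Implicit Arguments.
Unset Strict Implicit.
Unset Printing Implicit Defensive.

Import Order.TTheory GRing.Theory Num.Theory.

Local Open Scope ring_scope.

Record sgraph := SGraph {
  vertex :> finType;
  edge : rel vertex;
  edge_sym : symmetric edge;
  edge_irrefl : irreflexive edge }.

Definition order (G : sgraph) : nat := #|{: vertex G}|.

Definition isomorphic (G H : sgraph) : Prop :=
  exists f : G -> H, bijective f /\ forall x y, edge (f x) (f y) = edge x y.

(* [H] is a not necessarily induced subgraph of [G]. *)
Definition has_subgraph (G H : sgraph) : Prop :=
  exists f : H -> G, injective f /\ forall x y, edge x y -> edge (f x) (f y).

Section CompleteGraph.
Variable n : nat.
Let e : rel 'I_n := fun x y => x != y.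
Fact complete_sym : symmetric e. Proof. by move=> x y; rewrite /e eq_sym. Qed.
Fact complete_irrefl : irreflexive e. Proof. by move=> x; rewrite /e eqxx. Qed.
Definition complete_graph := SGraph complete_sym complete_irrefl.
End CompleteGraph.

Section EdgelessGraph.
Variable n : nat.
Let e : rel 'I_n := fun _ _ => false.
Fact edgeless_sym : symmetric e. Proof. by []. Qed.
Fact edgeless_irrefl : irreflexive e. Proof. by []. Qed.
Definition edgeless_graph := SGraph edgeless_sym edgeless_irrefl.
End EdgelessGraph.

Section Copies.
Variables (s : nat) (H : sgraph).
Let e : rel ('I_s * H)%type := fun x y => (x.1 == y.1) && edge x.2 y.2.
Fact copies_sym : symmetric e.
Proof. by move=> x y; rewrite /e eq_sym edge_sym. Qed.
Fact copies_irrefl : irreflexive e.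
Proof. by move=> x; rewrite /e edge_irrefl andbF. Qed.
Definition copies := SGraph copies_sym copies_irrefl.
End Copies.

Section BinaryOperations.
Variables G H : sgraph.

(* [b] tells whether vertices from different summands are adjacent. *)
Let e (b : bool) : rel (G + H)%type := fun x y =>
  match x, y with
  | inl u, inl v => edge u v
  | inr u, inr v => edge u v
  | _, _ => b
  end.
Fact sum_edge_sym b : symmetric (e b).
Proof. by case=> [u|u] [v|v] //=; rewrite edge_sym. Qed.
Fact sum_edge_irrefl b : irreflexive (e b).
Proof. by case=> u /=; rewrite edge_irrefl. Qed.

Definition disjoint_union := SGraph (sum_edge_sym false) (sum_edge_irrefl false).
Definition graph_join := SGraph (sum_edge_sym true) (sum_edge_irrefl true).
End BinaryOperations.

Section CompleteMultipartite.
Variables (r : nat) (p : 'I_r -> nat).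
Let e : rel {i : 'I_r & 'I_(p i)} := fun x y => tag x != tag y.
Fact multipartite_sym : symmetric e.
Proof. by move=> x y; rewrite /e eq_sym. Qed.
Fact multipartite_irrefl : irreflexive e.
Proof. by move=> x; rewrite /e eqxx. Qed.
Definition complete_multipartite := SGraph multipartite_sym multipartite_irrefl.
End CompleteMultipartite.

(* Exactly [n %% r] of the [r] parts have the larger size, so that the order is
   [n] (see [order_turan]); no part is enlarged when [r] divides [n]. *)
Definition turan_part (n r : nat) (i : 'I_r) : nat :=
  (n %/ r + (i < n %% r))%N.

Definition turan (n r : nat) : sgraph := complete_multipartite (@turan_part n r).

Lemma order_turan (n r : nat) : (0 < r)%N -> order (turan n r) = n.
Proof.
move=> r_gt0; rewrite /order card_tagged sumnE big_map big_enum /=.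
under eq_bigr => i _ do rewrite card_ord /turan_part.
rewrite big_split /= sum_nat_const card_ord [RHS](divn_eq n r) mulnC.
congr (_ + _)%N.
have le_r : (n %% r <= r)%N by rewrite ltnW // ltn_mod.
rewrite -(big_mkord xpredT (fun i => nat_of_bool (i < n %% r)%N)).
rewrite (big_cat_nat (leq0n _) le_r) /=.
rewrite (@eq_big_nat _ _ _ 0 _ _ (fun=> 1%N)) => [|i /andP[_ ->]//].
rewrite (@eq_big_nat _ _ _ (n %% r) _ _ (fun=> 0%N)) => [|i /andP[+ _]]; last first.
  by rewrite leqNgt => /negbTE->.
by rewrite !sum_nat_const_nat subn0 muln1 muln0 addn0.
Qed.

Section SpectralRadius.
Variable R : realType.

Definition adjacency_matrix (G : sgraph) : 'M[R]_(order G) :=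
  \matrix_(i, j) (edge (enum_val i : G) (enum_val j))%:R.

(* The adjacency matrix is real symmetric, so for a nonempty graph the set of
   its eigenvalues is finite and nonempty and its supremum is its maximum. *)
Definition spectral_radius (G : sgraph) : R :=
  sup [set x : R | eigenvalue (adjacency_matrix G) x]%classic.

Definition free_of (Fam : sgraph -> Prop) (G : sgraph) : Prop :=
  forall F, Fam F -> ~ has_subgraph G F.

Definition SPEX (n : nat) (Fam : sgraph -> Prop) (G : sgraph) : Prop :=
  [/\ order G = n, free_of Fam G &
    forall H : sgraph, order H = n -> free_of Fam H ->
      spectral_radius H <= spectral_radius G].

End SpectralRadius.

Definition family1 (F : sgraph) : sgraph -> Prop := fun H => H = F.

(* Main.v *)
(* Let G have the largest spectral radius l among the F-free graphs of order n,
   and let x be its Perron vector with entries of sum 1, seen as a weighting of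
   the vertices; every weight is at most 1/l, hence tiny. As l is at least about
   (1 - 1/r) n, the weighted edge density of G is at least 1 - 1/r - 1/l.

   Stability: a set U maximising (edge weight) - a (weight)^2, with a slightly
   below 1 - 1/r, has large weighted minimum degree. An Erdos-Stone argument finds
   in U a complete r-partite graph with large parts, and sorting the vertices of
   U by the part they avoid gives classes that are independent up to boundedly
   many vertices, because G contains no F; U carries almost all the weight.

   Maximality: reattaching a vertex v to all the classes but one creates no F, so
   it cannot increase the quadratic form. Hence every vertex has nearly maximal
   weighted degree, all entries of x are comparable, and all but boundedly many
   vertices lie in independent classes I_1, ..., I_r between which each vertex
   misses boundedly many others.

   Exact structure: let C be the bounded exceptional set, and let A_i be the
   heaviest trace on C of the neighbourhoods of many vertices of I_i. F-freeness
   shows that fewer than s vertices of C lie in all the A_i. Comparing G with the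
   join of a clique on s - 1 vertices of C and a complete r-partite graph, whose
   classes contain the I_i, shows that almost all vertices of I_i have trace
   exactly A_i. Then an edge inside a class would yield F, so G is contained in,
   hence equal to, that join. Moving a vertex between two classes shows that the
   classes are balanced. *)
Require Import Defs.
From mathcomp Require Import boolp classical_sets reals topology normedtype derive.
From mathcomp Require Import all_boot all_order all_algebra.
From mathcomp Require Import lra ring zify.

Set Implicit Arguments.
Unset Strict Implicit.
Unset Printing Implicit Defensive.
Import Order.TTheory GRing.Theory Num.Theory.

(** * Embedding criteria *)

(** With entries of sum 1, the eigenvector equation reads [weight (nbrs v) = l * x v]. Put
    [tau = 1 / l]: entries are at most [tau], so a set of weight at least [n * tau] has at least [n]
    vertices, and [n] vertices weigh at most [n * tau]. Degrees, densities and errors are therefore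
    measured by weight, with no detour through numbers of edges. The obstacle is that at first no
    lower bound on the entries is known: many vertices may weigh nothing, and at a vertex of weight
    0 a change of neighbourhood leaves the form unchanged. This is why maximality is stated with its
    ties, and why positivity of [x] comes from reattachment and not from connectedness. Errors start
    as small constants. Only when boundedly many vertices remain outside the classes do they become
    multiples of [tau], comparable with a single entry, which is the precision needed to determine
    traces exactly. Here [p] is r - 1, and the final thresholds depend on [m], [s], [p] alone,
    chosen before the field, the graph and [x]. *)

Definition matching_join_turan (m s p : nat) : sgraph :=
  graph_join (disjoint_union (copies s (complete_graph 2))
                             (edgeless_graph (m - 2 * s)))
             (turan (m * p) p).

Section Embedding.
Variables (G : sgraph).
Implicit Types (M : seq (G * G)) (A : {set G}) (u v : G).

Definition ends M : seq G := map fst M ++ map snd M.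

Definition is_matching M : bool :=
  uniq (ends M) && all (fun ab => edge ab.1 ab.2) M.

Definition complete_between r (Y : 'I_r -> {set G}) : Prop :=
  forall i j u v, i != j -> u \in Y i -> v \in Y j -> edge u v.

Lemma nth_enum_in d A i : i < #|A| -> nth d (enum A) i \in A.
Proof. by move=> iA; rewrite -mem_enum mem_nth // -cardE. Qed.

Lemma nth_enum_inj d A i j : i < #|A| -> j < #|A| ->
  nth d (enum A) i = nth d (enum A) j -> i = j.
Proof.
by rewrite !cardE => iA jA /eqP; rewrite nth_uniq ?enum_uniq // => /eqP.
Qed.

(** The part [Y i0] supplies the m - 2s isolated vertices and the other parts supply the Turan
    graph. The ends of [M] only have to avoid [Y i0], so a matching may use vertices outside all the
    parts. *)
Lemma has_matching_join_turan m s p M (i0 : 'I_p.+1) (Y : 'I_p.+1 -> {set G}) :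
  0 < s -> 0 < p -> is_matching M -> size M = s ->
  (forall z j v, z \in ends M -> j != i0 -> v \in Y j -> edge z v) ->
  (forall z, z \in ends M -> z \notin Y i0) ->
  (forall j, m <= #|Y j|) -> complete_between Y ->
  has_subgraph G (matching_join_turan m s p).
Proof.
move=> s_gt0 p_gt0 /andP[uM eM] sM adjM MY mY YY.
have d : G by case: M sM s_gt0 {uM eM adjM MY} => [<-|[]].
(* [ends M] lists all first ends before all second ends, so edge k occupies the positions k and k +
   s. *)
pose c (z : 'I_s * 'I_2) := nth d (ends M) (z.1 + s * z.2).
have sE : size (ends M) = s + s by rewrite size_cat !size_map sM.
have cM z : c z \in ends M.
  apply: mem_nth; rewrite sE; case: z => [[a sa] [b sb]] /=.
  by case: b sb => [|[|//]] _; lia.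
have ci : injective c.
  move=> [[a sa] [b sb]] [[a' sa'] [b' sb']] /eqP.
  rewrite /c /= nth_uniq // ?sE; first last.
  - by case: b' sb' => [|[|//]] _; lia.
  - by case: b sb => [|[|//]] _; lia.
  move=> /eqP; case: b sb => [|[|//]] sb; case: b' sb' => [|[|//]] sb' h;
   congr (_, _); apply: val_inj => /=; lia.
have ce (k : 'I_s) : edge (c (k, ord0)) (c (k, ord_max)).
  rewrite /c /= muln0 addn0 muln1 /ends !nth_cat !size_map sM ltn_ord.
  rewrite ltnNge leq_addl /= addnK !(nth_map (d, d)) ?sM //.
  by apply: (allP eM); apply: mem_nth; rewrite sM.
have tp i : @turan_part (m * p) p i = m by rewrite /turan_part mulnK // modnMl addn0.
pose f (z : matching_join_turan m s p) : G := match z with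
  | inl (inl z) => c z
  | inl (inr t) => nth d (enum (Y i0)) t
  | inr (existT i t) => nth d (enum (Y (lift i0 i))) t
  end.
have ltY0 (t : 'I_(m - 2 * s)) : t < #|Y i0|.
  by apply: leq_trans (mY _); apply: leq_trans (ltn_ord t) _; apply: leq_subr.
have ltY1 (i : 'I_p) (t : 'I_(@turan_part (m * p) p i)) : t < #|Y (lift i0 i)|.
  by apply: leq_trans (mY _); have := ltn_ord t; rewrite [X in _ < X]tp.
have Ydisj i j u : i != j -> u \in Y i -> u \in Y j -> False.
  by move=> ij ui uj; have := YY _ _ _ _ ij ui uj; rewrite edge_irrefl.
have ne i : lift i0 i != i0 by rewrite eq_sym neq_lift.
exists f; split.
- have in0 t := nth_enum_in d (ltY0 t).
  have in1 i t := nth_enum_in d (@ltY1 i t).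
  have c0 z (t : 'I_(m - 2 * s)) : c z <> nth d (enum (Y i0)) t.
    by move=> h; have := MY _ (cM z); rewrite h in0.
  have c1 z i (t : 'I_(@turan_part (m * p) p i)) : c z <> nth d (enum (Y (lift i0 i))) t.
    move=> h; have := adjM _ _ _ (cM z) (ne i) (@in1 i t).
    by rewrite h edge_irrefl.
  have n01 (t : 'I_(m - 2 * s)) i (t' : 'I_(@turan_part (m * p) p i)) : nth d (enum (Y i0)) t <> nth d (enum (Y (lift i0 i))) t'.
    by move=> h; apply: (Ydisj _ _ _ (ne i) (@in1 i t')); rewrite -h.
  case=> [[z|t]|[i t]] [[z'|t']|[i' t']] /= h.
  + by rewrite (ci _ _ h).
  + by case: (c0 _ _ h).
  + by case: (c1 _ _ _ h).
  + by case: (c0 _ _ (esym h)).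
  + by congr (inl (inr _)); apply: val_inj; apply: nth_enum_inj h.
  + by case: (n01 _ _ _ h).
  + by case: (c1 _ _ _ (esym h)).
  + by case: (n01 _ _ _ (esym h)).
  + case: (eqVneq i i') => [ii'|ii'].
      subst i'; congr (inr (existT _ _ _)); apply: val_inj.
      exact: nth_enum_inj h.
    case: (Ydisj (lift i0 i) (lift i0 i') (nth d (enum (Y (lift i0 i))) t)) => //.
      by rewrite (inj_eq (@lift_inj _ _)).
    by rewrite h.
case=> [[z|t]|[i t]] [[z'|t']|[i' t']] //=.
- case: z z' => [k [b sb]] [k' [b' sb']] /= /andP[/eqP kk]; rewrite /= in kk; subst k'.
  have o0 sx : Ordinal (n:=2) (m:=0) sx = ord0 by apply: val_inj.
  have o1 sx : Ordinal (n:=2) (m:=1) sx = ord_max by apply: val_inj.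
  case: b sb => [|[|//]] sb; case: b' sb' => [|[|//]] sb' //; rewrite ?o0 ?o1 //.
  by rewrite edge_sym.
- by move=> _; apply: (adjM _ (lift i0 i')) => //; apply: nth_enum_in.
- by move=> _; apply: YY (nth_enum_in d (ltY0 t)) (nth_enum_in d (@ltY1 i' t')); rewrite eq_sym.
- by move=> _; rewrite edge_sym; apply: (adjM _ (lift i0 i)) => //; apply: nth_enum_in.
- by move=> _; apply: YY (nth_enum_in d (@ltY1 i t)) (nth_enum_in d (ltY0 t')).
- move=> h; apply: YY (nth_enum_in d (@ltY1 i t)) (nth_enum_in d (@ltY1 i' t')).
  by rewrite (inj_eq (@lift_inj _ _)).
Qed.

(* Each vertex of [Q] destroys at most one of the [s] matching edges and no part
   of [T(mp, p)] entirely, so a copy of the graph would leave a clique of order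
   [p + 2] outside [Q]. *)
Lemma matching_join_turan_free m s p (Q : {set G}) (col : G -> 'I_p.+1) :
  #|Q| < s -> 2 * s <= m -> 0 < p ->
  (forall u v, u \notin Q -> v \notin Q -> edge u v -> col u != col v) ->
  ~ has_subgraph G (matching_join_turan m s p).
Proof.
move=> Qs sm p_gt0 colP [f [fi fe]].
have tp i : @turan_part (m * p) p i = m by rewrite /turan_part mulnK // modnMl addn0.
have avoid n (h : 'I_n -> matching_join_turan m s p) : injective h -> #|Q| < n ->
    exists i, f (h i) \notin Q.
  move=> hi Qn; apply/existsP; apply: contraLR Qn; rewrite negb_exists -leqNgt.
  move=> /forallP hQ; rewrite -[n]card_ord -(card_codom (inj_comp fi hi)).
  by apply: subset_leq_card; apply/subsetP=> y /codomP[i ->]; have := hQ i; rewrite negbK.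
have [k kP] : exists k : 'I_s, forall b, f (inl (inl (k, b))) \notin Q.
  pose bad (k : 'I_s) := [exists b, f (inl (inl (k, b))) \in Q].
  have [/forallP all_bad|] := boolP [forall k, bad k]; last first.
    rewrite negb_forall => /existsP[k]; rewrite negb_exists => /forallP kP.
    by exists k.
  have w k : {b | f (inl (inl (k, b))) \in Q} by apply/sigW/existsP/all_bad.
  have hi : injective (fun k => f (inl (inl (k, sval (w k))))).
    by move=> k k' /fi[].
  have : #|codom (fun k => f (inl (inl (k, sval (w k)))))| <= #|Q|.
    by apply: subset_leq_card; apply/subsetP=> y /codomP[k ->]; exact: svalP (w k).
  by rewrite (card_codom hi) card_ord leqNgt Qs.
have tP (i : 'I_p) : {t | f (inr (existT (fun i => 'I_(@turan_part (m * p) p i)) i t)) \notin Q}.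
  apply: sigW; apply: (avoid _ (fun t => inr (existT _ i t))); last first.
    by rewrite tp; lia.
  move=> t t' h; apply: val_inj.
  exact: (congr1 (fun z : matching_join_turan m s p =>
                    if z is inr w then val (tagged w) else 0) h).
pose g (z : 'I_2 + 'I_p) := match z with
  | inl b => f (inl (inl (k, b))) | inr i => f (inr (existT _ i (sval (tP i)))) end.
have gQ z : g z \notin Q by case: z => [b|i] /=; [exact: kP | exact: svalP (tP i)].
have ge z z' : z != z' -> edge (g z) (g z').
  case: z z' => [b|i] [b'|i'] //= h; apply: fe => //=.
  by rewrite eqxx.
have /leq_card : injective (col \o g).
  move=> z z' /= /eqP; apply: contraTeq => /ge /(colP _ _ (gQ z) (gQ z')).
  by [].
by rewrite card_sum !card_ord; lia.
Qed.

End Embedding.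

(** * The adjacency form and Perron eigenvectors *)

Section AdjacencyForm.
Local Open Scope ring_scope.
Variables (R : realFieldType) (V : finType).
Implicit Types (e : rel V) (x y : V -> R) (u v : V).

Definition nbr_sum e x v : R := \sum_(u | e v u) x u.

Definition adj_form e x : R := \sum_v x v * nbr_sum e x v.

Definition sqnorm x : R := \sum_v x v ^+ 2.

Definition rayleigh_bound e (l : R) := forall y, adj_form e y <= l * sqnorm y.

Definition eigenvector e (l : R) x := forall v, l * x v = nbr_sum e x v.

Lemma sqnorm_ge0 x : 0 <= sqnorm x.
Proof. by apply: sumr_ge0 => v _; rewrite sqr_ge0. Qed.

Lemma sqnorm_eq0 x : sqnorm x = 0 -> forall v, x v = 0.
Proof.
move=> /eqP; rewrite psumr_eq0 => [/allP h v|v _]; last exact: sqr_ge0.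
by apply/eqP; rewrite -sqrf_eq0; apply: (implyP (h v _)); rewrite ?mem_index_enum.
Qed.

Lemma adj_form_eigenvector e l x : eigenvector e l x -> adj_form e x = l * sqnorm x.
Proof.
move=> ex; rewrite /adj_form /sqnorm mulr_sumr; apply: eq_bigr => v _.
by rewrite -ex expr2 mulrCA.
Qed.

Lemma nbr_sumE e x v : nbr_sum e x v = \sum_u (e v u)%:R * x u.
Proof.
by rewrite /nbr_sum big_mkcond; apply: eq_bigr => u _; case: (e v u); rewrite ?mul1r ?mul0r.
Qed.

Lemma adj_form_abs e x : adj_form e x <= adj_form e (fun v => `|x v|).
Proof.
apply: ler_sum => v _; rewrite (le_trans (ler_norm _)) // normrM.
by rewrite ler_wpM2l // (le_trans (ler_norm_sum _ _ _)).
Qed.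

Lemma adj_form_pair e x z : symmetric e ->
  adj_form e (fun v => x v + z v) =
    adj_form e x + 2 * (\sum_v z v * nbr_sum e x v) + adj_form e z.
Proof.
move=> es; have sw : \sum_v x v * nbr_sum e z v = \sum_v z v * nbr_sum e x v.
  under eq_bigr => v _ do rewrite nbr_sumE mulr_sumr.
  under [RHS]eq_bigr => v _ do rewrite nbr_sumE mulr_sumr.
  rewrite exchange_big /=; apply: eq_bigr => v _; apply: eq_bigr => u _.
  by rewrite es mulrCA [x u * _]mulrC mulrCA.
transitivity (adj_form e x + \sum_v x v * nbr_sum e z v
              + \sum_v z v * nbr_sum e x v + adj_form e z).
  rewrite /adj_form -!big_split; apply: eq_bigr => v _ /=.
  by rewrite /nbr_sum big_split /=; ring.
by rewrite sw; ring.
Qed.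

Lemma rayleigh_eigenvector e l x : symmetric e -> rayleigh_bound e l ->
  l * sqnorm x <= adj_form e x -> eigenvector e l x.
Proof.
move=> es rb lx.
(* The form [l |y|^2 - y A y] is nonnegative and vanishes at [x], hence its
   polarisation at [x] vanishes in every direction. *)
pose w v := l * x v - nbr_sum e x v.
have key (t : R) : 0 <= - 2 * t * sqnorm w + t ^+ 2 * (`|l| * sqnorm w + `|adj_form e w|).
  have h := rb (fun v => x v + - t * w v).
  rewrite adj_form_pair // in h.
  have e1 : \sum_v (- t * w v) * nbr_sum e x v = - t * \sum_v w v * nbr_sum e x v.
    by rewrite mulr_sumr; apply: eq_bigr => v _; rewrite mulrA.
  have e2 : adj_form e (fun v => - t * w v) = t ^+ 2 * adj_form e w.
    rewrite /adj_form mulr_sumr; apply: eq_bigr => v _.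
    by rewrite /nbr_sum -mulr_sumr; ring.
  have e3 : sqnorm (fun v => x v + - t * w v) =
      sqnorm x - 2 * t * (\sum_v w v * x v) + t ^+ 2 * sqnorm w.
    rewrite /sqnorm !mulr_sumr -sumrB -big_split; apply: eq_bigr => v _ /=; ring.
  have e4 : sqnorm w = l * (\sum_v w v * x v) - \sum_v w v * nbr_sum e x v.
    by rewrite /sqnorm mulr_sumr -sumrB; apply: eq_bigr => v _; rewrite /w; ring.
  rewrite e1 e2 e3 in h.
  have a1 : t ^+ 2 * (l * sqnorm w) <= t ^+ 2 * (`|l| * sqnorm w).
    by rewrite ler_wpM2l ?sqr_ge0 // ler_wpM2r ?sqnorm_ge0 ?ler_norm.
  have a2 : t ^+ 2 * - adj_form e w <= t ^+ 2 * `|adj_form e w|.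
    by rewrite ler_wpM2l ?sqr_ge0 // -normrN ler_norm.
  have e4' : t * sqnorm w = t * (l * (\sum_v w v * x v)) - t * \sum_v w v * nbr_sum e x v.
    by rewrite e4; ring.
  set a := \sum_v w v * x v in h e4'; set b := \sum_v w v * nbr_sum e x v in h e4'.
  suff : - 2 * (t * sqnorm w) + (t ^+ 2 * (`|l| * sqnorm w) + t ^+ 2 * `|adj_form e w|) >= 0 by lra.
  rewrite e4'.
  have h' : adj_form e x - 2 * (t * b) + t ^+ 2 * adj_form e w <=
     l * sqnorm x - 2 * (t * (l * a)) + t ^+ 2 * (l * sqnorm w) by lra.
  lra.
have w0 : sqnorm w = 0.
  apply/eqP; rewrite eq_le sqnorm_ge0 andbT.
  set c := `|l| * sqnorm w + `|adj_form e w| in key.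
  have c0 : 0 <= c by rewrite addr_ge0 ?mulr_ge0 ?sqnorm_ge0.
  rewrite leNgt; apply/negP => w0.
  (* For this [t] the quadratic term [t ^+ 2 * c] is at most [t * sqnorm w], too small to offset the
     linear term. *)
  have := key (sqnorm w / (c + 1)); set t := _ / _.
  have t0 : 0 < t by rewrite divr_gt0 // ltr_wpDl.
  have : t * c <= sqnorm w.
    by rewrite /t mulrAC ler_pdivrMr ?ltr_wpDl // ler_pM2l // lerDl.
  nra.
by move=> v; apply/eqP; rewrite -subr_eq0; have := sqnorm_eq0 w0 v => /eqP.
Qed.

End AdjacencyForm.

Section SpectralRadiusRayleigh.
Import numFieldNormedType.Exports.
Local Open Scope ring_scope.
Variable (R : realType).

Lemma continuous_sumr (T : topologicalType) (I : Type) (s : seq I) (P : pred I)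
    (f : I -> T -> R) :
  (forall i, continuous (f i)) -> continuous (fun y => \sum_(i <- s | P i) f i y).
Proof.
move=> cf; elim: s => [|i s IH].
  under eq_fun do rewrite big_nil; by move=> y; exact: cvg_cst.
under eq_fun do rewrite big_cons.
case: (P i) => // y; apply: cvgD; [exact: cf|exact: IH].
Qed.

Lemma continuous_mulr (T : topologicalType) (f g : T -> R) :
  continuous f -> continuous g -> continuous (fun y => f y * g y).
Proof. by move=> cf cg y; apply: cvgM; [exact: cf|exact: cg]. Qed.

(** The form attains its maximum on the unit sphere. Taking absolute values of a maximiser does not
    decrease the form, so a nonnegative maximiser exists; it is an eigenvector by
    [rayleigh_eigenvector] and is then rescaled to sum 1. *)
Lemma perron_eigenvector (V : finType) (e : rel V) : symmetric e -> (0 < #|V|)%N ->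
  exists (l : R) (x : V -> R),
    [/\ rayleigh_bound e l, forall v, 0 <= x v, \sum_v x v = 1 & eigenvector e l x].
Proof.
move=> es V0.
pose n := #|V|.
pose fn (y : 'rV[R]_n) (v : V) := y ord0 (enum_rank v).
pose A := [set y : 'rV[R]_n | sqnorm (fn y) = 1]%classic.
have cont_co v : continuous (fun y => fn y v) by apply: coord_continuous.
have csq : continuous (fun y => sqnorm (fn y)).
  apply: continuous_sumr => v.
  under eq_fun do rewrite expr2.
  by apply: continuous_mulr; exact: cont_co.
have cfo : continuous (fun y => adj_form e (fn y)).
  apply: continuous_sumr => v; apply: continuous_mulr; first exact: cont_co.
  by apply: continuous_sumr => u; exact: cont_co.
have cA : compact A.
  have cb := @rV_compact R n (fun=> `[(-1 : R), 1]%classic)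
               (fun=> @segment_compact R (-1) 1).
  apply: subclosed_compact cb _.
    have -> : A = ((fun y => sqnorm (fn y)) @^-1` [set 1])%classic by [].
    by apply: closed_comp => [? _|]; [exact: csq|exact: closed_eq].
  move=> y Ay i /=; rewrite in_itv /= -ler_norml.
  have : fn y (enum_val i) ^+ 2 <= 1.
    rewrite -[X in _ <= X]Ay /sqnorm (bigD1 (enum_val i)) //= lerDl.
    by apply: sumr_ge0 => *; exact: sqr_ge0.
  by rewrite /fn enum_valK -real_normK ?num_real // expr_le1.
have toA (x : V -> R) : sqnorm x = 1 -> exists2 y, A y & fn y =1 x.
  move=> x1; exists (\row_i x (enum_val i)).
    rewrite /A /= -x1; apply: eq_bigr => v _; by rewrite /fn mxE enum_rankK.
  by move=> v; rewrite /fn mxE enum_rankK.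
have scale (x : V -> R) : sqnorm x != 0 -> exists k, 
   [/\ k > 0, k ^+ 2 * sqnorm x = 1 & exists2 y, A y & fn y =1 (fun v => k * x v)].
  move=> x0; have xp : 0 < sqnorm x by rewrite lt_neqAle eq_sym x0 sqnorm_ge0.
  exists (Num.sqrt (sqnorm x))^-1.
  have q : (Num.sqrt (sqnorm x))^-1 ^+ 2 * sqnorm x = 1.
    by rewrite exprVn sqr_sqrtr ?sqnorm_ge0 // mulVf.
  split=> //; first by rewrite invr_gt0 sqrtr_gt0.
  apply: toA; rewrite -[RHS]q /sqnorm mulr_sumr; apply: eq_bigr => v _.
  by rewrite exprMn.
have [v0 _] : exists v0 : V, true by case/card_gt0P: V0 => v; exists v.
have ne : (A !=set0)%classic.
  have [|k [_ _ [y Ay _]]] := scale (fun v => 1).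
    rewrite /sqnorm (eq_bigr (fun=> 1)); last by move=> *; rewrite expr1n.
    by rewrite sumr_const pnatr_eq0 -lt0n.
  by exists y.
have [y0] := compact_EVT_max ne cA (continuous_subspaceT cfo).
move=> /set_mem Ay0 ymax.
have ext (x y : V -> R) : x =1 y -> adj_form e x = adj_form e y.
  by move=> /funext->.
pose l := adj_form e (fn y0).
have rb : rayleigh_bound e l.
  move=> y; have [y00|yn0] := eqVneq (sqnorm y) 0.
    rewrite y00 mulr0 /adj_form big1 // => v _.
    by rewrite (sqnorm_eq0 y00) mul0r.
  have [k [k0 ky [z Az zy]]] := scale y yn0.
  have := ymax z (mem_set Az); rewrite (ext _ _ zy).
  have -> : adj_form e (fun v => k * y v) = k ^+ 2 * adj_form e y.
    rewrite /adj_form mulr_sumr; apply: eq_bigr => v _.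
    by rewrite /nbr_sum -mulr_sumr; ring.
  have k2 : 0 < k ^+ 2 by rewrite exprn_gt0.
  rewrite -/l => h; rewrite -(ler_pM2l k2); apply: le_trans h _.
  by rewrite mulrCA ky mulr1.
pose z v := `|fn y0 v|.
have z1 : sqnorm z = 1.
  by rewrite -[RHS]Ay0; apply: eq_bigr => v _; rewrite /z real_normK ?num_real.
have ez : eigenvector e l z.
  by apply: rayleigh_eigenvector => //; rewrite z1 mulr1 adj_form_abs.
have z0 v : 0 <= z v by exact: normr_ge0.
have sz : 0 < \sum_v z v.
  rewrite lt_neqAle sumr_ge0 // andbT; apply/eqP => /esym/eqP.
  rewrite psumr_eq0 // => /allP h; move: z1; rewrite /sqnorm big1 => [/eqP|v _].
    by rewrite eq_sym oner_eq0.
  by have /eqP -> := (h v (mem_index_enum _)); rewrite expr0n.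
exists l, (fun v => (\sum_v z v)^-1 * z v); split=> //.
- by move=> v; rewrite mulr_ge0 // invr_ge0 ltW.
- by rewrite -mulr_sumr mulVf // gt_eqF.
- by move=> v; rewrite /nbr_sum -mulr_sumr -/(nbr_sum e z v) -ez mulrCA.
Qed.

(** The Rayleigh bound at an eigenvector shows that no eigenvalue exceeds [l], so the supremum is
    attained at [l]. Symmetry of [edge] reconciles row eigenvectors with neighbour sums. *)
Lemma spectral_radiusE (G : sgraph) (l : R) (x : G -> R) :
  rayleigh_bound (@edge G) l -> \sum_v x v = 1 -> eigenvector (@edge G) l x ->
  spectral_radius R G = l.
Proof.
move=> rb x1 ex.
have mulA (y : 'rV[R]_(Defs.order G)) j :
    (y *m adjacency_matrix R G) 0 j =
    nbr_sum (@edge G) (fun v => y 0 (enum_rank v)) (enum_val j).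
  rewrite mxE nbr_sumE (reindex enum_rank) /=; last first.
    by exists enum_val => ? _; rewrite ?enum_rankK ?enum_valK.
  apply: eq_bigr => u _; rewrite mxE enum_rankK mulrC edge_sym.
  by [].
pose E := [set a | eigenvalue (adjacency_matrix R G) a]%classic.
have El : E l.
  apply/eigenvalueP; exists (\row_i x (enum_val i)).
    by apply/rowP=> j; rewrite mulA !mxE ex; apply: eq_bigr => u _; rewrite mxE enum_rankK.
  apply/eqP=> /rowP h; have /eqP : \sum_v x v = 0.
    by apply: big1 => v _; have := h (enum_rank v); rewrite !mxE enum_rankK.
  by rewrite x1 oner_eq0.
have Eub : ubound E l.
  move=> a /eigenvalueP[y ya y0].
  pose z v := y 0 (enum_rank v).
  have ez : eigenvector (@edge G) a z.
    by move=> v; have /rowP/(_ (enum_rank v)) := ya; rewrite mulA !mxE enum_rankK => <-.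
  have := rb z; rewrite (adj_form_eigenvector ez) ler_pM2r //.
  rewrite lt_neqAle sqnorm_ge0 andbT; apply: contra y0 => /eqP/esym/sqnorm_eq0 h.
  by apply/eqP/rowP => i; rewrite mxE -(enum_valK i); exact: h.
apply/eqP; rewrite eq_le; apply/andP; split.
  by apply: ge_sup => //; exists l.
by apply: ub_le_sup => //; exists l.
Qed.
End SpectralRadiusRayleigh.

(** * Weighted vertex sets *)

Lemma subset_of_card (T : finType) (A : {set T}) n : n <= #|A| ->
  exists2 B : {set T}, B \subset A & #|B| = n.
Proof.
move=> nA; exists [set z in take n (enum A)].
  by apply/subsetP=> z; rewrite inE => /mem_take; rewrite mem_enum.
rewrite cardsE (card_uniqP _) ?take_uniq ?enum_uniq // size_take -cardE.
by case: ltnP => // An; apply/eqP; rewrite eqn_leq nA An.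
Qed.

Lemma pigeonhole_fibre (T : finType) (f : T -> {set T}) (X D : {set T}) n :
  (forall v, v \in X -> f v \subset D) -> n * 2 ^ #|D| <= #|X| ->
  exists S, n <= #|[set v in X | f v == S]|.
Proof.
case: n => [|n] fD nX; first by exists set0.
apply/existsP; apply: contraLR nX; rewrite negb_exists -ltnNge => /forallP h.
have -> : #|X| = \sum_(S in powerset D) #|[set v in X | f v == S]|.
  rewrite -sum1_card (partition_big f (mem (powerset D))) => [|v vX]; last first.
    by rewrite /= powersetE fD.
  by apply: eq_bigr => S _; rewrite -sum1_card; apply: eq_bigl => v; rewrite inE.
have : \sum_(S in powerset D) #|[set v in X | f v == S]| <= \sum_(S in powerset D) n.
  by apply: leq_sum => S _; rewrite -ltnS ltnNge h.
rewrite sum_nat_const card_powerset mulnC => /leq_ltn_trans; apply.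
by rewrite mulSn -[X in X < _]add0n ltn_add2r expn_gt0.
Qed.

(** * Matchings, vertex covers and blow-ups of cliques *)

Section MatchingOrCover.
Variable G : sgraph.
Implicit Types (A Z : {set G}) (M : seq (G * G)).

Definition independent A := forall u v, u \in A -> v \in A -> ~~ edge u v.

Lemma ends_cons ab M : ends (ab :: M) =i ab.1 :: ab.2 :: ends M.
Proof. by move=> z; rewrite /ends /= !(inE, mem_cat); do !bool_congr. Qed.

Lemma size_ends M : size (ends M) = 2 * size M.
Proof. by rewrite size_cat !size_map mul2n addnn. Qed.

Lemma is_matching_cons a b M : is_matching M -> edge a b ->
  a \notin ends M -> b \notin ends M -> is_matching ((a, b) :: M).
Proof.
move=> /andP[uM eM] ab aM bM; apply/andP; split; last by rewrite /= ab.
rewrite /ends /= mem_cat in_cons.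
have -> : uniq (map fst M ++ b :: map snd M) = uniq (b :: ends M).
  by apply: perm_uniq; rewrite -[b :: map snd M]cat1s perm_catCA.
rewrite /= bM uM andbT; move: aM; rewrite /ends mem_cat !negb_or => /andP[-> ->].
rewrite /= !andbT; apply/eqP => h; by rewrite h edge_irrefl in ab.
Qed.

(** If a matching cannot be extended inside [A], its ends meet every edge of [A]. *)
Lemma matching_or_cover A s :
  (exists M, [/\ is_matching M, size M = s & {subset ends M <= A}]) \/
  exists Z, [/\ Z \subset A, #|Z| <= 2 * s & independent (A :\: Z)].
Proof.
elim: s => [|s [[M [mM sM MA]]|[Z [ZA Zs iZ]]]]; first by left; exists [::].
  pose Z := [set z in ends M].
  have [/existsP[a /existsP[b /and3P[aA bA ab]]]|] :=
      boolP [exists a, exists b, [&& a \in A :\: Z, b \in A :\: Z & edge a b]].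
    left; exists ((a, b) :: M); split=> /=; last 1 first.
    - move=> z; rewrite ends_cons !inE => /or3P[/eqP->|/eqP->|/MA//];
      by [move: aA; rewrite !inE => /andP[] | move: bA; rewrite !inE => /andP[]].
    - by apply: is_matching_cons => //; [move: aA | move: bA]; rewrite !inE => /andP[].
    - by rewrite sM.
  rewrite negb_exists => /forallP h; right; exists Z; split.
  - by apply/subsetP=> z; rewrite inE => /MA.
  - by rewrite cardsE (leq_trans (card_size _)) // size_ends sM; lia.
  - move=> u v uA vA; have := h u; rewrite negb_exists => /forallP/(_ v).
    by rewrite uA vA.
by right; exists Z; split=> //; lia.
Qed.

(** The matching joins the parts [ord_max] and [ord0]. Part [ord_max] is then dropped, and the rest
    of part [ord0] takes the isolated vertices; deleting the 2s <= m ends leaves m vertices in each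
    part. *)
Lemma has_matching_join_turan_blowup m s p (Y : 'I_p.+2 -> {set G}) :
  (0 < s) -> (2 * s <= m) -> (0 < p) -> complete_between Y ->
  (forall j, 2 * m <= #|Y j|) -> has_subgraph G (matching_join_turan m s p).
Proof.
move=> s0 sm p0 YY mY.
pose A := take s (enum (Y ord_max)); pose B := take s (enum (Y ord0)).
have sz j : size (take s (enum (Y j))) = s.
  by rewrite size_take -cardE; have := mY j; case: ltnP; lia.
have inT j z : z \in take s (enum (Y j)) -> z \in Y j.
  by move=> /mem_take; rewrite mem_enum.
have ms0 : (ord_max : 'I_p.+2) != ord0 by [].
have endsE : ends (zip A B) = A ++ B.
  by rewrite /ends -/unzip1 -/unzip2 unzip1_zip ?unzip2_zip // ?sz // /A /B !sz.
pose Z := [set z in ends (zip A B)].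
have Zs : (#|Z| <= 2 * s).
  by rewrite cardsE (leq_trans (card_size _)) // endsE size_cat !sz; lia.
apply: (@has_matching_join_turan _ m s p (zip A B) ord0
          (fun i => Y (lift ord_max i) :\: Z)) => //.
- apply/andP; split.
    rewrite endsE cat_uniq !take_uniq ?enum_uniq // andbT /=.
    apply/hasPn => z /inT zB; apply/negP => /inT zA.
    by have := YY _ _ _ _ ms0 zA zB; rewrite edge_irrefl.
  apply/allP => -[a b] /(nthP (a, b))[i]; rewrite size_zip !sz minnn => i_s.
  rewrite nth_zip ?sz // => -[<- <-] /=.
  by apply: (YY _ _ _ _ ms0); apply: inT; apply: mem_nth; rewrite sz.
- by rewrite size_zip !sz minnn.
- move=> z j v; rewrite endsE mem_cat => /orP[/inT zA|/inT zB] j0.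
    rewrite inE => /andP[_ vY]; apply: YY zA vY; exact: neq_lift.
  rewrite inE => /andP[_ vY]; apply: YY zB vY.
  apply: contraNneq j0 => /(congr1 val) /=; rewrite /bump leqNgt ltn_ord /= => h.
  by apply/eqP/val_inj; rewrite /= h.
- by move=> z zM; rewrite !inE zM.
- move=> j; rewrite cardsD; have := mY (lift ord_max j).
  have := subset_leq_card (subsetIr (Y (lift ord_max j)) Z); lia.
- move=> i j u v ij; rewrite !inE => /andP[_ ui] /andP[_ vj].
  by apply: YY ui vj; rewrite (inj_eq (@lift_inj _ _)).
Qed.

End MatchingOrCover.

Section WeightedGraph.
Local Open Scope ring_scope.
Variables (R : realFieldType) (G : sgraph) (x : G -> R) (tau : R).
Implicit Types (A B S U : {set G}) (u v : G).

Definition weight A : R := \sum_(v in A) x v.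
Definition nbrs u : {set G} := [set v | edge u v].
Definition common_nbrs S : {set G} := [set v | [forall u in S, edge u v]].
Definition near_complete r (J : 'I_r -> {set G}) (rho : R) :=
  forall i j v, i != j -> v \in J i -> weight (J j :\: nbrs v) <= rho.

Hypothesis x_ge0 : forall v, 0 <= x v.
Hypothesis x_le : forall v, x v <= tau.
Hypothesis tau_gt0 : 0 < tau.

Lemma weight_ge0 A : 0 <= weight A.
Proof. by apply: sumr_ge0. Qed.

Lemma weight0 : weight set0 = 0.
Proof. by rewrite /weight big_set0. Qed.

Lemma weight_sub A B : A \subset B -> weight A <= weight B.
Proof.
move=> AB; rewrite /weight [leRHS](big_setID A) /= (setIidPr AB) lerDl.
exact: sumr_ge0.
Qed.

Lemma weightID A B : weight A = weight (A :&: B) + weight (A :\: B).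
Proof. exact: big_setID. Qed.

Lemma weightU_le A B : weight (A :|: B) <= weight A + weight B.
Proof.
rewrite (weightID (A :|: B) A) (setIidPr (subsetUl A B)) lerD2l.
by apply: weight_sub; rewrite setDUl setDv set0U subsetDl.
Qed.

Lemma weight_bigcup_le r (F : 'I_r -> {set G}) P :
  weight (\bigcup_(i | P i) F i) <= \sum_(i | P i) weight (F i).
Proof.
elim/big_rec2: _ => [|i a A _ h]; first by rewrite weight0.
by apply: le_trans (weightU_le _ _) _; rewrite lerD2l.
Qed.

Lemma weight_le_card A : weight A <= #|A|%:R * tau.
Proof. by rewrite -sumr_const mulr_suml; apply: ler_sum => v _; rewrite mul1r. Qed.

Lemma card_ge_weight A n : n%:R * tau <= weight A -> (n <= #|A|)%N.
Proof.
by move=> /le_trans/(_ (weight_le_card A)); rewrite ler_pM2r // ler_nat.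
Qed.

Lemma weightD_ge A B : weight A - weight B <= weight (A :\: B).
Proof.
by rewrite (weightID A B) addrAC gerDr subr_le0 weight_sub // subsetIr.
Qed.

Lemma weight_common_nbrs S A rho : (forall u, u \in S -> weight (A :\: nbrs u) <= rho) ->
  weight A - #|S|%:R * rho <= weight (A :&: common_nbrs S).
Proof.
move=> h; have -> : A :&: common_nbrs S = A :\: \bigcup_(u in S) (A :\: nbrs u).
  apply/setP=> v; rewrite !inE; case vA: (v \in A); rewrite ?andbF ?andbT //=.
  apply/forall_inP/negP => [vN /bigcupP[u uS]|vN u uS].
    by rewrite !inE vN.
  by apply/negPn/negP=> uv; case: vN; apply/bigcupP; exists u; rewrite // !inE uv.
apply: le_trans (weightD_ge _ _); rewrite lerD2l lerN2.
apply: (@le_trans _ _ (\sum_(u in S) weight (A :\: nbrs u))).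
  elim/big_rec2: _ => [|u a B _ ha]; first by rewrite weight0.
  by apply: le_trans (weightU_le _ _) _; rewrite lerD2l.
by rewrite mulr_natl -sumr_const; apply: ler_sum.
Qed.

(** Greedy choice, one class after the other: the at most r m vertices already chosen exclude weight
    at most r m rho from the next [X k], and the remaining weight m tau contains m vertices. *)
Lemma blowup_in_near_complete r m (J X : 'I_r -> {set G}) rho :
  0 <= rho -> near_complete J rho -> (forall i, X i \subset J i) ->
  (forall i, (r * m)%:R * rho + m%:R * tau <= weight (X i)) ->
  exists Y : 'I_r -> {set G},
    [/\ forall i, Y i \subset X i, forall i, #|Y i| = m & complete_between Y].
Proof.
move=> rho0 nJ XJ wX.
suff /(_ r (leqnn r))[Y [Y1 Y2 Y3]] : forall k, (k <= r)%N ->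
    exists Y : 'I_r -> {set G},
    [/\ forall i : 'I_r, (i < k)%N -> Y i \subset X i,
        forall i : 'I_r, (i < k)%N -> #|Y i| = m &
        forall (i j : 'I_r) u v, (i < k)%N -> (j < k)%N -> i != j ->
          u \in Y i -> v \in Y j -> edge u v].
  exists Y; split=> [i|i|i j u v]; [exact: Y1|exact: Y2|exact: Y3].
elim=> [|k IH] kr; first by exists (fun=> set0); split.
have [Y [YX Ym YY]] := IH (ltnW kr).
pose k0 := Ordinal kr; pose S := \bigcup_(i : 'I_r | (i < k)%N) Y i.
have Sk : (#|S| <= r * m)%N.
  apply: (@leq_trans (\sum_(i : 'I_r | (i < k)%N) m)).
    rewrite /S; elim/big_rec2: _ => [|i a B ik ha]; first by rewrite cards0.
    by apply: leq_trans (leq_card_setU _ _) _; rewrite Ym // leq_add2l.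
  apply: (@leq_trans (\sum_(i : 'I_r) m)).
    by rewrite [leqRHS](bigID (fun i : 'I_r => (i < k)%N)) /= leq_addr.
  by rewrite sum_nat_const card_ord.
have Sw : weight (X k0) - #|S|%:R * rho <= weight (X k0 :&: common_nbrs S).
  apply: weight_common_nbrs => u /bigcupP[i ik ui].
  apply: le_trans (nJ i k0 u _ _); last 2 first.
  - by apply/eqP=> ik0; move: ik; rewrite ik0 ltnn.
  - exact: subsetP (XJ i) _ (subsetP (YX _ ik) _ ui).
  by apply: weight_sub; apply: setSD.
have [|Z ZX Zm] := @subset_of_card _ (X k0 :&: common_nbrs S) m.
  apply: card_ge_weight; apply: le_trans Sw; have := wX k0.
  have : #|S|%:R * rho <= (r * m)%:R * rho by rewrite ler_wpM2r // ler_nat.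
  lra.
exists (fun i : 'I_r => if (i < k)%N then Y i else Z).
have ltk (i : 'I_r) : (i < k.+1)%N -> ~~ (i < k)%N -> i = k0.
  rewrite ltnS -leqNgt => h1 h2; apply: val_inj; apply/eqP.
  by rewrite eqn_leq h1 h2.
have adjZ (i : 'I_r) u v : (i < k)%N -> u \in Y i -> v \in Z -> edge u v.
  move=> ik ui /(subsetP ZX); rewrite !inE => /andP[_ /forall_inP]; apply.
  by apply/bigcupP; exists i.
split=> [i ik1|i ik1|i j u v ik1 jk1 ij]; case: ifPn => ik.
- exact: YX.
- by rewrite (ltk _ ik1 ik); apply: subset_trans ZX (subsetIl _ _).
- exact: Ym.
- exact: Zm.
- case: ifPn => jk; first by move=> *; apply: (YY i j).
  exact: adjZ.
- case: ifPn => jk; first by move=> ui vj; rewrite edge_sym; apply: adjZ vj ui.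
  by case/eqP: ij; rewrite (ltk _ ik1 ik) (ltk _ jk1 jk).
Qed.

Lemma matching_join_turan_in_near_complete m s p (J : 'I_p.+1 -> {set G})
    (X : 'I_p.+1 -> {set G}) rho M i0 :
  (0 < s)%N -> (0 < p)%N -> 0 <= rho -> near_complete J rho ->
  (forall i, X i \subset J i) -> is_matching M -> size M = s ->
  (forall z j v, z \in ends M -> j != i0 -> v \in X j -> edge z v) ->
  (forall z, z \in ends M -> z \notin X i0) ->
  (forall i, (p.+1 * m)%:R * rho + m%:R * tau <= weight (X i)) ->
  has_subgraph G (matching_join_turan m s p).
Proof.
move=> s0 p0 rho0 nJ XJ mM sM MX MX0 wX.
have [Y [YX Ym YY]] := blowup_in_near_complete rho0 nJ XJ wX.
apply: (has_matching_join_turan (i0 := i0) (Y := Y) s0 p0 mM sM) => //.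
- by move=> z j v zM ji /(subsetP (YX j)); apply: MX.
- by move=> z zM; apply: contra (MX0 z zM); apply: subsetP.
- by move=> j; rewrite Ym.
Qed.

(** Each of the 2s ends excludes weight rho' from a class other than [J i0], and at most tau, namely
    itself, from [J i0]; what is left suffices for a greedy choice of the parts. *)
Lemma matching_join_turan_of_matching m s p (J : 'I_p.+1 -> {set G}) rho rho' M i0 :
  (0 < s)%N -> (0 < p)%N -> 0 <= rho -> 0 <= rho' -> near_complete J rho ->
  is_matching M -> size M = s ->
  (forall z j, z \in ends M -> j != i0 -> weight (J j :\: nbrs z) <= rho') ->
  (forall i, (2 * s)%:R * (rho' + tau) + (p.+1 * m)%:R * rho + m%:R * tau <= weight (J i)) ->
  has_subgraph G (matching_join_turan m s p).
Proof.
move=> s0 p0 rho0 rho'0 nJ mM sM MJ wJ.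
pose S := [set z in ends M].
have S2 : #|S| = (2 * s)%N.
  by rewrite cardsE (card_uniqP _) ?size_ends ?sM //; case/andP: mM.
have S2r : #|S|%:R * rho' <= (2 * s)%:R * (rho' + tau).
  by rewrite S2 ler_wpM2l ?ler0n // lerDl ltW.
pose X i := if i == i0 then J i :\: S else J i :&: common_nbrs S.
apply: (@matching_join_turan_in_near_complete m s p J X rho M i0) => //.
- by move=> i; rewrite /X; case: eqP => _; rewrite ?subsetDl ?subsetIl.
- move=> z j v zM /negbTE ji; rewrite /X ji !inE => /andP[_ /forall_inP]; apply.
  by rewrite inE.
- by move=> z zM; rewrite /X eqxx !inE zM.
- move=> i; have := wJ i; rewrite /X; case: eqP => [_|/eqP ii0] wi.
    have := weightD_ge (J i) S; have := weight_le_card S; rewrite S2.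
    have : (2 * s)%:R * tau <= (2 * s)%:R * (rho' + tau).
      by rewrite ler_wpM2l ?ler0n // lerDr.
    lra.
  apply: le_trans (@weight_common_nbrs S (J i) rho' _); first by lra.
  by move=> u; rewrite inE => uM; apply: MJ.
Qed.

(* Double counting the pairs (element of [B], neighbour in [A]) over the traces
   on [B] of the neighbourhoods of the vertices of [A]. *)
Lemma popular_trace A B (zeta : R) : (0 < #|B|)%N -> 0 < zeta -> weight A <= 1 ->
  (forall w, w \in B -> zeta <= weight (A :&: nbrs w)) ->
  exists B', [/\ B' \subset B, #|B|%:R * (zeta / 2) <= #|B'|%:R :> R &
                 zeta / 2 ^+ (#|B| + 2) <= weight (A :&: common_nbrs B')].
Proof.
move=> B0 z0 A1 hB; set b := #|B| in B0 *.
pose tr v := nbrs v :&: B.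
pose fib S := [set v in A | tr v == S].
pose big := [pred S : {set G} | (S \subset B) && (b%:R * (zeta / 2) <= #|S|%:R :> R)].
suff /existsP[S /andP[/andP[SB Sb] Sw]] :
    [exists S, big S && (zeta / 2 ^+ (b + 2) <= weight (fib S))].
  exists S; split=> //; apply: le_trans Sw _; apply: weight_sub.
  apply/subsetP=> v; rewrite !inE => /andP[-> /eqP <-] /=.
  by apply/forall_inP => w; rewrite !inE edge_sym => /andP[].
apply: contraT; rewrite negb_exists => /forallP noS.
have dc : \sum_(w in B) weight (A :&: nbrs w) = \sum_(v in A) x v * #|tr v|%:R.
  have e1 w : weight (A :&: nbrs w) = \sum_(v in A | edge w v) x v.
    by apply: eq_bigl => v; rewrite !inE.
  rewrite (eq_bigr _ (fun w _ => e1 w)).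
  under eq_bigr => w _ do rewrite big_mkcondr.
  rewrite exchange_big /=; apply: eq_bigr => v _.
  rewrite -big_mkcondr /= sumr_const mulr_natr; congr (_ *+ _).
  by apply: eq_card => w; rewrite !inE andbC edge_sym.
have lo : b%:R * zeta <= \sum_(v in A) x v * #|tr v|%:R.
  by rewrite -dc mulr_natl -sumr_const; apply: ler_sum.
have trb v : #|tr v|%:R <= b%:R :> R by rewrite ler_nat subset_leq_card // subsetIr.
(* Traces smaller than b zeta / 2 contribute at most b zeta / 2 in total. If no large trace is
   popular, the at most 2^b large ones weigh at most zeta / 4 together, and each counts at most b
   neighbours. *)
have hi : \sum_(v in A) x v * #|tr v|%:R <= b%:R * (zeta / 2) + b%:R * (zeta / 4).
  rewrite (bigID (fun v => big (tr v))) /= addrC; apply: lerD.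
    apply: (@le_trans _ _ (\sum_(v in A) x v * (b%:R * (zeta / 2)))).
      rewrite [leRHS](bigID (fun v => big (tr v))) /= -[leLHS]add0r; apply: lerD.
        apply: sumr_ge0 => v _; rewrite mulr_ge0 // mulr_ge0 ?ler0n //; lra.
      apply: ler_sum => v /andP[_]; rewrite subsetIr /= -ltNge => /ltW h.
      by rewrite ler_wpM2l.
    by rewrite -mulr_suml ler_piMl // mulr_ge0 ?ler0n //; lra.
  apply: (@le_trans _ _ (b%:R * \sum_(v in A | big (tr v)) x v)).
    rewrite mulr_sumr; apply: ler_sum => v _; rewrite mulrC ler_wpM2r //.
  rewrite ler_wpM2l ?ler0n //.
  rewrite (partition_big tr (mem (powerset B))) /=; last first.
    by move=> v /andP[_ /andP[h _]]; rewrite powersetE.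
  apply: (@le_trans _ _ (\sum_(S in powerset B) zeta / 2 ^+ (b + 2))).
    apply: ler_sum => S SB; have := noS S; rewrite negb_and; case/orP.
      move=> nb; rewrite big1 ?divr_ge0 ?exprn_ge0 ?ltW //.
      by move=> v /andP[/andP[_ h] /eqP tS]; rewrite /= -tS h in nb.
    rewrite -ltNge => /ltW; apply: le_trans.
    rewrite /weight [leRHS](eq_bigl (fun v => (v \in A) && (tr v == S))); last by move=> v; rewrite inE.
    rewrite [leRHS](bigID (fun v => big (tr v))) /= [X in X <= _](eq_bigl (fun v => ((v \in A) && (tr v == S)) && big (tr v))).
      by rewrite lerDl; apply: sumr_ge0.
    by move=> v; rewrite -andbA [big _ && _]andbC andbA.
  rewrite sumr_const card_powerset -/b -[_ *+ _]mulr_natr natrX exprD.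
  have p0 : (2 : R) ^+ b != 0 by rewrite expf_neq0 // pnatr_eq0.
  have -> : zeta / (2 ^+ b * 2 ^+ 2) * 2 ^+ b = zeta / 4 by field.
  by [].
have : 0 < b%:R * zeta by rewrite mulr_gt0 // ltr0n.
lra.
Qed.

End WeightedGraph.

(** * Blow-ups of cliques in weighted graphs *)

Section Blowup.
Variable G : sgraph.
Implicit Types (U X : {set G}) (P : nat -> {set G}).

(** Parts are indexed by [nat], so that an induction on [k] adds a part without changing the index
    type. *)
Definition is_blowup k t U (P : nat -> {set G}) :=
  [/\ forall i, (i < k) -> P i \subset U, forall i, (i < k) -> #|P i| = t &
      forall i j u v, (i < k) -> (j < k) -> i <> j ->
        u \in P i -> v \in P j -> edge u v].

Definition has_blowup k t U := exists P, is_blowup k t U P.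

(** The parts have at most k T vertices in all, hence at most 2^(k T) traces. Some t vertices of [X]
    share a trace; they form the new part, and the old parts shrink to t vertices of this trace. *)
Lemma blowup_extend k T t U P (X : {set G}) : (0 < t) -> is_blowup k T U P -> X \subset U ->
  (forall v i, v \in X -> (i < k) -> (t <= #|nbrs v :&: P i|)) ->
  (t * 2 ^ (k * T) <= #|X|) -> has_blowup k.+1 t U.
Proof.
move=> t0 [PU PT PP] XU XP tX.
pose D := \bigcup_(i < k) P i.
have Dk : (#|D| <= k * T).
  rewrite -[X in (_ <= X * _)]card_ord -sum_nat_const /D.
  elim/big_rec2: _ => [|i a B _ ha]; first by rewrite cards0.
  by apply: leq_trans (leq_card_setU _ _) _; rewrite PT // leq_add2l.
have [S fS] : exists S, (t <= #|[set v in X | nbrs v :&: D == S]|).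
  apply: (@pigeonhole_fibre _ _ X D); first by move=> v _; exact: subsetIr.
  by apply: leq_trans tX; rewrite leq_mul2l leq_exp2l ?Dk ?orbT.
have [Y YX Yt] := subset_of_card fS.
have [v0 v0Y] : exists v0, v0 \in Y by apply/set0Pn; rewrite -card_gt0 Yt.
have v0X := subsetP YX _ v0Y.
have SP i : (i < k) -> exists Z : {set G}, Z \subset S :&: P i /\ #|Z| = t.
  move=> ik; have [|Z ZS Zt] := @subset_of_card _ (S :&: P i) t; last by exists Z.
  move: v0X; rewrite inE => /andP[/XP/(_ ik) h /eqP <-].
  apply: leq_trans h _; apply: subset_leq_card; apply/subsetP=> u.
  rewrite !inE => /andP[-> ui]; rewrite ui andbT /=.
  by apply/bigcupP; exists (Ordinal ik).
have /all_sig[Z ZP] : forall i, {Z : {set G} | (i < k) -> Z \subset S :&: P i /\ #|Z| = t}.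
  move=> i; case: (ltnP i k) => [ik|ki]; last by exists set0.
  pose Q := fun Z : {set G} => (Z \subset S :&: P i) && (#|Z| == t).
  have /sigW[Z /andP[Z1 /eqP Z2]] : exists Z, Q Z.
    by have [Z [Z1 Z2]] := SP i ik; exists Z; rewrite /Q Z1 Z2 eqxx.
  by exists Z.
exists (fun i => if (i < k) then Z i else Y).
have adj i u v : (i < k) -> u \in Z i -> v \in Y -> edge u v.
  move=> ik ui /(subsetP YX); have [/subsetP/(_ _ ui) + _] := ZP i ik.
  by rewrite 2!inE edge_sym => /andP[uS _] /andP[_ /eqP h]; move: uS; rewrite -h !inE => /andP[].
split=> [i|i|i j u v].
- rewrite ltnS => ik; case: ifP => ik'.
    have [h _] := ZP i ik'; apply: subset_trans h (subset_trans (subsetIr _ _) (PU i ik')).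
  by apply: subset_trans YX _; apply/subsetP=> v; rewrite inE => /andP[/(subsetP XU)].
- by rewrite ltnS => ik; case: ifP => ik' //; have [] := ZP i ik'.
- rewrite !ltnS => ik jk ij; case: ifP => ik'; case: ifP => jk'.
  + have [/subsetP hi _] := ZP i ik'; have [/subsetP hj _] := ZP j jk'.
    move=> /hi; rewrite inE => /andP[_ ui] /hj; rewrite inE => /andP[_ vj].
    exact: PP ui vj.
  + exact: adj.
  + by move=> uY vZ; rewrite edge_sym; apply: adj vZ uY.
  + by case: ij; lia.
Qed.

End Blowup.

(** A weight, in units of tau, that suffices for k parts of size t. The first summand serves the
    previous stage, with larger parts; the second makes a fraction 1 / (2r) of the weight enough for
    the pigeonhole in [blowup_extend]. *)
Fixpoint es_threshold (r k t : nat) : nat :=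
  if k is k'.+1 then
    es_threshold r k' (8 * r * t) + 2 * r * (t * 2 ^ (k' * (8 * r * t)))
  else 1.

Section ErdosStone.
Local Open Scope ring_scope.
Variables (R : realFieldType) (G : sgraph) (x : G -> R) (tau : R).
Implicit Types (A B S U : {set G}) (u v : G).

Notation weight := (@weight R G x).

Hypothesis x_ge0 : forall v, 0 <= x v.
Hypothesis x_le : forall v, x v <= tau.
Hypothesis tau_gt0 : 0 < tau.

Definition missing_le U d := forall u, u \in U -> weight (U :\: nbrs u) <= d.

Lemma sum_weight_missing U A d : missing_le U d -> A \subset U ->
  \sum_(v in U) x v * #|A :\: nbrs v|%:R <= #|A|%:R * d.
Proof.
move=> Ud AU.
have -> : \sum_(v in U) x v * #|A :\: nbrs v|%:R = \sum_(u in A) weight (U :\: nbrs u).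
  have e1 u : weight (U :\: nbrs u) = \sum_(v in U | ~~ edge u v) x v.
    by apply: eq_bigl => v; rewrite !inE andbC.
  rewrite (eq_bigr _ (fun u _ => e1 u)).
  under [RHS]eq_bigr => w _ do rewrite big_mkcondr.
  rewrite exchange_big /=; apply: eq_bigr => v _.
  rewrite -big_mkcondr /= sumr_const mulr_natr; congr (_ *+ _).
  by apply: eq_card => w; rewrite !inE andbC edge_sym.
rewrite mulr_natl -sumr_const; apply: ler_sum => u uA.
exact: Ud (subsetP AU _ uA).
Qed.

(** A vertex of [U] with fewer than t neighbours in some part misses more than T - t vertices there,
    while the k T vertices of the parts miss weight at most d each. Double counting leaves weight g
    to the vertices with t neighbours in every part. *)
Lemma erdos_stone_step k T t U d g : (0 < t < T)%N -> missing_le U d -> 0 <= d ->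
  has_blowup k T U ->
  (k * T)%:R * d <= (T - t)%:R * (weight U - g) ->
  (t * 2 ^ (k * T))%:R * tau <= g -> has_blowup k.+1 t U.
Proof.
move=> /andP[t0 tT] Ud d0 [P bP] hg tg; have [PU PT PP] := bP.
pose X := [set v in U | [forall i : 'I_k, (t <= #|nbrs v :&: P i|)%N]].
have wX : g <= weight X.
  have XU : X \subset U by apply/subsetP=> v; rewrite inE => /andP[].
  suff h : (T - t)%:R * weight (U :\: X) <= (T - t)%:R * (weight U - g).
    move: h; rewrite ler_pM2l ?ltr0n ?subn_gt0 //.
    by have := weightID x U X; rewrite (setIidPr XU); lra.
  apply: le_trans hg.
  have s1 : \sum_(i < k) \sum_(v in U) x v * #|P i :\: nbrs v|%:R <= (k * T)%:R * d.
    rewrite natrM -mulrA mulr_natl -[X in _ *+ X]card_ord -sumr_const.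
    apply: ler_sum => i _; rewrite -(PT i) //.
    exact: sum_weight_missing (PU i _).
  apply: le_trans s1; rewrite exchange_big /= mulr_sumr.
  rewrite [leRHS](big_setID X) /= -[leLHS]add0r; apply: lerD.
    by do 2![apply: sumr_ge0 => *]; rewrite mulr_ge0 ?ler0n.
  apply: ler_sum => v; rewrite !inE => /andP[+ vU]; rewrite vU /= negb_forall => /existsP[i].
  rewrite -ltnNge => hi; rewrite (bigD1 i) //= mulrC.
  apply: (@le_trans _ _ (x v * #|P i :\: nbrs v|%:R)).
    rewrite ler_wpM2l // ler_nat cardsD (PT i) // [P i :&: _]setIC leq_sub2l //.
    exact: ltnW.
  by rewrite lerDl; apply: sumr_ge0 => *; rewrite mulr_ge0 ?ler0n.
apply: (blowup_extend t0 bP (X := X)).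
- by apply/subsetP=> v; rewrite inE => /andP[].
- by move=> v i; rewrite inE => /andP[_ /forallP h] ik; exact: h (Ordinal ik).
- by apply: (card_ge_weight x_le tau_gt0); apply: le_trans wX.
Qed.

Lemma erdos_stone r k t U d : (0 < r)%N -> (k <= r)%N -> (0 < t)%N ->
  missing_le U d -> 0 <= d -> d <= (r%:R^-1 + (4 * r ^ 2)%:R^-1) * weight U ->
  (es_threshold r k t)%:R * tau <= weight U -> has_blowup k t U.
Proof.
move=> r0 + + Ud d0 dU; elim: k t => [|k IH] s kr s0.
  by move=> _; exists (fun=> set0); split.
rewrite /=; set T := (8 * r * s)%N => cU.
have T0 : (0 < T)%N by rewrite !muln_gt0 r0.
have cU' : (es_threshold r k T)%:R * tau <= weight U.
  by apply: le_trans cU; rewrite ler_pM2r // ler_nat leq_addr.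
(* With T = 8 r s and g = weight U / (2r), the requirement is k T (1/r + 1/(4 r^2)) <= (T - s) (1 -
   1/(2r)), which holds since k + 1 <= r. *)
apply: (@erdos_stone_step k T s U d ((2 * r)%:R^-1 * weight U)) => //.
- by rewrite s0 /T /= -{1}[s]mul1n ltn_pmul2r //; lia.
- exact: IH (ltnW kr) T0 cU'.
- have U0 : 0 <= weight U by apply: weight_ge0.
  apply: (@le_trans _ _ ((k * T)%:R * ((r%:R^-1 + (4 * r ^ 2)%:R^-1) * weight U))).
    by rewrite ler_wpM2l ?ler0n.
  rewrite -[X in _ <= _ * (X - _)]mul1r -mulrBl !mulrA ler_wpM2r //.
  have k1 : k%:R + 1 <= r%:R :> R by rewrite natr1 ler_nat.
  have -> : (T - s)%:R = T%:R - s%:R :> R by rewrite natrB // /T; nia.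
  rewrite natrM /T !natrM.
  have r0' : (0 : R) < r%:R by rewrite ltr0n.
  have s0' : (0 : R) < s%:R by rewrite ltr0n.
  have k0' : (0 : R) <= k%:R by rewrite ler0n.
  move: (k%:R : R) (s%:R : R) (r%:R : R) k1 s0' r0' k0' => a b q k1 b0 q0 a0.
  have -> : a * (8%:R * q * b) * (q^-1 + (4%:R * (q * q))^-1) = b * (8 * a + 2 * a / q).
    by field; rewrite gt_eqF.
  have -> : (8%:R * q * b - b) * (1 - (2%:R * q)^-1) = b * (8 * q - 5 + (2 * q)^-1).
    by field; rewrite gt_eqF.
  rewrite ler_pM2l //.
  have : 0 <= (2 * q)^-1 by rewrite invr_ge0; lra.
  have : a / q <= 1 by rewrite ler_pdivrMr //; lra.
  lra.
- rewrite ler_pdivlMl ?ltr0n ?muln_gt0 //; apply: le_trans cU.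
  by rewrite mulrA -natrM ler_pM2r // ler_nat leq_addl.
Qed.
End ErdosStone.

(** * Stability *)

Lemma card_common_nbrs (R : realFieldType) (G : sgraph) (S A : {set G}) (rho : R) :
  (forall u, u \in S -> (#|A :\: nbrs u|%:R <= rho)%R) ->
  (#|A|%:R - #|S|%:R * rho <= #|A :&: common_nbrs S|%:R)%R.
Proof.
have e B : weight (fun _ : G => 1%R : R) B = #|B|%:R%R by rewrite /weight sumr_const.
move=> h; have /= := @weight_common_nbrs R G (fun=> 1%R) (fun=> ler01) S A rho.
by rewrite !e; apply=> u uS; rewrite e; exact: h.
Qed.

Section Stability.
Local Open Scope ring_scope.
Variables (R : realFieldType) (G : sgraph) (x : G -> R) (tau : R).
Implicit Types (A B S U : {set G}) (u v : G).

Notation weight := (@weight R G x).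

Hypothesis x_ge0 : forall v, 0 <= x v.
Hypothesis x_le : forall v, x v <= tau.
Hypothesis tau_gt0 : 0 < tau.

Variables (m s p : nat).
Hypothesis s_gt0 : (0 < s)%N.
Hypothesis sm : (2 * s <= m)%N.
Hypothesis p_gt0 : (0 < p)%N.
Hypothesis freeG : ~ has_subgraph G (matching_join_turan m s p).

Definition disjoint_family r (I : 'I_r -> {set G}) :=
  forall i j v, i != j -> v \in I i -> v \notin I j.

(** The ends of s disjoint edges in [A] number at most m and each miss at most t / (4m) of the other
    parts, so three quarters of these parts remain and F appears. Hence [A] has no such matching. *)
Lemma typed_class_cover t P i0 A : (4 * m <= t)%N ->
  is_blowup p.+1 t setT P -> (i0 <= p)%N ->
  (forall v, v \in A -> forall j, (j <= p)%N -> j != i0 ->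
    (4 * m * #|P j :\: nbrs v| <= t)%N) ->
  exists Z : {set G}, [/\ Z \subset A, (#|Z| <= 2 * s)%N & independent (A :\: Z)].
Proof.
move=> mt [_ PT PP] i0p AP.
have [[M [mM sM MA]]|//] := matching_or_cover A s.
case: freeG; pose S := [set z in ends M].
have m0 : (0 < m)%N by lia.
have Ss : (#|S| <= m)%N.
  by rewrite cardsE (leq_trans (card_size _)) // size_ends sM.
pose Y (j : 'I_p.+1) := if j == i0 :> nat then P j :\: S else P j :&: common_nbrs S.
apply: (@has_matching_join_turan _ m s p M (Ordinal (i0p : (i0 < p.+1)%N)) Y) => //.
- move=> z j v zM ji0; rewrite /Y -val_eqE /= in ji0 *; rewrite (negbTE ji0) !inE.
  by move=> /andP[_ /forall_inP]; apply; rewrite inE.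
- by move=> z zM; rewrite /Y /= eqxx !inE zM.
- move=> j; rewrite /Y; case: eqP => [_|/eqP ji].
    rewrite cardsD PT //; have := subset_leq_card (subsetIr (P j) S); lia.
  have h : #|P j|%:R - #|S|%:R * (t%:R / (4 * m)%:R) <= #|P j :&: common_nbrs S|%:R :> R.
    apply: card_common_nbrs => u; rewrite inE => /MA uA.
    rewrite ler_pdivlMr ?ltr0n ?muln_gt0 // -natrM ler_nat mulnC.
    exact: AP uA _ (ltn_ord j) ji.
  rewrite PT // in h.
  have : #|S|%:R * (t%:R / (4 * m)%:R) <= m%:R * (t%:R / (4 * m)%:R) :> R.
    by rewrite ler_wpM2r ?divr_ge0 ?ler0n ?ler_nat.
  have -> : m%:R * (t%:R / (4 * m)%:R) = t%:R / 4 :> R.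
    by rewrite natrM; field; rewrite pnatr_eq0 -lt0n.
  rewrite -(ler_nat R); have : (4 * m)%:R <= t%:R :> R by rewrite ler_nat.
  rewrite natrM; have : 0 <= m%:R :> R by rewrite ler0n.
  lra.
- move=> j k u v jk; rewrite /Y => uj vk.
  have {}uj : u \in P j by move: uj; case: ifP => _; rewrite inE => /andP[].
  have {}vk : v \in P k by move: vk; case: ifP => _; rewrite inE => /andP[].
  by apply: PP uj vk => //; apply/eqP; rewrite val_eqE.
Qed.

(** A vertex with 2m neighbours in every part is [good]; there are few of these, as otherwise a
    further part could be added. Any other vertex misses nearly all of one part, and is [typed] if
    it misses little of the others. The three lines of the bound come from the untyped vertices,
    from [good] (which also enters the estimate of the former), and from the covers of the edges
    within each type. *)
Lemma stability_classes t U d : (8 * m <= t)%N -> missing_le x U d ->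
  has_blowup p.+1 t U ->
  exists I : 'I_p.+1 -> {set G},
    [/\ forall i, I i \subset U, forall i, independent (I i), disjoint_family I &
        weight (U :\: \bigcup_i I i) <=
          (4 * m)%:R * (p.+1%:R * d - weight U + (2 * m)%:R * weight U / t%:R) +
          (4 * m + 1)%:R * (2 * m * 2 ^ (p.+1 * t))%:R * tau +
          (p.+1 * (2 * s))%:R * tau].
Proof.
move=> mt Ud [P bP]; have [PU PT PP] := bP; set r := p.+1 in bP PU PT PP *.
have m0 : (0 < m)%N by lia.
have t0 : (0 < t)%N by lia.
have bPT : is_blowup r t setT P by split=> // i _; exact: subsetT.
pose good := [set v in U | [forall i : 'I_r, (2 * m <= #|nbrs v :&: P i|)%N]].
have goodn : (#|good| <= 2 * m * 2 ^ (r * t))%N.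
  rewrite leqNgt; apply/negP => /ltnW big; case: freeG.
  have [|||Q [_ QT QQ]] := @blowup_extend G r t (2 * m) U P good _ bP _ _ big.
  - by rewrite muln_gt0.
  - by apply/subsetP=> v; rewrite inE => /andP[].
  - by move=> v i; rewrite inE => /andP[_ /forallP h] ir; exact: h (Ordinal ir).
  apply: (@has_matching_join_turan_blowup _ m s p (fun i => Q i)) => //.
    by move=> i j u v ij; apply: QQ => //; apply/eqP; rewrite val_eqE.
  by move=> j; rewrite QT.
pose typed (i : 'I_r) := [set v in U | (#|nbrs v :&: P i| < 2 * m)%N &&
   [forall j : 'I_r, (j != i) ==> (4 * m * #|P j :\: nbrs v| <= t)%N]].
pose T := \bigcup_i typed i.
have TU : T \subset U.
  by apply/bigcupsP=> i _; apply/subsetP=> v; rewrite inE => /andP[].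
have Pmiss v (i : 'I_r) : (#|P i :\: nbrs v| + #|nbrs v :&: P i|)%N = t.
  by rewrite -[RHS](PT i) // -(cardsID (nbrs v) (P i)) addnC setIC.
pose miss v : R := \sum_(i < r) #|P i :\: nbrs v|%:R.
have miss_ge v (i : 'I_r) : #|P i :\: nbrs v|%:R <= miss v.
  by rewrite /miss (bigD1 i) //= lerDl; apply: sumr_ge0 => *; rewrite ler0n.
have miss_ge2 v (i j : 'I_r) : i != j ->
    #|P i :\: nbrs v|%:R + #|P j :\: nbrs v|%:R <= miss v.
  move=> ij; rewrite /miss (bigD1 i) //= (bigD1 j) 1?eq_sym //= addrA lerDl.
  by apply: sumr_ge0 => *; rewrite ler0n.
have miss0 v : 0 <= miss v by apply: sumr_ge0 => *; rewrite ler0n.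
have total : \sum_(v in U) x v * miss v <= (r * t)%:R * d.
  under eq_bigr => v _ do rewrite mulr_sumr.
  rewrite exchange_big /= natrM -mulrA mulr_natl -[X in _ *+ X]card_ord -sumr_const.
  apply: ler_sum => i _; rewrite -(PT i) //.
  exact: (sum_weight_missing Ud (PU i _)).
have mT v : v \in T -> (t%:R - (2 * m)%:R : R) <= miss v.
  move=> /bigcupP[i _]; rewrite inE => /and3P[_ h _]; apply: le_trans (miss_ge v i).
  by rewrite -natrB ?ler_nat; have := Pmiss v i; lia.
have mO v : v \in U :\: T -> v \notin good ->
    (t%:R - (2 * m)%:R + t%:R / (4 * m)%:R : R) <= miss v.
  rewrite inE => /andP[vT vU]; rewrite inE vU /= negb_forall => /existsP[i].
  rewrite -ltnNge => hi.
  have : ~~ [forall j : 'I_r, (j != i) ==> (4 * m * #|P j :\: nbrs v| <= t)%N].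
    apply: contra vT => h; apply/bigcupP; exists i => //.
    by rewrite inE vU hi h.
  rewrite negb_forall => /existsP[j]; rewrite negb_imply -ltnNge => /andP[ji hj].
  apply: le_trans (miss_ge2 v _ _ ji); rewrite addrC; apply: lerD.
    rewrite ler_pdivrMr ?ltr0n ?muln_gt0 // -natrM ler_nat mulnC; exact: ltnW.
  by rewrite -natrB ?ler_nat; have := Pmiss v i; lia.
pose O := (U :\: T) :\: good.
(* Every vertex outside [good] misses at least t - 2m vertices of the parts, and one in [O] misses t
   / (4m) more. As [total] is only slightly above t, this surplus bounds the weight of [O]. *)
have hO : weight O * (t%:R / (4 * m)%:R) <=
   (r * t)%:R * d - (weight U - weight good) * (t%:R - (2 * m)%:R).
  have split3 : weight U <= weight good + weight (T :\: good) + weight O.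
    rewrite (weightID x U good) -addrA; apply: lerD.
      by apply: weight_sub => //; exact: subsetIr.
    rewrite (weightID x (U :\: good) T); apply: lerD; apply: weight_sub => //.
      by rewrite setIC setIDA; apply: setSD; exact: subsetIl.
    by rewrite /O setDDl setUC -setDDl.
  have a1 : weight (T :\: good) * (t%:R - (2 * m)%:R) +
      weight O * (t%:R - (2 * m)%:R + t%:R / (4 * m)%:R) <= (r * t)%:R * d.
    apply: le_trans total.
    rewrite [leRHS](big_setID T) /= (setIidPr TU); apply: lerD.
      rewrite [leRHS](big_setID good) /= -[leLHS]add0r; apply: lerD.
        by apply: sumr_ge0 => v _; rewrite mulr_ge0.
      rewrite mulr_suml; apply: ler_sum => v; rewrite inE => /andP[_ /mT h].
      by rewrite ler_wpM2l.
    rewrite [leRHS](big_setID good) /= -[leLHS]add0r; apply: lerD.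
      by apply: sumr_ge0 => v _; rewrite mulr_ge0.
    rewrite mulr_suml; apply: ler_sum => v; rewrite /O in_setD => /andP[vg vUT].
    by rewrite ler_wpM2l // mO.
  have tm : 0 <= t%:R - (2 * m)%:R :> R by rewrite subr_ge0 ler_nat; lia.
  have := ler_wpM2r tm split3; lra.
have typedP i : exists Z : {set G}, [/\ Z \subset typed i, (#|Z| <= 2 * s)%N & independent (typed i :\: Z)].
  apply: (@typed_class_cover t P i) => //; first by lia.
    by rewrite -ltnS.
  move=> v; rewrite inE => /and3P[_ _ /forallP h] j jr ji.
  by have /implyP := h (Ordinal (jr : (j < r)%N)); apply; rewrite -val_eqE.
have /all_sig[Z ZP] : forall i, {Z : {set G} |
   [/\ Z \subset typed i, (#|Z| <= 2 * s)%N & independent (typed i :\: Z)]}.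
  move=> i; have /sigW[Z /and3P[Z1 Z2 /forallP Z3]] : exists Z : {set G},
      [&& Z \subset typed i, (#|Z| <= 2 * s)%N &
          [forall u, forall v, (u \in typed i :\: Z) ==> (v \in typed i :\: Z) ==> ~~ edge u v]].
    have [Z [Z1 Z2 Z3]] := typedP i; exists Z; rewrite Z1 Z2 /=.
    by apply/forallP => u; apply/forallP => v; apply/implyP => ui; apply/implyP; exact: Z3.
  exists Z; split=> // u v ui vi.
  by have /forallP/(_ v)/implyP/(_ ui)/implyP/(_ vi) := Z3 u.
exists (fun i => typed i :\: Z i); split.
- by move=> i; apply/subsetP=> v; rewrite !inE => /and3P[].
- by move=> i; have [] := ZP i.
- move=> i j v ij; rewrite !inE => /and4P[_ _ h _]; apply/negP => /and4P[_ _ _ /forallP/(_ i)].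
  rewrite ij /= => h'; have := Pmiss v i; move: h h' mt.
  have : (4 * #|P i :\: nbrs v| <= 4 * m * #|P i :\: nbrs v|)%N.
    by rewrite leq_mul2r leq_pmulr ?orbT.
  by lia.
have wZ : weight (\bigcup_i Z i) <= (r * (2 * s))%:R * tau.
  apply: (@le_trans _ _ (\sum_(i < r) (2 * s)%:R * tau)).
    apply: le_trans (weight_bigcup_le _ _ _) _ => //.
    apply: ler_sum => i _; apply: le_trans (weight_le_card x_le _) _.
    by rewrite ler_pM2r // ler_nat; have [] := ZP i.
  by rewrite sumr_const card_ord -[_ *+ r]mulr_natl mulrA -natrM.
have wg : weight good <= (2 * m * 2 ^ (r * t))%:R * tau.
  by apply: le_trans (weight_le_card x_le _) _; rewrite ler_pM2r // ler_nat.
have cover : weight (U :\: \bigcup_i (typed i :\: Z i)) <= weight O + weight good + weight (\bigcup_i Z i).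
  apply: le_trans (lerD (weightU_le x_ge0 O good) (lexx _)).
  apply: le_trans (weightU_le x_ge0 _ _); apply: weight_sub => //.
  apply/subsetP=> v; rewrite in_setD => /andP[nv vU]; rewrite !in_setU in_setD in_setD vU andbT.
  case vg: (v \in good) => //=; case vT: (v \in T) => //=.
  move/bigcupP: vT => [i _ vi]; apply/bigcupP; exists i => //.
  by apply: contraR nv => vZ; apply/bigcupP; exists i; rewrite // inE vZ.
apply: le_trans cover _.
have t0' : 0 < t%:R :> R by rewrite ltr0n.
have m0' : 0 < m%:R :> R by rewrite ltr0n.
set gg := (2 * m * 2 ^ (r * t))%:R in wg *.
have wO : weight O <= (4 * m)%:R * (r%:R * d - weight U + (2 * m)%:R * weight U / t%:R + weight good).
  rewrite !natrM in hO *.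
  have w0 : 0 <= weight good by apply: weight_ge0.
  rewrite -(@ler_pM2r _ (t%:R / (4%:R * m%:R))); last by rewrite divr_gt0 // mulr_gt0.
  apply: le_trans hO _.
  set a := (r%:R : R); set b := (t%:R : R) in t0' *; set c := (m%:R : R) in m0' *.
  have -> : 4%:R * c * (a * d - weight U + 2%:R * c * weight U / b + weight good) *
     (b / (4%:R * c)) = (a * d - weight U + weight good) * b + 2 * c * weight U.
    by field; rewrite !gt_eqF.
  have : 0 <= c * weight good by rewrite mulr_ge0 // ltW.
  lra.
have : (4 * m)%:R * weight good <= (4 * m)%:R * (gg * tau) by rewrite ler_wpM2l ?ler0n.
rewrite mulrDr in wO.
have -> : (4 * m + 1)%:R * gg * tau = (4 * m)%:R * (gg * tau) + gg * tau.
  by rewrite natrD mulrDl mul1r mulrDl mulrA.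
lra.
Qed.
End Stability.

(** * Absorbing all but boundedly many vertices *)

(** After p + 1 selections that each keep a fraction 1 / (32 (p + 1) m), a pool of this size still
    has 2m vertices. *)
Definition refine_pool (m p : nat) : nat := 2 * m * (32 * p.+1 * m) ^ p.+1.
(** The inverse of the error at which common neighbourhoods of weight zeta / 2^(pool + 2), with zeta
    = 1 / (16 (p + 1) m), still contain a blow-up with parts of size 2m. *)
Definition refine_scale (m p : nat) : nat :=
  64 * p.+1 ^ 2 * m ^ 2 * 2 ^ (refine_pool m p + 2).
Definition refine_rest (m s p : nat) : nat := refine_pool m p + p.+1 * (2 * s).

Section Refinement.
Local Open Scope ring_scope.
Variables (R : realFieldType) (G : sgraph) (x : G -> R) (tau : R).
Implicit Types (A B S U : {set G}) (u v : G).

Notation weight := (@weight R G x).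

Hypothesis x_ge0 : forall v, 0 <= x v.
Hypothesis x_le : forall v, x v <= tau.
Hypothesis tau_gt0 : 0 < tau.

Variables (m s p : nat).
Hypothesis s_gt0 : (0 < s)%N.
Hypothesis sm : (2 * s <= m)%N.
Hypothesis p_gt0 : (0 < p)%N.
Hypothesis freeG : ~ has_subgraph G (matching_join_turan m s p).

Notation r := p.+1.

(* The last field leaves a vertex of the class [I i], all of which it misses, with
   at most [eta] missing in the other classes. *)
Record near_turan (U : {set G}) (I : 'I_r -> {set G}) (eta : R) : Prop := NearTuran {
  nt_sub : forall i, I i \subset U;
  nt_indep : forall i, independent (I i);
  nt_disj : disjoint_family I;
  nt_missing : forall v i, v \in U -> weight (U :\: nbrs v) <= weight (I i) + eta }.

Lemma near_turan_complete U I eta : near_turan U I eta -> near_complete x I eta.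
Proof.
case=> IU iI dI mI i j v ij vi.
have := mI v i (subsetP (IU i) _ vi).
suff : weight (I i) + weight (I j :\: nbrs v) <= weight (U :\: nbrs v) by lra.
rewrite (weightID x (U :\: nbrs v) (I i)); apply: lerD; apply: weight_sub => //.
  apply/subsetP=> u ui; rewrite !inE ui (subsetP (IU i)) // !andbT.
  exact: (iI i).
apply/subsetP=> u; rewrite !inE => /andP[-> uj]; rewrite (subsetP (IU j)) //= !andbT.
by apply: (dI j i _ _ uj); rewrite eq_sym.
Qed.

(** [nt_missing] holds for every index, not only for the class of the vertex: a vertex of [I j]
    misses all of [I j], and by the field at [i] it misses at most [weight (I i) + eta]. *)
Lemma near_turan_balanced U I eta i j : near_turan U I eta -> 0 <= eta ->
  weight (I j) <= weight (I i) + eta.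
Proof.
case=> IU iI dI mI eta0; have [->|/set0Pn[v vj]] := eqVneq (I j) set0.
  by rewrite weight0 addr_ge0 // weight_ge0.
apply: le_trans (mI v i (subsetP (IU j) _ vj)); apply: weight_sub => //.
by apply/subsetP=> u uj; rewrite !inE (subsetP (IU j)) // andbT (iI j).
Qed.

(** [popular_trace] is applied to the classes in turn. Each application keeps a fraction zeta / 2 of
    the set, and shrinking the set only enlarges the common neighbourhoods obtained before. *)
Lemma popular_traces (I : 'I_r -> {set G}) B (zeta : R) :
  0 < zeta <= 2 -> (forall i, weight (I i) <= 1) ->
  (forall w i, w \in B -> zeta <= weight (I i :&: nbrs w)) -> (0 < #|B|)%N ->
  exists B', [/\ B' \subset B, #|B|%:R * (zeta / 2) ^+ r <= #|B'|%:R :> R &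
    forall i, zeta / 2 ^+ (#|B| + 2) <= weight (I i :&: common_nbrs B')].
Proof.
move=> /andP[z0 z2] I1 hB B0.
suff /(_ r (leqnn r))[B' [B1 B2 B3]] : forall k, (k <= r)%N ->
    exists B', [/\ B' \subset B, #|B|%:R * (zeta / 2) ^+ k <= #|B'|%:R :> R &
    forall i : 'I_r, (i < k)%N -> zeta / 2 ^+ (#|B| + 2) <= weight (I i :&: common_nbrs B')].
  by exists B'; split=> // i; apply: B3.
elim=> [|k IH] kr; first by exists B; rewrite expr0 mulr1; split.
have [B1 [B1B B1k B1w]] := IH (ltnW kr).
have B10 : (0 < #|B1|)%N.
  rewrite -(ltr_nat R); apply: lt_le_trans B1k; rewrite mulr_gt0 ?ltr0n // exprn_gt0 //.
  by lra.
have [|B2 [B2B B2k B2w]] := @popular_trace R G x x_ge0 (I (Ordinal kr)) B1 zeta B10 z0 (I1 _).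
  by move=> w wB; apply: hB; apply: (subsetP B1B).
exists B2; split; first exact: subset_trans B2B B1B.
  by apply: le_trans B2k; rewrite exprSr mulrA ler_wpM2r //; lra.
have mono : zeta / 2 ^+ (#|B| + 2) <= zeta / 2 ^+ (#|B1| + 2).
  rewrite ler_pM2l // lef_pV2 ?posrE ?exprn_gt0 // ler_weXn2l ?ler1n //.
  by rewrite leq_add2r subset_leq_card.
move=> i; rewrite ltnS leq_eqVlt => /orP[/eqP ik|ik].
  have -> : i = Ordinal kr by apply: val_inj.
  exact: le_trans mono B2w.
apply: le_trans (B1w _ ik) _; apply: weight_sub => //.
apply: setIS; apply/subsetP=> u; rewrite !inE => /forall_inP h.
by apply/forall_inP => w wB; apply: h; apply: (subsetP B2B).
Qed.

(** In a larger pool, [popular_traces] finds 2m vertices with heavy common neighbourhoods in all the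
    classes. A blow-up found inside these neighbourhoods, with the 2m vertices as a further part,
    has p + 2 parts and so contains F. *)
Lemma pool_bound U I eta : near_turan U I eta -> 0 <= eta ->
  (forall i, weight (I i) <= 1) ->
  let zeta : R := (16 * r * m)%:R^-1 in
  (refine_scale m p)%:R * (eta + tau) <= 1 ->
  (#|[set v in U | [forall i, zeta <= weight (I i :&: nbrs v)]%R]| < refine_pool m p)%N.
Proof.
move=> nt eta0 I1 zeta De; rewrite ltnNge; apply/negP => big.
have m0 : (0 < m)%N by lia.
set C := refine_pool m p in big De *.
have C0 : (0 < C)%N by rewrite /C /refine_pool !muln_gt0 m0 expn_gt0 !muln_gt0 m0.
have [B BX BC] := subset_of_card big.
have rm0 : (0 : R) < (16 * r * m)%:R by rewrite ltr0n !muln_gt0.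
have z0 : 0 < zeta by rewrite invr_gt0.
have z1 : zeta <= 1 by rewrite invf_le1 // ler1n !muln_gt0.
have [|||B' [B'B B'k B'w]] := @popular_traces I B zeta _ I1.
- by rewrite z0; lra.
- by move=> w i /(subsetP BX); rewrite inE => /andP[_ /forallP].
- by rewrite BC.
have [|W WB Wm] := @subset_of_card _ B' (2 * m).
  rewrite -(ler_nat R); apply: le_trans B'k.
  have -> : zeta / 2 = (32 * r * m)%:R^-1 :> R.
    by rewrite /zeta -invfM -natrM; congr (_%:R^-1); lia.
  rewrite BC /C /refine_pool (natrM _ (2 * m)) natrX -mulrA -exprMn mulfV ?expr1n ?mulr1 //.
  by rewrite pnatr_eq0 -lt0n !muln_gt0.
pose X i := I i :&: common_nbrs W.
have nc := near_turan_complete nt.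
have [||||Y [YX Ym YY]] := @blowup_in_near_complete R G x tau x_ge0 x_le tau_gt0 r (2 * m) I X eta.
- by [].
- by [].
- by move=> i; exact: subsetIl.
- move=> i; apply: (@le_trans _ _ (zeta / 2 ^+ (#|B| + 2))).
    rewrite BC /zeta -invfM -natrX -natrM -[leRHS]mul1r ler_pdivlMr ?ltr0n ?muln_gt0 ?m0 ?expn_gt0 //.
    apply: le_trans De.
    apply: (@le_trans _ _ ((r * (2 * m))%:R * (eta + tau) * (16 * r * m * 2 ^ (C + 2))%:R)).
      rewrite ler_wpM2r ?ler0n // mulrDr lerD2l ler_pM2r // ler_nat; lia.
    rewrite mulrAC -natrM; apply: ler_wpM2r; first by rewrite addr_ge0 // ltW.
    rewrite ler_nat /refine_scale -/C !mulnA leq_mul2r; apply/orP; right.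
    nia.
  apply: le_trans (B'w i) _; apply: weight_sub => //; apply: setIS.
  apply/subsetP=> u; rewrite !inE => /forall_inP h.
  by apply/forall_inP => w wB; apply: h; apply: (subsetP WB).
case: freeG.
apply: (@has_matching_join_turan_blowup _ m s p
   (fun i => if unlift ord_max i is Some j then Y j else W)) => //.
- have adj i u v : u \in Y i -> v \in W -> edge v u.
    by move=> /(subsetP (YX i)); rewrite !inE => /andP[_ /forall_inP]; apply.
  move=> i j u v ij; case: unliftP => [i' ii'|ii']; case: unliftP => [j' jj'|jj'].
  + by apply: YY; apply: contraNneq ij => h; rewrite ii' jj' h.
  + by move=> ui vW; rewrite edge_sym; apply: adj ui vW.
  + by move=> uW vj; apply: adj vj uW.
  + by rewrite ii' jj' eqxx in ij.
- by move=> j; case: unliftP => [j' _|_]; rewrite ?Ym ?Wm.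
Qed.

(* Every vertex outside a bounded pool sees almost nothing of one class and
   almost everything of the others, so it can be added to that class. *)
Lemma near_turan_refine U I eta : near_turan U I eta -> 0 <= eta -> weight U <= 1 ->
  (refine_scale m p)%:R * (eta + tau) <= 1 ->
  (forall i, (2 * r)%:R^-1 <= weight (I i)) ->
  exists J : 'I_r -> {set G},
    near_turan U J (eta + (2 * s)%:R * tau) /\
    (#|U :\: \bigcup_i J i| <= refine_rest m s p)%N.
Proof.
move=> nt eta0 U1 De wI; have [IU iI dI mI] := nt.
have m0 : (0 < m)%N by lia.
have I1 i : weight (I i) <= 1 by apply: le_trans U1; exact: weight_sub.
set zeta : R := (16 * r * m)%:R^-1.
pose B := [set v in U | [forall i, zeta <= weight (I i :&: nbrs v)]].
have Bc : (#|B| < refine_pool m p)%N by apply: pool_bound nt eta0 I1 De.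
have z0 : 0 < zeta by rewrite invr_gt0 ltr0n !muln_gt0.
have m1 : 1 <= m%:R :> R by rewrite ler1n.
have r1 : 2 <= r%:R :> R by rewrite ler_nat.
have zE : m%:R * zeta = (16 * r%:R)^-1.
  by rewrite /zeta !natrM; field; rewrite !gt_eqF //; lra.
have De' : (16 * r%:R) * (r%:R * m%:R) * (eta + tau) * 4 <= 1 :> R.
  apply: le_trans De.
  have -> : (16 * r%:R) * (r%:R * m%:R) * (eta + tau) * 4 = (64 * r ^ 2 * m)%:R * (eta + tau).
    by rewrite !natrM; ring.
  apply: ler_wpM2r; first by rewrite addr_ge0 // ltW.
  rewrite ler_nat /refine_scale -[leqLHS]muln1; apply: leq_mul; last by rewrite expn_gt0.
  by rewrite leq_mul2l; apply/orP; right; rewrite -{1}[m]muln1 leq_mul.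
have De2 : r%:R * m%:R * (eta + tau) * 4 <= (16 * r%:R)^-1.
  by rewrite -[leRHS]mul1r ler_pdivlMr; lra.
have r16 : 0 < (16 * r%:R)^-1 :> R by rewrite invr_gt0; lra.
have xiE : (2 * r)%:R^-1 = 8 * (16 * r%:R)^-1 :> R.
  by rewrite natrM; field; rewrite gt_eqF //; lra.
(* With q = 1 / (16 r), zeta is q / m and every class weighs at least 8 q, so a class survives the
   loss of weight zeta to each of m vertices. *)
move: (16 * r%:R)^-1 zE De2 r16 xiE => q zE De2 r16 xiE.
have rme : 0 <= m%:R * (eta + tau) by rewrite mulr_ge0 ?addr_ge0 // ?ltW //; lra.
have rme2 : 2 * (m%:R * (eta + tau)) <= r%:R * (m%:R * (eta + tau)) by rewrite ler_wpM2r.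
have sm' : (2 * s)%:R <= m%:R :> R by rewrite ler_nat.
(* Outside the pool [B], each vertex of [U] lies in some [V i]. By [other] it misses little of the
   remaining classes, which makes the sets [V i] disjoint. *)
pose V i := [set v in U | weight (I i :&: nbrs v) < zeta].
have other v i j : v \in V i -> j != i -> weight (I j :\: nbrs v) <= eta + zeta.
  rewrite inE => /andP[vU vi] ji; have := mI v i vU.
  suff : weight (I i :\: nbrs v) + weight (I j :\: nbrs v) <= weight (U :\: nbrs v).
    by have := weightID x (I i) (nbrs v); lra.
  rewrite (weightID x (U :\: nbrs v) (I i)); apply: lerD; apply: weight_sub => //.
    by apply/subsetP=> u; rewrite !inE => /andP[-> ui]; rewrite ui (subsetP (IU i)).
  apply/subsetP=> u; rewrite !inE => /andP[-> uj]; rewrite (subsetP (IU j)) //= !andbT.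
  exact: dI uj.
have V_disj : disjoint_family V.
  move=> i j v ij vi; apply/negP; rewrite inE => /andP[_ vj].
  rewrite eq_sym in ij; have h1 := other v i j vi ij; have h2 := weightID x (I j) (nbrs v).
  have := wI j; rewrite xiE.
  have : 0 <= (m%:R - 1) * eta by rewrite mulr_ge0 ?subr_ge0.
  have : 0 <= m%:R * tau by rewrite mulr_ge0 ?ler0n // ltW.
  have : 0 <= (m%:R - 1) * zeta by rewrite mulr_ge0 ?subr_ge0 // ltW.
  lra.
have IV i : I i \subset V i.
  apply/subsetP=> v vi; rewrite inE (subsetP (IU i)) //=.
  have -> : I i :&: nbrs v = set0.
    by apply/setP=> u; rewrite !inE; case ui: (u \in I i) => //=; apply/negbTE/(iI i).
  by rewrite weight0.
(* By [other], s disjoint edges inside [V i] would complete to a copy of F, so 2s vertices cover all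
   edges of [V i]. *)
have VP i : exists Z : {set G},
    [&& Z \subset V i, (#|Z| <= 2 * s)%N &
        [forall u, forall v, (u \in V i :\: Z) ==> (v \in V i :\: Z) ==> ~~ edge u v]].
  have [[M [mM sM MA]]|[Z [Z1 Z2 Z3]]] := matching_or_cover (V i) s; last first.
    exists Z; rewrite Z1 Z2 /=.
    by apply/forallP => u; apply/forallP => v; apply/implyP => ui; apply/implyP; exact: Z3.
  case: freeG.
  apply: (@matching_join_turan_of_matching R G x tau x_ge0 x_le tau_gt0 m s p I eta (eta + zeta) M i) => //.
  - by rewrite addr_ge0 // ltW.
  - exact: near_turan_complete nt.
  - by move=> z j /MA zV ji; apply: other zV ji.
  - move=> j; apply: le_trans (wI j); rewrite xiE.
    have : (2 * s)%:R * (eta + zeta + tau) <= m%:R * (eta + zeta + tau).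
      by rewrite ler_wpM2r // !addr_ge0 // ltW.
    have : 0 <= m%:R * tau by rewrite mulr_ge0 ?ler0n // ltW.
    have : 0 <= m%:R * eta by rewrite mulr_ge0 ?ler0n // ltW.
    have : 0 <= r%:R * m%:R * tau by rewrite mulr_ge0 ?mulr_ge0 ?ler0n // ltW.
    rewrite natrM; lra.
have /all_sig[Z ZP] : forall i, {Z : {set G} | [&& Z \subset V i, (#|Z| <= 2 * s)%N &
        [forall u, forall v, (u \in V i :\: Z) ==> (v \in V i :\: Z) ==> ~~ edge u v]]}.
  by move=> i; apply: sigW.
exists (fun i => V i :\: Z i); split.
  split.
  - by move=> i; apply/subsetP=> v; rewrite !inE => /and3P[].
  - move=> i u v ui vi; have /and3P[_ _ /forallP/(_ u)/forallP/(_ v)] := ZP i.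
    by rewrite ui vi.
  - by move=> i j v ij; rewrite in_setD => /andP[_ vi]; rewrite in_setD (negbTE (V_disj _ _ _ ij vi)) andbF.
  - move=> v i vU; apply: le_trans (mI v i vU) _.
    have /and3P[_ Zs _] := ZP i.
    have h1 : weight (I i) - weight (Z i) <= weight (V i :\: Z i).
      apply: le_trans (weightD_ge x_ge0 _ _) _; apply: weight_sub => //.
      exact: setSD.
    have h2 : weight (Z i) <= (2 * s)%:R * tau.
      by apply: le_trans (weight_le_card x_le _) _; rewrite ler_pM2r // ler_nat.
    lra.
apply: (@leq_trans #|B :|: \bigcup_i Z i|).
  apply: subset_leq_card; apply/subsetP=> v; rewrite in_setD => /andP[vn vU].
  rewrite in_setU; case vB: (v \in B) => //=.
  move: vB; rewrite inE vU /= => /negbT; rewrite negb_forall => /existsP[i]; rewrite -ltNge => vi.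
  apply/bigcupP; exists i => //; apply: contraR vn => vZ; apply/bigcupP; exists i => //.
  by rewrite !inE vZ vU.
apply: leq_trans (leq_card_setU _ _) _; apply: leq_add; first exact: ltnW.
apply: (@leq_trans (\sum_(i : 'I_r) 2 * s)).
  elim/big_rec2: _ => [|i a A _ ha]; first by rewrite cards0.
  by apply: leq_trans (leq_card_setU _ _) _; rewrite leq_add //; have /and3P[] := ZP i.
by rewrite sum_nat_const card_ord.
Qed.
End Refinement.

(** * Structure under a weighted minimum degree condition *)

Section MinDegree.
Local Open Scope ring_scope.

Lemma min_degree_structure (m s p L : nat) :
  (0 < s)%N -> (2 * s <= m)%N -> (0 < p)%N -> (0 < L)%N ->
  exists E D : nat, [/\ (0 < E)%N, (0 < D)%N &
  forall (R : realFieldType) (G : sgraph) (x : G -> R) (tau : R) (U : {set G}),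
    ~ has_subgraph G (matching_join_turan m s p) ->
    (forall v, 0 <= x v) -> (forall v, x v <= tau) -> 0 < tau -> D%:R * tau <= 1 ->
    weight x U = 1 -> missing_le x U (p.+1%:R^-1 + E%:R^-1) ->
    exists J : 'I_p.+1 -> {set G},
      near_turan x U J (L%:R^-1) /\ (#|U :\: \bigcup_i J i| <= refine_rest m s p)%N].
Proof.
move=> s0 sm p0 L0; have m0 : (0 < m)%N by lia.
pose r := p.+1.
(* The error budget is h = 1 / H. The choices of [t] and [E] make 8 m^2 / t equal to h / 8 and 40 m
   r^2 / E equal to h, and [C] collects the multiples of tau. Introducing them through equations
   keeps them opaque to arithmetic. *)
have [H HE] : exists H, H = (4 * (refine_scale m p + L + 2 * r))%N by eexists.
have [t tE] : exists t, t = (64 * m * m * H)%N by eexists.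
have [E EE] : exists E, E = (40 * m * r * r * H)%N by eexists.
have [C CE] : exists C, C = ((4 * m + 1) * (2 * m * 2 ^ (r * t)) + r * (2 * s))%N.
  by eexists.
have H0 : (0 < H)%N by rewrite HE /r; clear; lia.
have C0 : (0 < C)%N by rewrite CE addn_gt0 !muln_gt0 expn_gt0 m0 /= addn1.
have t0 : (0 < t)%N by rewrite tE !muln_gt0 m0 H0.
have E0 : (0 < E)%N by rewrite EE !muln_gt0 m0 H0.
exists E, (8 * H * C + es_threshold r r t)%N; split=> //.
  by rewrite addn_gt0 !muln_gt0 H0 C0.
move=> R G x tau U freeG x0 xt tau0 Dt U1 Ud.
set e : R := E%:R^-1 in Ud; rewrite -/r in Ud *.
have [|||P bP] := @erdos_stone R G x tau x0 xt tau0 r r t U (r%:R^-1 + e) isT (leqnn r) t0 Ud.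
- by rewrite addr_ge0 // invr_ge0 ler0n.
- rewrite U1 mulr1 lerD2l lef_pV2 ?posrE ?ltr0n ?muln_gt0 //.
  rewrite ler_nat EE; apply: leq_trans (leq_pmulr _ H0); rewrite mulnA leq_mul2r.
  by apply/orP; right; rewrite leq_mul2r; apply/orP; right; lia.
- by rewrite U1; apply: le_trans Dt; rewrite ler_pM2r // ler_nat leq_addl.
have [|J [JU iJ dJ bJ]] := @stability_classes R G x tau x0 xt tau0 m s p s0 sm p0 freeG t U _ _ Ud (ex_intro _ P bP).
  by rewrite tE; apply: leq_trans (leq_pmulr _ H0); rewrite leq_mul2r; nia.
set h : R := H%:R^-1.
have h0 : 0 < h by rewrite invr_gt0 ltr0n.
have H0' : 0 < H%:R :> R by rewrite ltr0n.
have m1 : 1 <= m%:R :> R by rewrite ler1n.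
have r1 : 2 <= r%:R :> R by rewrite ler_nat.
have thE : (4 * m)%:R * ((2 * m)%:R / t%:R) = h / 8 :> R.
  by rewrite tE /h !natrM; field; rewrite !gt_eqF //; lra.
have ehE : m%:R * r%:R * e * 40 * r%:R = h.
  by rewrite /e EE /h !natrM; field; rewrite !gt_eqF //; lra.
have Ctau : C%:R * tau <= h / 8.
  have : (8 * H * C)%:R * tau <= 1.
    by apply: le_trans Dt; rewrite ler_pM2r // ler_nat leq_addr.
  rewrite !natrM => h1; rewrite ler_pdivlMr // -(ler_pM2l H0') mulfV ?gt_eqF //; lra.
have e0 : 0 < e by rewrite invr_gt0 ltr0n.
have mre : 0 <= m%:R * r%:R * e by rewrite !mulr_ge0 ?ler0n // ltW.
have mre1 : 0 <= (r%:R - 2) * (m%:R * r%:R * e) by rewrite mulr_ge0 // subr_ge0.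
have mre2 : 0 <= (m%:R - 1) * (r%:R * e) by rewrite mulr_ge0 ?subr_ge0 // mulr_ge0 // ltW.
rewrite U1 mulr1 in bJ.
have r0' : r%:R != 0 :> R by rewrite gt_eqF //; lra.
have rd : r%:R * (r%:R^-1 + e) = 1 + r%:R * e by rewrite mulrDr mulfV.
have bJ' : weight x (U :\: \bigcup_i J i) <= 4 * (m%:R * r%:R * e) + h / 4.
  apply: le_trans bJ _; rewrite -addrA.
  have -> : p.+1%:R * (r%:R^-1 + e) - 1 + (2 * m)%:R / t%:R = r%:R * e + (2 * m)%:R / t%:R.
    by rewrite rd; ring.
  rewrite mulrDr thE.
  have -> : (4 * m + 1)%:R * (2 * m * 2 ^ (p.+1 * t))%:R * tau + (p.+1 * (2 * s))%:R * tau = C%:R * tau.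
    by rewrite CE [in RHS]natrD [in RHS]natrM mulrDl.
  by rewrite natrM; lra.
pose eta := h / 2.
have wJ i : weight x (J i) <= r%:R^-1 + e.
  have [->|/set0Pn[v vJ]] := eqVneq (J i) set0.
    by rewrite weight0 addr_ge0 ?invr_ge0 ?ler0n // ltW.
  apply: le_trans (Ud v (subsetP (JU i) _ vJ)); apply: weight_sub => //.
  by apply/subsetP=> u ui; rewrite !inE (subsetP (JU i)) // andbT (iJ i).
(* A vertex of a class misses all of it, so by [Ud] no class weighs more than 1/r + e; since the
   classes together weigh almost 1, none is much lighter than 1/r. *)
have wJ2 i : r%:R^-1 - (r%:R * e + (4 * (m%:R * r%:R * e) + h / 4)) <= weight x (J i) - e.
  have tot : 1 <= \sum_j weight x (J j) + (4 * (m%:R * r%:R * e) + h / 4).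
    apply: (@le_trans _ _ (weight x U)); first by rewrite U1.
    rewrite (weightID x U (\bigcup_i J i)); apply: lerD; last exact: bJ'.
    apply: le_trans (weight_bigcup_le x0 _ _); apply: weight_sub => //.
    exact: subsetIr.
  rewrite (bigD1 i) //= in tot.
  have : \sum_(j < r | j != i) weight x (J j) <= \sum_(j < r | j != i) (r%:R^-1 + e).
    by apply: ler_sum => j _.
  rewrite sumr_const cardC1 card_ord /= -[_ *+ p]mulr_natl.
  have -> : p%:R = r%:R - 1 :> R by rewrite /r -natr1 addrK.
  rewrite mulrBl rd mul1r; lra.
have nt : near_turan x U J eta.
  split=> // v i vU; apply: le_trans (Ud v vU) _.
  by have := wJ2 i; rewrite /eta; lra.
have hS : (refine_scale m p)%:R * h * 4 + L%:R * h * 4 + r%:R * h * 8 = 1.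
  have : H%:R * h = 1 by rewrite mulfV // gt_eqF.
  by rewrite {1}HE natrM !natrD natrM; lra.
have S0 : 0 <= (refine_scale m p)%:R * h by rewrite mulr_ge0 ?ler0n // ltW.
have L0' : 0 <= L%:R * h by rewrite mulr_ge0 ?ler0n // ltW.
have rh0 : 0 <= r%:R * h by rewrite mulr_ge0 ?ler0n // ltW.
have th : tau <= h / 8.
  by apply: le_trans Ctau; apply: ler_peMl; [exact: ltW|rewrite ler1n].
have [||||J' [nJ' cJ']] := near_turan_refine x0 xt tau0 s0 sm p0 freeG nt.
- by rewrite /eta; lra.
- by rewrite U1.
- have : (refine_scale m p)%:R * (eta + tau) <= (refine_scale m p)%:R * h.
    by rewrite ler_wpM2l ?ler0n // /eta; lra.
  lra.
- move=> i; have := wJ2 i.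
  have -> : (2 * r)%:R^-1 = r%:R^-1 / 2 :> R by rewrite natrM invfM mulrC.
  have : r%:R * h <= 1 / 8 by lra.
  have : h <= r%:R^-1 / 8.
    by rewrite -(@ler_pM2l _ r%:R) ?ltr0n // mulrA mulfV // mulrC; lra.
  lra.
exists J'; split=> //; case: nJ' => U' i' d' mi'; split=> // v i vU.
apply: le_trans (mi' v i vU) _; rewrite lerD2l.
have hL : h <= L%:R^-1.
  have LH : (L <= H)%N by rewrite HE; move: (refine_scale m p) (2 * r)%N => a b; clear; lia.
  by rewrite lef_pV2 ?posrE ?ltr0n // ler_nat.
apply: le_trans hL; rewrite /eta.
have : (2 * s)%:R * tau <= C%:R * tau.
  by rewrite ler_pM2r // ler_nat CE; apply: leq_trans (leq_addl _ _); rewrite leq_pmull.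
lra.
Qed.
End MinDegree.

(** * A vertex set maximising a density potential *)

Section DensityPotential.
Local Open Scope ring_scope.
Variables (R : realFieldType) (G : sgraph) (x : G -> R) (tau : R).
Implicit Types (A B S U : {set G}) (u v : G).

Notation weight := (@weight R G x).

Hypothesis x_ge0 : forall v, 0 <= x v.
Hypothesis x_le : forall v, x v <= tau.

Definition inner_form U : R := \sum_(u in U) x u * weight (U :&: nbrs u).

Lemma inner_form_le U : inner_form U <= weight U ^+ 2.
Proof.
rewrite expr2 /inner_form {2}/weight mulr_suml; apply: ler_sum => u uU.
by rewrite ler_wpM2l // weight_sub // subsetIl.
Qed.

Lemma inner_form_setT : inner_form setT = adj_form (@edge G) x.
Proof.
apply: eq_big => [u|u _]; first by rewrite inE.
by congr (_ * _); apply: eq_bigl => v; rewrite !inE.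
Qed.

Lemma inner_formD1 U u : u \in U ->
  inner_form U = inner_form (U :\ u) + 2 * (x u * weight (U :&: nbrs u)).
Proof.
move=> uU; rewrite /inner_form (big_setD1 u) //=.
have e v : weight (U :&: nbrs v) = weight ((U :\ u) :&: nbrs v) + (edge v u)%:R * x u.
  rewrite (weightID x (U :&: nbrs v) [set u]) addrC; congr (_ + _).
    by congr (weight _); apply/setP=> w; rewrite !inE andbA.
  case vu: (edge v u); last first.
    rewrite mul0r -[RHS](weight0 x); congr (weight _); apply/setP=> w; rewrite !inE.
    by case: eqP => [->|]; rewrite ?vu ?andbF.
  rewrite mul1r (_ : _ :&: _ = [set u]) ?[LHS]big_set1 //.
  by apply/setP=> w; rewrite !inE; case: eqP => [->|]; rewrite ?vu ?uU ?andbF.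
under [X in _ + X]eq_bigr => v _ do rewrite e mulrDr.
rewrite big_split /= addrCA; congr (_ + _).
have -> : \sum_(v in U :\ u) x v * ((edge v u)%:R * x u) = x u * weight (U :&: nbrs u).
  rewrite e edge_irrefl mul0r addr0 mulr_sumr /weight.
  rewrite [RHS](eq_bigl (fun v => (v \in U :\ u) && edge u v)); last by move=> v; rewrite !inE.
  rewrite [RHS]big_mkcondr; apply: eq_bigr => v _; rewrite edge_sym.
  by case: edge; rewrite ?mul1r ?mul0r ?mulr0 // mulrC.
by ring.
Qed.

Lemma weight_support U : weight (U :&: [set v | x v != 0]) = weight U.
Proof.
rewrite (weightID x U [set v | x v != 0]) -[LHS]addr0; congr (_ + _).
by rewrite /weight big1 // => v; rewrite !inE => /andP[/negPn/eqP].
Qed.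

(* Deleting a vertex from a maximiser of the potential does not increase it,
   which bounds from below the weighted degree of every vertex it contains. *)
Lemma dense_part (a : R) : 0 <= a ->
  exists U, [/\ inner_form setT - a * weight setT ^+ 2 <= inner_form U - a * weight U ^+ 2 &
    forall u, u \in U -> a * (2 * weight U - x u) <= 2 * weight (U :&: nbrs u)].
Proof.
(* Restricting the maximisation to subsets of the support makes [x u] positive, so that it can be
   cancelled at the end. *)
move=> a0; pose supp := [set v | x v != 0].
pose F U : R := inner_form U - a * weight U ^+ 2.
have ss : supp \subset supp by [].
case: (@Order.TotalTheory.arg_maxP _ _ _ supp (fun U => U \subset supp) F ss) => U Us Umax.
exists U; split.
  have -> : inner_form setT - a * weight setT ^+ 2 = F supp; last exact: Umax.
  rewrite /F -(weight_support setT) setTI -/supp; congr (_ - _).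
  rewrite /inner_form (big_setID supp) /= setTI [X in _ + X]big1 ?addr0; last first.
    by move=> v; rewrite !inE => /andP[/negPn/eqP-> _]; rewrite mul0r.
  by apply: eq_bigr => v _; rewrite setTI -(weight_support (nbrs v)) setIC.
move=> u uU; have xu : 0 < x u.
  by rewrite lt_neqAle x_ge0 eq_sym andbT; have := subsetP Us _ uU; rewrite inE.
have := Umax _ (subset_trans (subsetDl U [set u]) Us); rewrite /F (inner_formD1 uU).
have -> : weight U = weight (U :\ u) + x u.
  rewrite (weightID x U [set u]) addrC; congr (_ + _).
  by rewrite (setIidPr _) ?sub1set // [LHS]big_set1.
set w := weight (U :\ u); set b := weight (U :&: nbrs u) => h.
rewrite -(ler_pM2l xu).
have -> : x u * (a * (2 * (w + x u) - x u)) = a * (w + x u) ^+ 2 - a * w ^+ 2 by ring.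
have -> : x u * (2 * b) = 2 * (x u * b) by ring.
rewrite /= in h; lra.
Qed.

End DensityPotential.

(** * Stability for the whole graph *)

Section GlobalStability.
Local Open Scope ring_scope.

Lemma sqr_sum_le (R : realFieldType) (T : finType) (w : T -> R) : (0 < #|T|)%N ->
  (\sum_i w i) ^+ 2 / #|T|%:R <= \sum_i w i ^+ 2.
Proof.
move=> r0; have r0' : 0 < #|T|%:R :> R by rewrite ltr0n.
set S := \sum_i w i; rewrite ler_pdivrMr //.
have : 0 <= \sum_i (w i - S / #|T|%:R) ^+ 2 by apply: sumr_ge0 => i _; exact: sqr_ge0.
have -> : \sum_i (w i - S / #|T|%:R) ^+ 2 = \sum_i w i ^+ 2 - S ^+ 2 / #|T|%:R.
  have e i : (w i - S / #|T|%:R) ^+ 2 =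
      w i ^+ 2 - w i * (2 * S / #|T|%:R) + (S / #|T|%:R) ^+ 2 by ring.
  rewrite (eq_bigr _ (fun i _ => e i)) big_split sumrB /= -mulr_suml sumr_const.
  by rewrite -/S -[_ *+ _]mulr_natr; field; rewrite gt_eqF.
by rewrite subr_ge0 ler_pdivrMr.
Qed.

Lemma disjoint_familyW (G : sgraph) r (J : 'I_r -> {set G}) : disjoint_family J ->
  forall i j, i != j -> [disjoint J i & J j].
Proof.
move=> dJ i j ij; rewrite -setI_eq0; apply/eqP/setP=> v; rewrite !inE.
by apply/negbTE; rewrite negb_and; case vi: (v \in J i) => //=; apply: dJ ij vi.
Qed.

(** A vertex of [J i] has no neighbour in [J i], so Cauchy-Schwarz on the class weights gives w^2 -
    (w - b)^2 / r, where b is the weight left over. As r >= 2, the cross term 2 b w / r is at most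
    b. *)
Lemma inner_form_turan (R : realFieldType) (G : sgraph) (x : G -> R) r
    (U : {set G}) (J : 'I_r -> {set G}) : (1 < r)%N ->
  (forall v, 0 <= x v) -> weight x U <= 1 -> (forall i, J i \subset U) ->
  (forall i, independent (J i)) -> disjoint_family J ->
  inner_form x U <= (1 - r%:R^-1) * weight x U ^+ 2 + weight x (U :\: \bigcup_i J i).
Proof.
move=> r1 x0 U1 JU iJ dJ; set b := weight x (U :\: _); set w := weight x U.
have sumJ : weight x (\bigcup_i J i) = \sum_i weight x (J i).
  by rewrite /weight partition_disjoint_bigcup //; exact: disjoint_familyW.
have JJU : \bigcup_i J i \subset U by apply/bigcupsP => i _.
have wE : w = \sum_i weight x (J i) + b.
  by rewrite -sumJ /w (weightID x U (\bigcup_i J i)) (setIidPr JJU).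
have h : inner_form x U <= \sum_i weight x (J i) * (w - weight x (J i)) + b * w.
  rewrite /inner_form (big_setID (\bigcup_i J i)) /= (setIidPr JJU); apply: lerD.
    rewrite partition_disjoint_bigcup /=; last exact: disjoint_familyW.
    apply: ler_sum => i _; rewrite {1}/weight mulr_suml; apply: ler_sum => u ui.
    rewrite ler_wpM2l // lerBrDr [w](weightID x U (J i)) (setIidPr (JU i)) addrC lerD2l.
    apply: weight_sub => //; apply/subsetP=> v; rewrite !inE => /andP[-> uv]; rewrite andbT.
    by apply: contraL uv; exact: iJ.
  rewrite {1}/b {1}/weight mulr_suml; apply: ler_sum => u _.
  by rewrite ler_wpM2l // weight_sub // subsetIl.
have cs := @sqr_sum_le R 'I_r (fun i => weight x (J i)).
rewrite card_ord in cs; have {}cs := cs (ltnW r1).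
have b0 : 0 <= b by apply: weight_ge0.
have e : \sum_i weight x (J i) * (w - weight x (J i)) = (\sum_i weight x (J i)) * w - \sum_i weight x (J i) ^+ 2.
  by rewrite mulr_suml -sumrB; apply: eq_bigr => i _; ring.
rewrite e in h; apply: le_trans h _.
have S0 : \sum_i weight x (J i) = w - b by rewrite wE addrK.
rewrite S0 in cs *.
have q0 : 0 <= r%:R^-1 :> R by rewrite invr_ge0 ler0n.
have q2 : r%:R^-1 <= 2^-1 :> R by rewrite lef_pV2 ?posrE ?ltr0n ?ler_nat // ltnW.
have w0 : 0 <= w by apply: weight_ge0.
have : (w - b) ^+ 2 / r%:R = r%:R^-1 * w ^+ 2 - 2 * r%:R^-1 * (b * w) + r%:R^-1 * b ^+ 2 by ring.
have : 0 <= r%:R^-1 * b ^+ 2 by rewrite mulr_ge0 // sqr_ge0.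
have bw : b * w <= b by rewrite ler_piMr.
have bw0 : 0 <= b * w by rewrite mulr_ge0.
have : r%:R^-1 * (b * w) <= 2^-1 * b.
  by apply: le_trans (ler_wpM2r bw0 q2) _; lra.
lra.
Qed.

(** [min_degree_structure] is applied to the set [U] of [dense_part], rescaled to weight 1. The
    potential of [U] is at least e - tau, while [inner_form_turan] bounds it by e w^2 + b; hence e
    (1 - w^2) <= b + tau, and [U] carries almost all the weight. *)
Lemma spectral_stability (m s p L : nat) :
  (0 < s)%N -> (2 * s <= m)%N -> (0 < p)%N -> (0 < L)%N ->
  exists D : nat, (0 < D)%N /\
  forall (R : realFieldType) (G : sgraph) (x : G -> R) (tau : R),
    ~ has_subgraph G (matching_join_turan m s p) ->
    (forall v, 0 <= x v) -> (forall v, x v <= tau) -> 0 < tau -> D%:R * tau <= 1 ->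
    weight x setT = 1 -> 1 - p.+1%:R^-1 - tau <= adj_form (@edge G) x ->
    exists J : 'I_p.+1 -> {set G},
      [/\ forall i, independent (J i), disjoint_family J, near_complete x J (L%:R^-1),
          forall i j, weight x (J j) <= weight x (J i) + L%:R^-1 &
          weight x (~: \bigcup_i J i) <= L%:R^-1].
Proof.
move=> s0 sm p0 L0.
have [E [D1 [E0 D10 HD]]] := min_degree_structure s0 sm p0 L0.
have [c cE] : exists c, c = refine_rest m s p by eexists.
exists (4 * E * E + 4 * E * D1 + L * (2 * E * (c + 1) + c))%N; split.
  by rewrite !addn_gt0 !muln_gt0 E0.
move=> R G x tau freeG x0 xt t0 Dt T1 dens.
have E0' : 0 < E%:R :> R by rewrite ltr0n.
have E1' : 1 <= E%:R :> R by rewrite ler1n.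
have L0' : 0 < L%:R :> R by rewrite ltr0n.
(* Half of the slack 1 / E allowed by [min_degree_structure]; the other half absorbs the term
   [a * x u] in the degree bound of [dense_part]. *)
pose e : R := (2 * E%:R)^-1.
have eE : e * E%:R = 2^-1 by rewrite /e; field; rewrite gt_eqF.
have e0 : 0 < e by rewrite /e invr_gt0 mulr_gt0.
have e1 : e <= 2^-1 by rewrite -eE ler_peMr // ltW.
have c0 : 0 <= c%:R :> R by rewrite ler0n.
have D10' : 0 <= D1%:R :> R by rewrite ler0n.
rewrite !natrD !natrM !natrD in Dt.
have k1 : 0 <= D1%:R * tau * E%:R by rewrite !mulr_ge0 // ltW.
have k2 : 0 <= L%:R * ((2 * E%:R * (c%:R + 1) + c%:R) * tau).
  by repeat (apply: mulr_ge0 || apply: addr_ge0); rewrite ?ler0n // ltW.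
have k3 : 0 <= E%:R * E%:R * tau by rewrite !mulr_ge0 // ltW.
have EEt : 4 * (E%:R * E%:R * tau) <= 1 by lra.
have EDt : 4 * (D1%:R * tau * E%:R) <= 1 by lra.
have Lt : L%:R * ((2 * E%:R * (c%:R + 1) + c%:R) * tau) <= 1 by lra.
have q2 : p.+1%:R^-1 <= 2^-1 :> R by rewrite lef_pV2 ?posrE ?ltr0n ?ler_nat.
have q0 : 0 <= p.+1%:R^-1 :> R by rewrite invr_ge0 ler0n.
have [q qE] : exists q : R, q = p.+1%:R^-1 by eexists.
rewrite -qE in q0 q2 dens.
pose a := 1 - q - e.
have a0 : 0 <= a by rewrite /a; lra.
have [U [phiU degU]] := dense_part x0 a0.
rewrite inner_form_setT T1 expr1n mulr1 in phiU.
set w := weight x U in phiU degU.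
have w1 : w <= 1 by rewrite -T1; apply: weight_sub => //; exact: subsetT.
have w0 : 0 <= w by apply: weight_ge0.
have Et : E%:R * tau <= 4^-1.
  have : 0 <= E%:R * (E%:R - 1) * tau by rewrite !mulr_ge0 ?subr_ge0 // ltW.
  lra.
have te : tau <= e / 2.
  rewrite -(ler_pM2l E0'); have -> : E%:R * (e / 2) = 4^-1 by rewrite mulrA [_ * e]mulrC eE; field.
  by [].
have ww : w ^+ 2 <= w by rewrite expr2 ler_piMl.
have we : e / 2 <= w.
  apply: le_trans ww; have := inner_form_le x0 U; rewrite -/w => iU.
  have : (1 - a) * w ^+ 2 <= w ^+ 2 by rewrite ler_piMl ?sqr_ge0 // /a; lra.
  move: phiU; rewrite {1}/a; lra.
have w00 : 0 < w by apply: lt_le_trans we; rewrite divr_gt0.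
pose y v := w^-1 * x v.
have wy A : weight y A = w^-1 * weight x A by rewrite /weight mulr_sumr.
have [||||||J [nJ cJ]] := HD R G y (w^-1 * tau) U freeG.
- by move=> v; rewrite mulr_ge0 // invr_ge0.
- by move=> v; rewrite ler_pM2l ?invr_gt0.
- by rewrite mulr_gt0 // invr_gt0.
- rewrite mulrCA ler_pdivrMl // mulr1; apply: le_trans we.
  rewrite -(ler_pM2r E0') [e / 2 * _]mulrAC eE; lra.
- by rewrite wy -/w mulVf // gt_eqF.
- move=> u uU; rewrite wy ler_pdivrMl // -qE.
  have := degU u uU; have := weightID x U (nbrs u); rewrite -/w => wID dU.
  have : a * x u <= tau.
    apply: le_trans (xt u); rewrite ler_piMl //; rewrite /a; lra.
  have tw : tau <= w * E%:R^-1.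
    rewrite ler_pdivlMr // mulrC; apply: le_trans we; rewrite -(ler_pM2r E0') [e / 2 * _]mulrAC eE; lra.
  have eE' : e = E%:R^-1 / 2 by rewrite /e invfM mulrC.
  move: dU; rewrite /a eE'; set iE := E%:R^-1 in tw *; lra.
have wyx A : weight x A <= weight y A.
  by rewrite wy -ler_pdivrMl ?invr_gt0 // invrK ler_piMl // weight_ge0.
have y0 v : 0 <= y v by rewrite mulr_ge0 // invr_ge0.
have nc := near_turan_complete y0 nJ.
have L1 : 0 <= L%:R^-1 :> R by rewrite invr_ge0 ltW.
have bal i j := near_turan_balanced y0 i j nJ L1; case: nJ => JU iJ dJ mJ.
exists J; split=> //.
- by move=> i j v ij vi; apply: le_trans (wyx _) (nc _ _ _ ij vi).
- move=> i j; have := bal i j; rewrite !wy -(ler_pM2l w00) mulrDr !mulrA mulfV ?gt_eqF // !mul1r.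
  by move=> /le_trans; apply; rewrite lerD2l ler_piMl.
set b := weight x (U :\: \bigcup_i J i).
have bc : b <= c%:R * tau.
  by apply: le_trans (weight_le_card xt _) _; rewrite ler_pM2r // ler_nat cE.
have h := inner_form_turan (p0 : (1 < p.+1)%N) x0 w1 JU iJ dJ.
rewrite -/w -/b -qE in h.
have outer : weight x (~: \bigcup_i J i) <= (1 - w) + b.
  have -> : 1 - w = weight x (setT :\: U).
    by rewrite -T1 (weightID x setT U) setTI addrAC subrr add0r.
  apply: le_trans (weightU_le x0 _ _); apply: weight_sub => //.
  by apply/subsetP=> v; rewrite !inE => ->; case: (v \in U).
apply: le_trans outer _.
have ew : e * (1 - w) <= b + tau.
  have : e * (1 - w) <= e * (1 - w ^+ 2) by rewrite ler_pM2l // lerD2l lerN2.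
  by rewrite /a in phiU; lra.
have ew2 : 1 - w <= 2 * E%:R * (c%:R + 1) * tau.
  rewrite -(ler_pM2l e0); apply: le_trans ew _.
  have -> : e * (2 * E%:R * (c%:R + 1) * tau) = (e * E%:R) * 2 * (c%:R + 1) * tau by ring.
  by rewrite eE; lra.
rewrite -[leRHS]mul1r ler_pdivlMr // mulrC; apply: le_trans Lt.
by rewrite ler_pM2l //; lra.
Qed.
End GlobalStability.

(** * Reattaching a vertex *)

Lemma nbr_sum_nbrs (R : realFieldType) (G : sgraph) (x : G -> R) v :
  nbr_sum (@edge G) x v = weight x (nbrs v).
Proof. by apply: eq_bigl => u; rewrite inE. Qed.

Section VertexForm.
Local Open Scope ring_scope.
Variables (R : realFieldType) (V : finType) (e : rel V) (x : V -> R).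

Lemma adj_form_vertex v : symmetric e -> irreflexive e ->
  adj_form e x = 2 * (x v * nbr_sum e x v) +
    \sum_(u | u != v) x u * \sum_(w | (w != v) && e u w) x w.
Proof.
move=> es ei; rewrite /adj_form (bigD1 v) //= mulrDl mul1r -addrA; congr (_ + _).
have split u : nbr_sum e x u = (e u v)%:R * x v + \sum_(w | (w != v) && e u w) x w.
  rewrite /nbr_sum [LHS](bigID (pred1 v)) /=; congr (_ + _); last first.
    by apply: eq_bigl => w; rewrite andbC.
  case euv: (e u v); last first.
    by rewrite mul0r big1 // => w /andP[+ /eqP wv]; rewrite wv euv.
  rewrite mul1r (eq_bigl (pred1 v)) ?big_pred1_eq // => w.
  by rewrite inE /=; case: (eqVneq w v) => [->|_]; rewrite ?euv ?andbF.
under eq_bigr => u _ do rewrite split mulrDr.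
rewrite big_split /=; congr (_ + _).
rewrite /nbr_sum mulr_sumr [RHS]big_mkcond /= [RHS](bigD1 v) //= ei add0r.
by apply: eq_bigr => u _; rewrite es; case: (e v u); rewrite ?mul1r ?mul0r ?mulr0 // mulrC.
Qed.
End VertexForm.

(* [x] is a weighting for which the form cannot be beaten by an [F]-free graph on
   the same vertices, a tie forcing [x] to be an eigenvector of that graph too. *)
Record extremal_pair (R : realFieldType) (F G : sgraph) (l : R) (x : G -> R) : Prop :=
  ExtremalPair {
  ep_free : ~ has_subgraph G F;
  ep_ge0 : forall v, (0 <= x v)%R;
  ep_sum : weight x setT = 1%R;
  ep_gt0 : (0 < l)%R;
  ep_eigen : eigenvector (@edge G) l x;
  ep_max : forall (e : rel G) (es : symmetric e) (ei : irreflexive e),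
    ~ has_subgraph (SGraph es ei) F -> (l * sqnorm x <= adj_form e x)%R ->
    eigenvector e l x }.

Section Extremal.
Local Open Scope ring_scope.
Variables (R : realFieldType) (F G : sgraph) (l : R) (x : G -> R).
Implicit Types (A B S U : {set G}) (u v : G).
Notation weight := (@weight R G x).
Hypothesis ext : extremal_pair F l x.
Let tau := l^-1.

Let x_ge0 := ep_ge0 ext.
Let l_gt0 := ep_gt0 ext.
Let tau_gt0 : 0 < tau. Proof. by rewrite invr_gt0 (ep_gt0 ext). Qed.

Lemma extremal_weight_nbrs v : weight (nbrs v) = l * x v.
Proof. by rewrite (ep_eigen ext) nbr_sum_nbrs. Qed.

Lemma extremal_le v : x v <= tau.
Proof.
rewrite -(ler_pM2l l_gt0) -extremal_weight_nbrs mulfV ?gt_eqF //.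
by rewrite -(ep_sum ext); apply: weight_sub => //; exact: subsetT.
Qed.

Lemma extremal_max (e : rel G) (es : symmetric e) (ei : irreflexive e) :
  ~ has_subgraph (SGraph es ei) F -> adj_form e x <= adj_form (@edge G) x.
Proof.
move=> fe; rewrite (adj_form_eigenvector (ep_eigen ext)).
case: (lerP (l * sqnorm x) (adj_form e x)) => [h|/ltW //].
by rewrite (adj_form_eigenvector (ep_max ext fe h)).
Qed.

(* A copy of [F] in the graph where [v] has been reattached to the classes other
   than [J i] could use, in place of [v], a spare vertex of [J i]. *)
Lemma extremal_swap r (J : 'I_r -> {set G}) rho i v :
  near_complete x J rho -> 0 <= rho ->
  #|{: F}|%:R * (rho + tau) + tau < weight (J i) ->
  weight ((\bigcup_(j | j != i) J j) :\ v) <= l * x v.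
Proof.
move=> nJ rho0 big; set X := _ :\ v.
have vX : v \notin X by rewrite !inE eqxx.
pose e u w := if u == v then w \in X else if w == v then u \in X else edge u w.
have es : symmetric e.
  move=> u w; rewrite /e; case: (eqVneq u v) => [uv|uv]; case: (eqVneq w v) => [wv|wv] //.
    by rewrite uv wv.
  by rewrite edge_sym.
have ei : irreflexive e.
  by move=> u; rewrite /e; case: (eqVneq u v) => [->|uv]; [exact: negbTE|exact: edge_irrefl].
have fe : ~ has_subgraph (SGraph es ei) F.
  move=> [f [fi fe]]; apply: (ep_free ext).
  pose f' : F -> G := f; pose S : {set G} := [set f' a | a in {: F}].
  have cS : (#|S| <= #|{: F}|)%N by exact: leq_imset_card.
  have cS' : #|S|%:R * tau <= #|{: F}|%:R * tau :> R by rewrite ler_pM2r // ler_nat.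
  have [y] : exists y, y \in (J i :&: common_nbrs (S :&: X)) :\: (v |: S).
    apply/set0Pn; apply/negP => /eqP h.
    have := weightD_ge x_ge0 (J i :&: common_nbrs (S :&: X)) (v |: S).
    have h1 : weight (J i) - #|S :&: X|%:R * rho <= weight (J i :&: common_nbrs (S :&: X)).
      apply: weight_common_nbrs => // u; rewrite !inE => /and3P[_ _ /bigcupP[j ji uj]].
      exact: nJ ji uj.
    have : #|S :&: X|%:R * rho <= #|{: F}|%:R * rho.
      by rewrite ler_wpM2r // ler_nat (leq_trans _ cS) // subset_leq_card // subsetIl.
    have := weightU_le x_ge0 [set v] S; have := weight_le_card extremal_le S.
    have : weight [set v] <= tau by rewrite /weight big_set1 extremal_le.
    rewrite h weight0; lra.
  rewrite !inE => /and3P[/norP[yv yS] yJ /forall_inP yX].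
  exists (fun a => if f a == v then y else f a); split.
    move=> a b /=; case: (eqVneq (f a) v) => [fa|fa]; case: (eqVneq (f b) v) => [fb|fb].
    - by move=> _; apply: fi; rewrite fa fb.
    - by move=> h; case/negP: yS; rewrite h imset_f.
    - by move=> h; case/negP: yS; rewrite -h imset_f.
    - exact: fi.
  move=> a b ab; have := fe a b ab; rewrite /= /e.
  case: (eqVneq (f a) v) => [fa|fa]; case: (eqVneq (f b) v) => [fb|fb] //.
  - by rewrite fb (negbTE vX).
  - by move=> fX; rewrite edge_sym; apply: yX; rewrite in_setI fX imset_f.
  - by move=> fX; apply: yX; rewrite in_setI fX imset_f.
rewrite leNgt; apply/negP => lt.
have nv : nbr_sum e x v = weight X by apply: eq_bigl => u; rewrite /e eqxx.
have := ep_max ext fe; rewrite -(adj_form_eigenvector (ep_eigen ext)).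
rewrite (adj_form_vertex x v es ei) (adj_form_vertex x v (@edge_sym G) (@edge_irrefl G)).
have -> : \sum_(u | u != v) x u * (\sum_(w | (w != v) && e u w) x w) =
          \sum_(u | u != v) x u * (\sum_(w | (w != v) && edge u w) x w).
  apply: eq_bigr => u uv; congr (_ * _); apply: eq_bigl => w.
  by rewrite /e (negbTE uv); case: (eqVneq w v).
rewrite nv nbr_sum_nbrs extremal_weight_nbrs lerD2r ler_pM2l //.
(* If x v = 0 the two forms tie. The tie clause of [ep_max] still makes [x] an eigenvector of the
   modified graph, whence l x v = weight X. *)
move=> /(_ (ler_wpM2l (x_ge0 v) (ltW lt))) /(_ v); rewrite nv => h.
by rewrite h ltxx in lt.
Qed.

(** [extremal_swap] bounds from below the degree of every vertex, inside or outside the classes, so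
    the conclusion holds on the whole vertex set. *)
Lemma extremal_near_turan p (J : 'I_p.+1 -> {set G}) rho :
  (forall i, independent (J i)) -> disjoint_family J -> near_complete x J rho -> 0 <= rho ->
  (forall i, #|{: F}|%:R * (rho + tau) + tau < weight (J i)) ->
  near_turan x setT J (weight (~: \bigcup_i J i) + tau).
Proof.
move=> iJ dJ nJ rho0 big; split=> // v i _.
have := extremal_swap v nJ rho0 (big i); rewrite -extremal_weight_nbrs.
set X := \bigcup_(j | _) J j; rewrite -[setT :\: _]/(setT :\: nbrs v) => h.
have t1 := weightID x setT (nbrs v); rewrite setTI (ep_sum ext) in t1.
have h2 := weightD_ge x_ge0 X [set v].
have h3 : weight [set v] <= tau by rewrite /weight big_set1 extremal_le.
have h4 : 1 <= weight X + (weight (J i) + weight (~: \bigcup_i J i)).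
  rewrite -(ep_sum ext); apply: (@le_trans _ _ (weight (X :|: (J i :|: ~: \bigcup_i J i)))).
    apply: weight_sub => //; apply/subsetP=> u _; rewrite !in_setU in_setC.
    case uJ: (u \in \bigcup_i J i); rewrite ?orbT //= orbF.
    move/bigcupP: uJ => [j _ uj]; case: (eqVneq j i) => [<-|ji]; rewrite ?uj ?orbT //.
    by apply/orP; left; apply/bigcupP; exists j.
  apply: le_trans (weightU_le x_ge0 _ _) _; rewrite lerD2l.
  exact: weightU_le.
lra.
Qed.

End Extremal.

Section ExtremalStructure.
Local Open Scope ring_scope.

(** Reattachment is used twice. The first use extends the classes of [spectral_stability] to the
    whole graph with a constant error, which lets [near_turan_refine] leave only boundedly many
    vertices outside; the second then has an error that is a multiple of 1 / l. *)
Lemma extremal_structure (m s p : nat) :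
  (0 < s)%N -> (2 * s <= m)%N -> (0 < p)%N ->
  exists D k : nat, [/\ (0 < D)%N, (s <= k)%N &
  forall (R : realFieldType) (G : sgraph) (l : R) (x : G -> R),
    extremal_pair (matching_join_turan m s p) l x -> D%:R <= l ->
    1 - p.+1%:R^-1 - l^-1 <= adj_form (@edge G) x ->
    exists I : 'I_p.+1 -> {set G},
      [/\ near_turan x setT I (k%:R / l),
          (s.-1 <= #|~: (\bigcup_i I i)| <= k)%N,
          forall i, (4 * p.+1)%:R^-1 <= weight x (I i) &
          forall v, ((4 * p.+1)%:R * l)^-1 <= x v]].
Proof.
move=> s0 sm p0.
have [N NE] : exists N, N = #|{: matching_join_turan m s p}| by eexists.
have [c cE] : exists c, c = refine_rest m s p by eexists.
have [S SE] : exists S, S = refine_scale m p by eexists.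
(* (N + S + 2) / L is 1 / 32 of 1 / r: [N], the order of F, enters through [extremal_swap], and [S]
   through [near_turan_refine]. *)
have [L LE] : exists L, L = (32 * p.+1 * (N + S + 2))%N by eexists.
have L0 : (0 < L)%N by rewrite LE; clear; lia.
have [D1 [D10 HD]] := spectral_stability s0 sm p0 L0.
exists (D1 + 32 * p.+1 * (N + S + 2) * (2 * s + 2 + (c + 1)))%N, (c + 2 * s + 1)%N; split.
- by rewrite addn_gt0 D10.
- by clear; lia.
move=> R G l x ext Dl dens.
have l0 := ep_gt0 ext; have x0 := ep_ge0 ext; have T1 := ep_sum ext.
set tau := l^-1 in dens *.
have t0 : 0 < tau by rewrite invr_gt0.
have xt := extremal_le ext.
have r1 : 2 <= p.+1%:R :> R by rewrite ler_nat.
have tD (n : nat) : (n <= D1 + 32 * p.+1 * (N + S + 2) * (2 * s + 2 + (c + 1)))%N -> n%:R * tau <= 1.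
  by move=> nD; rewrite ler_pdivrMr // mul1r; apply: le_trans Dl; rewrite ler_nat.
have [J [iJ dJ nJ bJ wJ]] := HD R G x tau (ep_free ext) x0 xt t0 (tD _ (leq_addr _ _)) T1 dens.
set q : R := (p.+1%:R)^-1.
have rq : p.+1%:R * q = 1 by rewrite mulfV // gt_eqF //; lra.
have q0 : 0 < q by rewrite invr_gt0; lra.
have N0 : 0 <= N%:R :> R by rewrite ler0n.
have S0 : 0 <= S%:R :> R by rewrite ler0n.
have lq : 32 * (N%:R * L%:R^-1) + 32 * (S%:R * L%:R^-1) + 64 * L%:R^-1 = q.
  by rewrite LE /q !natrM !natrD; field; rewrite !gt_eqF //; lra.
have [K KE] : exists K, K = (2 * s + 2 + (c + 1))%N by eexists.
have tq : 32 * (N%:R * (K%:R * tau)) + 32 * (S%:R * (K%:R * tau)) + 64 * (K%:R * tau) <= q.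
  have h : (32 * p.+1 * (N + S + 2) * K)%:R * tau <= 1.
    by apply: tD; rewrite KE leq_addl.
  rewrite -(@ler_pM2l _ p.+1%:R); last by lra.
  rewrite rq; apply: le_trans h; rewrite !natrM !natrD; lra.
have KtE : K%:R * tau = 2 * (s%:R * tau) + c%:R * tau + 3 * tau.
  by rewrite KE; ring.
have L1 : 0 <= L%:R^-1 :> R by rewrite invr_ge0 ler0n.
set iL := L%:R^-1 in nJ bJ wJ lq L1.
have st0 : 0 <= s%:R * tau by rewrite mulr_ge0 ?ler0n // ltW.
have ct0 : 0 <= c%:R * tau by rewrite mulr_ge0 ?ler0n // ltW.
have NL : 0 <= N%:R * iL by rewrite mulr_ge0.
have SL : 0 <= S%:R * iL by rewrite mulr_ge0.
have Nst : 0 <= N%:R * (s%:R * tau) by rewrite mulr_ge0.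
have Nct : 0 <= N%:R * (c%:R * tau) by rewrite mulr_ge0.
have Nt : 0 <= N%:R * tau by rewrite mulr_ge0 // ltW.
have Sst : 0 <= S%:R * (s%:R * tau) by rewrite mulr_ge0.
have Sct : 0 <= S%:R * (c%:R * tau) by rewrite mulr_ge0.
have St : 0 <= S%:R * tau by rewrite mulr_ge0 // ltW.
rewrite {}KtE !mulrDr !(mulrCA N%:R) !(mulrCA S%:R) in tq.
have avg (A : 'I_p.+1 -> {set G}) (a b : R) :
    (forall i j, weight x (A j) <= weight x (A i) + a) ->
    weight x (~: \bigcup_i A i) <= b -> 0 <= b ->
    forall i, q - a - b <= weight x (A i).
  move=> hA hb b0 i.
  have h1 : 1 <= \sum_j weight x (A j) + b.
    rewrite -T1; apply: (@le_trans _ _ (weight x (\bigcup_j A j) + weight x (~: \bigcup_j A j))).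
      by apply: le_trans (weightU_le x0 _ _); rewrite setUCr.
    by apply: lerD => //; exact: weight_bigcup_le.
  have h2 : \sum_j weight x (A j) <= p.+1%:R * (weight x (A i) + a).
    rewrite mulr_natl -[X in _ *+ X]card_ord -sumr_const; apply: ler_sum => j _; exact: hA.
  rewrite -(@ler_pM2l _ p.+1%:R); last by lra.
  have : b <= p.+1%:R * b by rewrite ler_peMl //; lra.
  rewrite !mulrBr rq; lra.
have wJi := avg J iL iL bJ wJ L1.
have rho1 : 0 <= iL by [].
have nt1 : near_turan x setT J (weight x (~: \bigcup_i J i) + tau).
  apply: (extremal_near_turan ext iJ dJ nJ rho1) => i; rewrite -NE -/tau.
  by have := wJi i; lra.
set eta1 := _ + tau in nt1.
have eta1L : eta1 <= iL + tau by rewrite /eta1 lerD2r.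
have eta10 : 0 <= eta1 by rewrite addr_ge0 ?weight_ge0 // ltW.
have T1' : weight x setT <= 1 by rewrite T1.
have Seta : S%:R * (eta1 + tau) <= 1.
  have : S%:R * (eta1 + tau) <= S%:R * (iL + tau + tau) by rewrite ler_wpM2l // lerD2r.
  have : q <= 1 by rewrite -rq ler_peMl ?(ltW q0) //; lra.
  lra.
rewrite SE in Seta.
have r2E : (2 * p.+1)%:R^-1 = q / 2 by rewrite natrM invfM mulrC.
have [|J1 [nt2 cJ1]] := near_turan_refine x0 xt t0 s0 sm p0 (ep_free ext) nt1 eta10 T1' Seta.
  by move=> i; rewrite r2E; have := wJi i; lra.
rewrite setTD -cE in cJ1.
set eta2 := eta1 + _ in nt2.
have eta2L : eta2 <= iL + tau + 2 * (s%:R * tau) by rewrite /eta2 natrM -mulrA lerD2r.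
have eta20 : 0 <= eta2 by rewrite addr_ge0 // mulr_ge0 ?ler0n // ltW.
have wC : weight x (~: \bigcup_i J1 i) <= c%:R * tau.
  by apply: le_trans (weight_le_card xt _) _; rewrite ler_pM2r // ler_nat.
have wJ1 := avg J1 eta2 (c%:R * tau) (fun i j => near_turan_balanced x0 i j nt2 eta20) wC ct0.
have nc2 := near_turan_complete x0 nt2.
have big2 i : #|{: matching_join_turan m s p}|%:R * (eta2 + l^-1) + l^-1 < weight x (J1 i).
  rewrite -NE -/tau; apply: lt_le_trans (wJ1 i).
  have : N%:R * (eta2 + tau) <= N%:R * (iL + tau + 2 * (s%:R * tau) + tau).
    by rewrite ler_wpM2l // lerD2r.
  rewrite !mulrDr !(mulrCA N%:R); lra.
have [_ iJ1 dJ1 _] := nt2.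
have nt3 := extremal_near_turan ext iJ1 dJ1 nc2 eta20 big2.
(* At least s - 1 vertices must lie outside the classes, to leave room for the clique; an arbitrary
   [T] of that size is removed from them. *)
have [|T _ Tc] := @subset_of_card _ [set: G] s.-1.
  apply: (card_ge_weight xt t0); rewrite T1; apply: tD.
  by rewrite -KE; clear -KE L0 LE s0; rewrite KE; nia.
have wT : weight x T <= s%:R * tau.
  apply: le_trans (weight_le_card xt _) _; rewrite ler_pM2r // ler_nat Tc; exact: leq_pred.
have wI i : weight x (J1 i) - s%:R * tau <= weight x (J1 i :\: T).
  by have := weightD_ge x0 (J1 i) T; lra.
exists (fun i => J1 i :\: T); split.
- have [_ _ _ m3] := nt3; split.
  + by move=> i; exact: subsetT.
  + by move=> i u v; rewrite !in_setD => /andP[_ ui] /andP[_ vi]; exact: iJ1 ui vi.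
  + by move=> i j v ij; rewrite !in_setD => /andP[_ vi]; rewrite (negbTE (dJ1 _ _ _ ij vi)) andbF.
  + move=> v i vT; apply: le_trans (m3 v i vT) _; rewrite -/tau.
    have kE : (c + 2 * s + 1)%:R = c%:R + 2 * s%:R + 1 :> R by ring.
    by have := wI i; rewrite kE; lra.
- have -> : ~: (\bigcup_i (J1 i :\: T)) = ~: (\bigcup_i J1 i) :|: T.
    apply/setP=> v; rewrite !inE -[RHS]negbK negb_or negbK; congr (~~ _).
    apply/bigcupP/andP => [[i _]|[/bigcupP[i _ vi] vT]].
      by rewrite inE => /andP[vT vi]; split=> //; apply/bigcupP; exists i.
    by exists i; rewrite // inE vT.
  rewrite -Tc subset_leq_card ?subsetUr //=; apply: leq_trans (leq_card_setU _ _) _.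
  by rewrite Tc; apply: leq_trans (leq_add cJ1 (leqnn _)) _; clear; lia.
- move=> i; have -> : (4 * p.+1)%:R^-1 = q / 4 by rewrite natrM invfM mulrC.
  have := wI i; have := wJ1 i; lra.
move=> v; have -> : ((4 * p.+1)%:R * l)^-1 = (q / 4) * tau.
  by rewrite invfM natrM invfM [4^-1 * _]mulrC.
rewrite -(ler_pM2l l0).
have -> : l * (q / 4 * tau) = q / 4 by rewrite mulrCA mulfV ?mulr1 ?gt_eqF.
(* Any [v] may be attached to every class but the first. As p > 0, this includes the last class,
   whose weight bounds l x v from below. *)
have h := extremal_swap ext v nc2 eta20 (big2 ord0).
apply: le_trans h; apply: le_trans (weightD_ge x0 _ _).
have : weight x (J1 ord_max) <= weight x (\bigcup_(j | j != ord0) J1 j).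
  apply: weight_sub => //; apply: (bigcup_sup ord_max).
  by rewrite -val_eqE /= -lt0n.
have : weight x [set v] <= tau by rewrite /weight big_set1 xt.
have := wJ1 ord_max; lra.
Qed.
End ExtremalStructure.

(** * Exact structure of extremal graphs *)

(** Greedy choice: fewer than [size ws] vertices of [B] are in use whenever a partner is needed. *)
Lemma star_matching (G : sgraph) (ws : seq G) (B : {set G}) : uniq ws ->
  (forall w, w \in ws -> w \notin B /\ size ws <= #|nbrs w :&: B|) ->
  exists M, [/\ is_matching M, map fst M = ws & {subset map snd M <= B}].
Proof.
move=> uw; have [n nE] : exists n, n = size ws by eexists.
rewrite -nE => hw; have : size ws <= n by rewrite nE.
elim: ws uw hw {nE} => [|w ws IH] /=; first by exists [::].
move=> /andP[ww uw] hw sn.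
have [M [mM Mw MB]] := IH uw (fun z zw => hw z (mem_behead (s := w :: ws) zw)) (ltnW sn).
have [wB wn] := hw w (mem_head _ _).
have [y yP] : exists y, y \in (nbrs w :&: B) :\: [set z in map snd M].
  apply/set0Pn; rewrite -card_gt0 cardsD subn_gt0; apply: leq_trans wn.
  apply: leq_ltn_trans (subset_leq_card (subsetIr _ _)) _.
  rewrite cardsE (leq_ltn_trans (card_size _)) // size_map -(size_map fst) Mw.
  exact: sn.
move: yP; rewrite !inE => /andP[yM /andP[wy yB]].
exists ((w, y) :: M); split=> /=; last 1 first.
- by move=> z; rewrite inE => /orP[/eqP->//|]; exact: MB.
- apply: is_matching_cons => //; rewrite /ends mem_cat negb_or Mw ?ww ?yM ?andbT /=.
    by apply: contra wB => /MB.
  apply/negP => yw; have [] := hw y (mem_behead (s := w :: ws) yw).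
  by rewrite yB.
- by rewrite Mw.
Qed.

Lemma subset_between (T : finType) (X Y : {set T}) n : X \subset Y ->
  #|X| <= n <= #|Y| -> exists Z : {set T}, [/\ X \subset Z, Z \subset Y & #|Z| = n].
Proof.
move=> XY /andP[Xn nY]; have [|B BY Bn] := @subset_of_card _ (Y :\: X) (n - #|X|).
  by rewrite cardsD (setIidPr XY) leq_sub2r.
have XB : [disjoint X & B].
  rewrite -setI_eq0; apply/eqP/setP=> z; rewrite !inE; apply/negP => /andP[zX /(subsetP BY)].
  by rewrite inE zX.
exists (X :|: B); split; first exact: subsetUl.
  by rewrite subUset XY; apply: subset_trans BY (subsetDl _ _).
by rewrite cardsU (eqP (_ : X :&: B == set0)) ?setI_eq0 // cards0 subn0 Bn subnKC.
Qed.

(** The join of a clique on [Q] with the complete multipartite graph of the colour classes outside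
    [Q], placed on the given vertex set so that the same weighting can be evaluated on it. *)
Definition join_edge (V : finType) r (Q : {set V}) (col : V -> 'I_r) : rel V :=
  fun u v => (u != v) && [|| u \in Q, v \in Q | col u != col v].

Lemma join_edge_sym (V : finType) r (Q : {set V}) (col : V -> 'I_r) :
  symmetric (join_edge Q col).
Proof. by move=> u v; rewrite /join_edge eq_sym orbCA [col u == _]eq_sym. Qed.

Lemma join_edge_irrefl (V : finType) r (Q : {set V}) (col : V -> 'I_r) :
  irreflexive (join_edge Q col).
Proof. by move=> u; rewrite /join_edge eqxx. Qed.

Lemma join_edge_free (V : finType) p (Q : {set V}) (col : V -> 'I_p.+1) m s :
  #|Q| < s -> 2 * s <= m -> 0 < p ->
  ~ has_subgraph (SGraph (join_edge_sym Q col) (join_edge_irrefl Q col))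
                 (matching_join_turan m s p).
Proof.
move=> Qs sm p0; apply: (@matching_join_turan_free (SGraph (join_edge_sym Q col) (join_edge_irrefl Q col)) m s p Q col) => // u v uQ vQ.
by rewrite /= /join_edge (negbTE uQ) (negbTE vQ) /= => /andP[].
Qed.

(** * Traces on the exceptional set *)

Section Atoms.
Local Open Scope ring_scope.
Variables (R : realFieldType) (G : sgraph) (l : R) (x : G -> R) (m s p k : nat).
Implicit Types (A B S U : {set G}) (u v w : G).
Notation weight := (@weight R G x).
Notation r := p.+1.
Hypothesis s_gt0 : (0 < s)%N.
Hypothesis sm : (2 * s <= m)%N.
Hypothesis p_gt0 : (0 < p)%N.
Hypothesis ext : extremal_pair (matching_join_turan m s p) l x.
Let tau := l^-1.
Variable (I : 'I_r -> {set G}).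
Hypothesis nt : near_turan x setT I (k%:R * l^-1).
Let C := ~: \bigcup_i I i.
Hypothesis Ck : (#|C| <= k)%N.
Hypothesis sC : (s.-1 <= #|C|)%N.
Hypothesis sk : (s <= k)%N.
Variable kappa : R.
Hypothesis kappa_gt0 : 0 < kappa.
Hypothesis wI : forall i, kappa <= weight (I i).
Hypothesis x_ge : forall v, kappa * l^-1 <= x v.

(** In units of tau: s vertices from another class exclude s k, and the greedy choice of a part of
    size m needs r m k + m. *)
Let M := (s * k + r * m * k + m)%N.
Let x_ge0 := ep_ge0 ext.
Let l_gt0 := ep_gt0 ext.
Let x_le := extremal_le ext.
Let tau_gt0 : 0 < tau. Proof. by rewrite invr_gt0 (ep_gt0 ext). Qed.
Let nc := near_turan_complete x_ge0 nt.
Let kt_ge0 : 0 <= k%:R * l^-1 := mulr_ge0 (ler0n R k) (ltW tau_gt0).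

Definition atom v : {set G} := nbrs v :&: C.
Definition atom_fibre i A : {set G} := [set v in I i | atom v == A].
Definition large_atom i A : bool := M%:R * tau <= weight (atom_fibre i A).

Hypothesis small1 : (2 * s + M)%:R * tau <= kappa.

Lemma notin_class v i : v \in C -> v \notin I i.
Proof. by rewrite inE; apply: contra => vi; apply/bigcupP; exists i. Qed.

Lemma in_class v : v \notin C -> exists i, v \in I i.
Proof. by rewrite inE negbK => /bigcupP[i _ vi]; exists i. Qed.

Lemma atom_sub v : atom v \subset C.
Proof. exact: subsetIr. Qed.

Lemma large_atom_nbrs i A w : large_atom i A -> w \in A -> (s <= #|nbrs w :&: I i|)%N.
Proof.
move=> lA wA; apply: (@leq_trans #|atom_fibre i A|).
  apply: (card_ge_weight x_le tau_gt0); apply: le_trans lA.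
  rewrite ler_pM2r // ler_nat /M.
  have : (s <= m)%N by lia.
  by move=> h; apply: leq_trans h (leq_addl _ _).
apply: subset_leq_card; apply/subsetP=> v; rewrite !inE => /andP[vi /eqP vA].
by move: wA; rewrite vi andbT -vA !inE edge_sym => /andP[].
Qed.

Lemma large_atom_sub i A : large_atom i A -> A \subset C.
Proof.
move=> lA; have /set0Pn[v] : atom_fibre i A != set0.
  apply: contraTneq lA => h; rewrite /large_atom h weight0 -ltNge mulr_gt0 // ltr0n.
  by rewrite /M addn_gt0; apply/orP; right; lia.
by rewrite inE => /andP[_ /eqP <-]; exact: atom_sub.
Qed.

(** Otherwise s such vertices could be matched into [I i0]. They are adjacent to the whole fibre of
    each [A j], and their partners miss only weight k tau of it, so the fibres would complete a copy
    of F. *)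
Lemma few_common (A : 'I_r -> {set G}) i0 :
  (forall j, j != i0 -> large_atom j (A j)) ->
  (#|[set w in C | [forall j, (j != i0) ==> (w \in A j)] && (s <= #|nbrs w :&: I i0|)%N]| < s)%N.
Proof.
move=> lA; rewrite ltnNge; apply/negP => big.
have [W Wsub Ws] := subset_of_card big.
pose ws := enum W.
have wsE : size ws = s by rewrite -cardE.
have wsP w : w \in ws -> [/\ w \in C, forall j, j != i0 -> w \in A j & (s <= #|nbrs w :&: I i0|)%N].
  rewrite mem_enum => /(subsetP Wsub); rewrite !inE => /and3P[h1 /forallP h2 h3].
  by split=> // j ji; have /implyP := h2 j; apply.
have [|Mt [mM Mw MB]] := @star_matching G ws (I i0) (enum_uniq _).
  by move=> w /wsP[wC _ h]; rewrite wsE; split=> //; exact: notin_class.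
apply: (ep_free ext).
pose S := [set z in map snd Mt].
have sMt : size Mt = s by rewrite -(size_map fst) Mw wsE.
have Ss : (#|S| <= s)%N by rewrite cardsE (leq_trans (card_size _)) // size_map sMt.
have m1 : (1 <= m)%N by lia.
have tl := tau_gt0.
have sm1 := small1; rewrite /M in sm1.
pose X j := if j == i0 then I j :\: [set z in ends Mt] else atom_fibre j (A j) :&: common_nbrs S.
apply: (@matching_join_turan_in_near_complete R G x tau x_ge0 x_le tau_gt0 m s p I X (k%:R * l^-1) Mt i0) => //.
- move=> j; rewrite /X; case: eqP => _; first exact: subsetDl.
  by apply: subset_trans (subsetIl _ _) _; apply/subsetP=> v; rewrite inE => /andP[].
- move=> z j v zM ji; rewrite /X (negbTE ji) !inE => /andP[/andP[vj /eqP vA] /forall_inP vS].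
  move: zM; rewrite /ends mem_cat Mw => /orP[zw|zS]; last by apply: vS; rewrite inE.
  have [_ /(_ j ji) + _] := wsP z zw; rewrite -vA !inE edge_sym => /andP[+ _].
  by [].
- by move=> z zM; rewrite /X eqxx !inE zM.
- move=> j; rewrite /X; case: eqP => [_|/eqP ji].
    have := weightD_ge x_ge0 (I j) [set z in ends Mt]; have := wI j.
    have : weight [set z in ends Mt] <= (2 * s)%:R * tau.
      apply: le_trans (weight_le_card x_le _) _; rewrite ler_pM2r // ler_nat.
      by rewrite cardsE (leq_trans (card_size _)) // size_ends sMt.
    have : 0 <= (s * k)%:R * tau by rewrite mulr_ge0 ?ler0n // ltW.
    have : (r * m)%:R * (k%:R * l^-1) = (r * m * k)%:R * tau by rewrite mulrA -natrM.
    rewrite !natrD !mulrDl in sm1 *; lra.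
  have := @weight_common_nbrs R G x x_ge0 S (atom_fibre j (A j)) (k%:R * l^-1).
  have nS u : u \in S -> weight (atom_fibre j (A j) :\: nbrs u) <= k%:R * l^-1.
    rewrite inE => /MB uI; apply: le_trans (nc _ uI); last by rewrite eq_sym; exact: ji.
    by apply: weight_sub => //; apply: setSD; apply/subsetP=> v; rewrite inE => /andP[].
  move=> /(_ nS); apply: le_trans.
  have := lA j ji; rewrite /large_atom /M.
  have : #|S|%:R * (k%:R * l^-1) <= s%:R * (k%:R * l^-1) by rewrite ler_wpM2r // ler_nat.
  have : (r * m)%:R * (k%:R * l^-1) = (r * m * k)%:R * tau by rewrite mulrA -natrM.
  have : s%:R * (k%:R * l^-1) = (s * k)%:R * tau by rewrite mulrA -natrM.
  rewrite !natrD !mulrDl; lra.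
Qed.

Definition pair_form (e : rel G) A B : R :=
  \sum_(u in A) x u * \sum_(v in B | e u v) x v.

Lemma adj_formID (e : rel G) A : symmetric e ->
  adj_form e x = pair_form e A A + 2 * pair_form e (~: A) A + pair_form e (~: A) (~: A).
Proof.
move=> es; have sw : pair_form e A (~: A) = pair_form e (~: A) A.
  have ex B D : pair_form e B D = \sum_(u in B) \sum_(v in D) (e u v)%:R * (x u * x v).
    apply: eq_bigr => u _; rewrite mulr_sumr big_mkcondr; apply: eq_bigr => v _.
    by case: (e u v); rewrite ?mul1r ?mul0r.
  rewrite !ex exchange_big; apply: eq_bigr => u _; apply: eq_bigr => v _.
  by rewrite es [x v * _]mulrC.
have -> : adj_form e x = pair_form e setT setT.
  apply: eq_big => [u|u _]; first by rewrite inE.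
  by congr (_ * _); apply: eq_bigl => v; rewrite inE.
have spl B : pair_form e B setT = pair_form e B A + pair_form e B (~: A).
  rewrite /pair_form -big_split; apply: eq_bigr => u _ /=; rewrite -mulrDr; congr (_ * _).
  rewrite (bigID (mem A)) /=; congr (_ + _); apply: eq_bigl => v;
    by rewrite !inE andbC.
have spl2 B : pair_form e setT B = pair_form e A B + pair_form e (~: A) B.
  by rewrite /pair_form (big_setID A) /= setTI setTD.
by rewrite spl2 !spl sw; ring.
Qed.

(* Replacing the graph by the join graph gains, at each vertex [u] outside [C],
   the difference between the traces on [C] of its new and old neighbourhoods,
   and loses at most the square of the weight of [C]. *)
Lemma join_form_gain (Q : {set G}) (col : G -> 'I_r) : Q \subset C ->
  (#|Q| < s)%N -> (forall v, v \notin C -> v \in I (col v)) ->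
  2 * (\sum_(u in ~: C) x u *
     (weight [set v in C | (v \in Q) || (col v != col u)] - weight (atom u)))
  <= weight C ^+ 2.
Proof.
move=> QC Qs colI; pose e := join_edge Q col.
have := extremal_max ext (@join_edge_free G p Q col m s Qs sm p_gt0).
rewrite (adj_formID C (join_edge_sym Q col)) (adj_formID C (@edge_sym G)).
have h1 : 0 <= pair_form e C C.
  by apply: sumr_ge0 => u _; rewrite mulr_ge0 //; apply: sumr_ge0.
have h2 : pair_form (@edge G) C C <= weight C ^+ 2.
  rewrite expr2 {1}/weight mulr_suml; apply: ler_sum => u _; rewrite ler_wpM2l //.
  rewrite /weight [leRHS](bigID (fun v => edge u v)) /= lerDl.
  exact: sumr_ge0.
have h3 : pair_form (@edge G) (~: C) (~: C) <= pair_form e (~: C) (~: C).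
  apply: ler_sum => u; rewrite in_setC => uC; rewrite ler_wpM2l //.
  rewrite big_mkcondr [leRHS]big_mkcondr; apply: ler_sum => v; rewrite in_setC => vC.
  case uv: (edge u v); last by case: ifP.
  rewrite ifT // /e /join_edge; apply/andP; split.
    by apply: contraTneq uv => ->; rewrite edge_irrefl.
  apply/or3P; apply: Or33; apply: contraTneq uv => cuv.
  by apply: (nt_indep nt (i := col u)); rewrite ?cuv ?colI // -cuv colI.
have h4 : pair_form (@edge G) (~: C) C = \sum_(u in ~: C) x u * weight (atom u).
  apply: eq_bigr => u _; congr (_ * _); apply: eq_bigl => v.
  by rewrite !inE andbC.
have h5 : pair_form e (~: C) C = \sum_(u in ~: C) x u *
     weight [set v in C | (v \in Q) || (col v != col u)].
  apply: eq_bigr => u; rewrite in_setC => uC; congr (_ * _); apply: eq_bigl => v.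
  rewrite [in RHS]inE; case vC: (v \in C) => //=; rewrite /e /join_edge.
  have uv : u != v by apply: contraNneq uC => ->.
  have uQ : (u \in Q) = false by apply: contraNF uC; apply: subsetP.
  by rewrite uv uQ /= [col u == _]eq_sym.
move=> h; under eq_bigr do rewrite mulrBr.
rewrite sumrB -h4 -h5 -/e in h *; lra.
Qed.

Lemma small_fibres i :
  weight [set v in I i | ~~ large_atom i (atom v)] <= (2 ^ k * M)%:R * tau.
Proof.
pose T := [set v in I i | ~~ large_atom i (atom v)].
apply: (@le_trans _ _ (\sum_(A in powerset C) M%:R * tau)).
  rewrite -/T /weight (partition_big atom (mem (powerset C))) => [|v _] /=; last first.
    by rewrite powersetE atom_sub.
  apply: ler_sum => A _; case lA: (large_atom i A).
    rewrite big1 ?mulr_ge0 ?ler0n // ?ltW // => v /andP[+ /eqP vA].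
    by rewrite !inE vA lA andbF.
  have /ltW : weight (atom_fibre i A) < M%:R * tau by rewrite ltNge -/(large_atom i A) lA.
  apply: le_trans; rewrite /weight [leRHS](bigID (fun v => v \in T)) /= -[leLHS]addr0.
  apply: lerD; last exact: sumr_ge0.
  rewrite le_eqVlt; apply/orP; left; apply/eqP; apply: eq_bigl => v.
  by rewrite !inE; case: (v \in I i) => //=; rewrite ?andbF //= andbC.
rewrite sumr_const card_powerset -[_ *+ _]mulr_natl natrM -mulrA.
apply: ler_wpM2r; first by rewrite mulr_ge0 ?ler0n // ltW.
by rewrite ler_nat leq_exp2l.
Qed.

(** A bound for the weight of the vertices of a class without the preferred trace: the fraction
    accounts for [bad] in the next proof, the second summand for traces that are not large. *)
Let rho := ((k ^ 2 + r * (2 ^ k * M) * k)%:R / kappa + (2 ^ k * M)%:R) * tau.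

Hypothesis small2 :
  (2 * s)%:R * (rho + tau) + (r * m)%:R * (k%:R * l^-1) + m%:R * tau <= kappa.

Lemma extremal_join : exists (Q : {set G}) (col : G -> 'I_r),
  #|Q| = s.-1 /\ forall u v, edge u v = join_edge Q col u v.
Proof.
have t0 := tau_gt0.
have rho_ge : (2 ^ k * M)%:R * tau <= rho.
  by rewrite /rho mulrDl lerDr mulr_ge0 ?divr_ge0 ?ler0n // ltW.
have rho0 : 0 <= rho by apply: le_trans rho_ge; rewrite mulr_ge0 ?ler0n // ltW.
have s1 : 2 <= (2 * s)%:R :> R by rewrite ler_nat; lia.
have rho_lt : rho < kappa.
  have : 2 * (rho + tau) <= (2 * s)%:R * (rho + tau) by rewrite ler_wpM2r // addr_ge0 // ltW.
  have : 0 <= (r * m)%:R * (k%:R * l^-1) by rewrite mulr_ge0 ?ler0n.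
  have : 0 <= m%:R * tau by rewrite mulr_ge0 ?ler0n // ltW.
  move: small2; lra.
have ex_large i : exists A, large_atom i A.
  apply/existsP; apply: contraT; rewrite negb_exists => /forallP nl.
  have := small_fibres i; rewrite (_ : [set v in I i | _] = I i); last first.
    by apply/setP=> v; rewrite !inE nl andbT.
  have := wI i; lra.
have /all_sig[A AP] i : {A | large_atom i A /\ forall A', large_atom i A' -> weight A' <= weight A}.
  have [A0 lA0] := sigW (ex_large i).
  case: (@Order.TotalTheory.arg_maxP _ _ _ A0 (large_atom i) (fun A => weight A) lA0) => A lA Amax.
  by exists A.
have AC i : A i \subset C by apply: large_atom_sub (proj1 (AP i)).
pose W i0 := [set w in C | [forall j, (j != i0) ==> (w \in A j)] && (s <= #|nbrs w :&: I i0|)%N].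
have few i0 : (#|W i0| < s)%N := few_common (fun j _ => proj1 (AP j)).
pose Q0 := \bigcap_i A i.
have Q0s : (#|Q0| < s)%N.
  apply: leq_ltn_trans (few ord0); apply: subset_leq_card.
  apply/subsetP=> w /bigcapP h; rewrite inE (subsetP (AC ord0)) ?h //=; apply/andP; split.
    by apply/forallP => j; rewrite h ?implybT.
  by apply: large_atom_nbrs (proj1 (AP ord0)) _; apply: h.
have Q0C : Q0 \subset C by apply: subset_trans (AC ord0); apply: bigcap_inf.
have [|Q [Q0Q QC Qs]] := subset_between (n := s.-1) Q0C.
  by rewrite sC andbT -ltnS prednK.
(* A vertex of [C] outside [Q] is missing from some [A i] and receives such a colour. Hence [A i]
   lies in [A1 i], the trace that the join gives to the vertices of [I i]. *)
pose col v : 'I_r := if v \in C then odflt ord0 [pick i | v \notin A i]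
                     else odflt ord0 [pick i | v \in I i].
have colI v : v \notin C -> v \in I (col v).
  move=> vC; rewrite /col (negbTE vC); case: pickP => // h.
  by have [i vi] := in_class vC; rewrite h in vi.
have colE v i : v \in I i -> col v = i.
  move=> vi; have vC : v \notin C by apply: contraL vi => /notin_class.
  by apply/eqP; apply: contraTT vi => ci; apply: (nt_disj nt ci); apply: colI.
have colA w : w \in C -> w \notin Q -> w \notin A (col w).
  move=> wC wQ; rewrite /col wC; case: pickP => // h; case/negP: wQ.
  by apply: (subsetP Q0Q); apply/bigcapP => i _; have /negbFE := h i.
have Qs1 : (#|Q| < s)%N by rewrite Qs prednK.
pose A1 i := [set v in C | (v \in Q) || (col v != i)].
have A1A i : A i \subset A1 i.
  apply/subsetP=> v vA; have vC := subsetP (AC i) v vA; rewrite inE vC /=.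
  case vQ: (v \in Q) => //=; apply: contraTneq vA => <-; apply: colA; rewrite ?vQ //.
pose g u := weight (A1 (col u)) - weight (atom u).
have gain : 2 * (\sum_(u in ~: C) x u * g u) <= weight C ^+ 2 := join_form_gain QC Qs1 colI.
have wC : weight C <= k%:R * tau.
  by apply: le_trans (weight_le_card x_le _) _; rewrite ler_pM2r // ler_nat.
pose lrg u := large_atom (col u) (atom u).
have g_lrg u : lrg u -> 0 <= g u.
  move=> lu; rewrite subr_ge0; apply: le_trans (proj2 (AP (col u)) _ lu) _.
  exact: weight_sub.
(* No entry is below kappa tau, so a vertex whose trace lies strictly inside the one given by the
   join gains at least this much. *)
pose bad := [set u in ~: C | lrg u && (kappa * tau <= g u)].
pose sml := [set u in ~: C | ~~ lrg u].
have wsml : weight sml <= (r * (2 ^ k * M))%:R * tau.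
  apply: (@le_trans _ _ (\sum_(i < r) (2 ^ k * M)%:R * tau)).
    apply: (@le_trans _ _ (weight (\bigcup_(i < r) [set v in I i | ~~ large_atom i (atom v)]))).
      apply: weight_sub => //; apply/subsetP=> u; rewrite inE in_setC => /andP[uC ul].
      by apply/bigcupP; exists (col u); rewrite // inE colI.
    apply: le_trans (weight_bigcup_le x_ge0 _ _) _; apply: ler_sum => i _.
    exact: small_fibres.
  by rewrite sumr_const card_ord -[_ *+ r]mulr_natl mulrA -natrM.
(* A vertex of [bad] gains at least kappa tau and one of [sml] loses at most k tau, so [gain] limits
   the weight of [bad]. *)
have wbad : weight bad <= (k ^ 2 + r * (2 ^ k * M) * k)%:R / kappa * tau.
  have ge_sum : weight bad * (kappa * tau) - weight sml * (k%:R * tau) <= \sum_(u in ~: C) x u * g u.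
    rewrite [leRHS](big_setID sml) /= addrC; apply: lerD.
      rewrite [leRHS](big_setID bad) /= -[leLHS]addr0; apply: lerD; last first.
        apply: sumr_ge0 => u; rewrite !inE => /andP[_ /andP[+ uC]].
        by rewrite uC /= negbK => /g_lrg h; rewrite mulr_ge0.
      rewrite (_ : _ :&: bad = bad); last first.
        apply/setIidPr/subsetP => u; rewrite !inE => /and3P[-> -> _].
        by rewrite andbF.
      rewrite {1}/weight mulr_suml; apply: ler_sum => u; rewrite inE => /and3P[_ _ h].
      by rewrite ler_wpM2l.
    rewrite (_ : _ :&: sml = sml); last by apply/setIidPr/subsetP => u; rewrite inE => /andP[].
    rewrite /weight mulr_suml -sumrN; apply: ler_sum => u _.
    rewrite -mulrN ler_wpM2l // /g -[leLHS]add0r lerD ?weight_ge0 // lerN2.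
    by apply: le_trans wC; apply: weight_sub => //; exact: atom_sub.
  have ww : weight C ^+ 2 <= (k%:R * tau) ^+ 2.
    by rewrite ler_sqr ?nnegrE ?weight_ge0 // mulr_ge0 ?ler0n // ltW.
  have ws : weight sml * (k%:R * tau) <= (r * (2 ^ k * M))%:R * tau * (k%:R * tau).
    by rewrite ler_wpM2r // mulr_ge0 ?ler0n // ltW.
  have kt : 0 < kappa * tau by rewrite mulr_gt0.
  rewrite -(ler_pM2r kt) natrD natrX natrM.
  set a := (k%:R : R) in ww ws gain *; set b := ((r * (2 ^ k * M))%:R : R) in ws *.
  have -> : (a ^+ 2 + b * a) / kappa * tau * (kappa * tau) = (a * tau) ^+ 2 + b * tau * (a * tau).
    by field; rewrite gt_eqF.
  have : 0 <= (a * tau) ^+ 2 by exact: sqr_ge0.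
  lra.
have wtyp i : weight (I i :\: bad) - (2 ^ k * M)%:R * tau <= weight (I i :&: [set u | lrg u] :\: bad).
  have := small_fibres i; have := weightID x (I i :\: bad) [set u | lrg u].
  have : weight ((I i :\: bad) :\: [set u | lrg u]) <= weight [set v in I i | ~~ large_atom i (atom v)].
    apply: weight_sub => //; apply/subsetP=> u; rewrite !inE => /and3P[+ _ ui].
    by rewrite /lrg (colE _ _ ui) ui.
  by rewrite setIDAC; lra.
(* If [A1 i] had a further vertex, every vertex of [I i] with a large trace would gain at least its
   entry, because [A i] is heaviest. All of them would be [bad], and [I i] would weigh at most rho <
   kappa. *)
have A1E i : A1 i = A i.
  apply/eqP; rewrite eq_sym eqEsubset A1A /=; apply/subsetP => v vA1.
  apply: contraT => vA; have vs : weight (A i) + x v <= weight (A1 i).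
    rewrite (weightID x (A1 i) [set v]) addrC; apply: lerD.
      by rewrite (setIidPr _) ?sub1set // /weight big_set1.
    apply: weight_sub => //; apply/subsetP=> u uA.
    rewrite in_setD in_set1 (subsetP (A1A i) _ uA) andbT.
    by apply: contraNneq vA => <-.
  have Ibad : I i :&: [set u | lrg u] :\: bad = set0.
    apply/eqP; rewrite setD_eq0; apply/subsetP=> u; rewrite in_setI [u \in [set _ | _]]inE => /andP[ui lu].
    rewrite inE lu /= in_setC (contraL (@notin_class u i) ui) /=.
    move: lu; rewrite /lrg /g (colE _ _ ui) => lu.
    have := proj2 (AP i) _ lu; have := x_ge v; rewrite -/tau; lra.
  have := wtyp i; rewrite Ibad weight0; have := wI i.
  have := weightD_ge x_ge0 (I i) bad; move: rho_lt; rewrite /rho mulrDl; lra.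
have QA i : Q \subset A i.
  by apply/subsetP=> w wQ; rewrite -A1E inE (subsetP QC) // wQ.
(* [W i] contains the s - 1 vertices of [Q] and has fewer than s elements. *)
have WQ i w : w \in W i -> w \in Q.
  move=> wW; apply: contraT => wQ; have := few i; rewrite ltnNge; case/negP.
  rewrite -[X in (X <= _)%N](prednK s_gt0) -Qs -add1n.
  have -> : (1 + #|Q|)%N = #|w |: Q| by rewrite cardsU1 wQ.
  apply: subset_leq_card; rewrite subUset sub1set wW /=.
  apply/subsetP=> z zQ; rewrite inE (subsetP QC) //=; apply/andP; split.
    by apply/forallP => j; rewrite (subsetP (QA j)) ?implybT.
  by apply: large_atom_nbrs (proj1 (AP i)) _; apply: (subsetP (QA i)).
have atomE u i : u \in I i -> lrg u -> u \notin bad -> atom u = A i.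
  move=> ui lu ub; have uC : u \notin C by apply: contraL ui => /notin_class.
  have lu' : large_atom i (atom u) by rewrite /lrg (colE _ _ ui) in lu.
  have sub : atom u \subset A i.
    (* A vertex of the trace outside [Q] and [A i] has colour i, hence lies in every other [A j];
       having s neighbours in [I i], it would belong to [W i]. *)
    apply/subsetP=> w wu; have wC' := subsetP (atom_sub u) w wu.
    case wQ: (w \in Q); first exact: (subsetP (QA i)).
    apply: contraT => wA; case/negP: (negbT wQ); apply: (WQ i).
    have cw : col w = i.
      by move: wA; rewrite -A1E inE wC' wQ /= negbK => /eqP.
    rewrite inE wC' /= (large_atom_nbrs lu' wu) andbT; apply/forallP => j.
    by apply/implyP => ji; rewrite -A1E inE wC' wQ cw eq_sym.
  apply/eqP; rewrite eqEsubset sub /=; apply/subsetP => v vA; apply: contraT => vu.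
  case/negP: ub; rewrite inE in_setC uC lu /= /g (colE _ _ ui) A1E.
  apply: (@le_trans _ _ (x v)); first exact: x_ge.
  rewrite lerBrDr (weightID x (A i) [set v]); apply: lerD.
    by rewrite (setIidPr _) ?sub1set // /weight big_set1.
  apply: weight_sub => //; apply/subsetP=> z zu; rewrite !inE (subsetP sub) // andbT.
  by apply: contraNneq vu => <-.
have wdef i : weight [set u in I i | atom u != A i] <= rho.
  apply: (@le_trans _ _ (weight (bad :|: [set u in I i | ~~ large_atom i (atom u)]))).
    apply: weight_sub => //; apply/subsetP=> u; rewrite inE => /andP[ui uA].
    rewrite in_setU; apply/orP; case lu: (large_atom i (atom u)); last by right; rewrite inE ui lu.
    left; apply: contraR uA => ub; apply/eqP; apply: atomE => //.
    by rewrite /lrg (colE _ _ ui).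
  apply: le_trans (weightU_le x_ge0 _ _) _; rewrite /rho mulrDl; apply: lerD => //.
  exact: small_fibres.
have missing z j : z \in Q \/ col z != j -> weight (I j :\: nbrs z) <= rho.
  move=> zj; case zC: (z \in C); last first.
    have [zQ|ci] := zj; first by have := subsetP QC z zQ; rewrite zC.
    have zi := colI z (negbT zC).
    apply: le_trans (nc ci zi) _; apply: (@le_trans _ _ ((k ^ 2)%:R / kappa * tau)).
      have k1 : kappa <= 1.
        by apply: le_trans (wI ord0) _; rewrite -(ep_sum ext); apply: weight_sub => //; exact: subsetT.
      rewrite ler_wpM2r ?(ltW t0) // ler_pdivlMr // natrX expr2 ler_wpM2l ?ler0n //.
      by apply: le_trans k1 _; rewrite ler1n; exact: leq_trans s_gt0 sk.
    rewrite /rho natrD !mulrDl -addrA lerDl addr_ge0 // mulr_ge0 ?divr_ge0 ?ler0n // ltW //.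
  apply: le_trans (wdef j); apply: weight_sub => //; apply/subsetP=> u.
  rewrite !inE => /andP[zu uj]; rewrite uj /=; apply: contraNneq zu => uA.
  have : z \in atom u.
    rewrite uA -A1E inE zC /=; by case: zj => ->; rewrite ?orbT.
  by rewrite inE inE edge_sym => /andP[].
(* An edge inside a colour class, together with a matching of the s - 1 vertices of [Q] into [I i]
   avoiding its ends, would give s disjoint edges and so a copy of F. *)
have indep u v : u \notin Q -> v \notin Q -> edge u v -> col u != col v.
  move=> uQ vQ uv; apply/eqP => cuv; set i := col u in cuv.
  pose B := I i :\: [set u; v].
  have wuv : weight [set u; v] <= 2 * tau.
    apply: le_trans (weight_le_card x_le _) _; rewrite ler_pM2r // cards2 ler_nat.
    by case: (u != v).
  have [|Mt [mM Mw MB]] := @star_matching G (enum Q) B (enum_uniq _).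
    move=> w; rewrite mem_enum => wQ; split.
      by rewrite inE negb_and; apply/orP; right; apply: notin_class; apply: (subsetP QC).
    rewrite -cardE Qs; apply: (card_ge_weight x_le tau_gt0); rewrite -/tau.
    have := weightD_ge x_ge0 (nbrs w :&: I i) [set u; v]; rewrite -setIDA -/B.
    have := weightID x (I i) (nbrs w); rewrite [I i :&: _]setIC.
    have := missing w i (or_introl wQ); have := wI i.
    have : s.-1%:R * tau + 2 * tau <= (2 * s)%:R * tau.
      rewrite -mulrDl -natrD ler_pM2r // ler_nat addn2 prednK // mul2n -addnn.
      by rewrite -[X in (X <= _)%N]addn1 leq_add2l.
    have : rho * 2 <= rho * (2 * s)%:R by rewrite ler_wpM2l.
    have : 0 <= (r * m)%:R * (k%:R * l^-1) by rewrite mulr_ge0 ?ler0n.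
    have : 0 <= m%:R * tau by rewrite mulr_ge0 ?ler0n // ltW.
    move: small2; lra.
  have uvM z : z \in [:: u; v] -> z \notin ends Mt.
    move=> zuv; rewrite /ends mem_cat Mw mem_enum negb_or; apply/andP; split.
      by move: zuv; rewrite !inE => /orP[] /eqP ->.
    by apply/negP => /MB; rewrite !inE => /andP[/negP[]]; move: zuv; rewrite !inE.
  apply: (ep_free ext).
  apply: (@matching_join_turan_of_matching R G x tau x_ge0 x_le tau_gt0 m s p I (k%:R * l^-1) rho ((u, v) :: Mt) i) => //.
  - by apply: is_matching_cons => //; apply: uvM; rewrite !inE eqxx ?orbT.
  - by rewrite /= -(size_map fst) Mw -cardE Qs prednK.
  - move=> z j; rewrite ends_cons !inE => zM ji; apply: missing.
    case/or3P: zM => [/eqP->|/eqP->|]; [by right; rewrite eq_sym|by right; rewrite -cuv eq_sym|].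
    rewrite /ends mem_cat Mw mem_enum => /orP[zQ|/MB]; first by left.
    by rewrite inE => /andP[_ zi]; right; rewrite (colE _ _ zi) eq_sym.
  - move=> j; apply: le_trans (wI j); move: small2; lra.
exists Q, col; split=> // u v.
pose e := join_edge Q col.
have sube a b : edge a b -> e a b.
  move=> ab; apply/andP; split; first by apply: contraTneq ab => ->; rewrite edge_irrefl.
  case aQ: (a \in Q) => //=; case bQ: (b \in Q) => //=.
  by apply: indep ab; rewrite ?aQ ?bQ.
have nbr_le a : nbr_sum (@edge G) x a <= nbr_sum e x a.
  rewrite /nbr_sum [leRHS](bigID (fun b => edge a b)) /= -[leLHS]addr0; apply: lerD; last exact: sumr_ge0.
  rewrite le_eqVlt; apply/orP; left; apply/eqP; apply: eq_bigl => b.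
  by case ab: (edge a b); rewrite ?andbF // (sube _ _ ab).
(* G lies inside the join, so the form does not decrease and [x] is an eigenvector of both graphs
   for [l]; with positive entries, no edge of the join can be missing from G. *)
have eig : eigenvector e l x.
  apply: (ep_max ext (@join_edge_free G p Q col m s Qs1 sm p_gt0)).
  rewrite -(adj_form_eigenvector (ep_eigen ext)); apply: ler_sum => a _.
  by rewrite ler_wpM2l.
apply/idP/idP; first exact: sube.
move=> euv; apply: contraT => nuv.
have : nbr_sum e x u = nbr_sum (@edge G) x u by rewrite -eig (ep_eigen ext).
have : nbr_sum (@edge G) x u + x v <= nbr_sum e x u.
  rewrite /nbr_sum [leRHS](bigD1 v) //= [leLHS]addrC; apply: lerD => //.
  rewrite big_mkcond [leRHS]big_mkcond; apply: ler_sum => b _.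
  case ub: (edge u b); last by case: ifP.
  rewrite (sube _ _ ub) /= ifT //; apply: contraNneq nuv => <-; exact: ub.
have : 0 < x v by apply: lt_le_trans (x_ge v); rewrite mulr_gt0.
lra.
Qed.

End Atoms.

Section JoinStructure.
Local Open Scope ring_scope.

Lemma extremal_pair_join (m s p : nat) :
  (0 < s)%N -> (2 * s <= m)%N -> (0 < p)%N ->
  exists D : nat, (0 < D)%N /\
  forall (R : realFieldType) (G : sgraph) (l : R) (x : G -> R),
    extremal_pair (matching_join_turan m s p) l x -> D%:R <= l ->
    1 - p.+1%:R^-1 - l^-1 <= adj_form (@edge G) x ->
    (forall v, 0 < x v) /\
    exists (Q : {set G}) (col : G -> 'I_p.+1),
      #|Q| = s.-1 /\ forall u v, edge u v = join_edge Q col u v.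
Proof.
move=> s0 sm p0; have [D [k [D0 sk HD]]] := extremal_structure s0 sm p0.
have [M ME] : exists M, M = (s * k + p.+1 * m * k + m)%N by eexists.
have [Y YE] : exists Y, Y = (k ^ 2 + p.+1 * (2 ^ k * M) * k)%N by eexists.
have [Z ZE] : exists Z, Z = (2 ^ k * M)%N by eexists.
have [W WE] : exists W, W = (Y * (4 * p.+1) + Z)%N by eexists.
(* The factor 4 p.+1 is 1 / kappa; the last two summands provide [small1] and [small2]. *)
exists (D + 4 * p.+1 * (2 * s + M) + 4 * p.+1 * (2 * s * (W + 1) + p.+1 * m * k + m))%N.
split; first by rewrite !addn_gt0 D0.
move=> R G l x ext Dl dens; have l0 := ep_gt0 ext.
have Dl1 : D%:R <= l by apply: le_trans Dl; rewrite ler_nat -addnA leq_addr.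
have [I [nt /andP[sC Ck] wI x_ge]] := HD R G l x ext Dl1 dens.
pose kappa : R := (4 * p.+1)%:R^-1.
have k0 : 0 < kappa by rewrite invr_gt0 ltr0n.
have kE (a : nat) : (4 * p.+1 * a <= D + 4 * p.+1 * (2 * s + M) +
    4 * p.+1 * (2 * s * (W + 1) + p.+1 * m * k + m))%N -> a%:R * l^-1 <= kappa.
  move=> aD; rewrite ler_pdivrMr // -ler_pdivrMl // invrK -natrM.
  by apply: le_trans Dl; rewrite ler_nat.
have xk v : kappa * l^-1 <= x v by rewrite -invfM.
split=> [v|]; first by apply: lt_le_trans (xk v); rewrite mulr_gt0 // invr_gt0.
apply: (@extremal_join R G l x m s p k s0 sm p0 ext I nt Ck sC sk kappa k0 wI xk).
  by rewrite -ME; apply: kE; apply: leq_trans (leq_addr _ _); apply: leq_addl.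
rewrite -ME -YE -ZE invrK.
have -> : (2 * s)%:R * ((Y%:R * (4 * p.+1)%:R + Z%:R) * l^-1 + l^-1) +
     (p.+1 * m)%:R * (k%:R * l^-1) + m%:R * l^-1 =
   (2 * s * (W + 1) + p.+1 * m * k + m)%:R * l^-1.
  by rewrite WE; ring.
by apply: kE; apply: leq_addl.
Qed.

Definition join_class (V : finType) r (Q : {set V}) (col : V -> 'I_r) i : {set V} :=
  [set v | (v \notin Q) && (col v == i)].

(* With [a], [b] the sizes of the classes of [i] and [j], the entries of [x] on
   them are [1 / (l + a)] and [1 / (l + b)]; moving a vertex between the classes
   increases the form as soon as [b + 2 <= a]. *)
Lemma extremal_join_balanced (R : realFieldType) (G : sgraph) (l : R) (x : G -> R)
    m s p (Q : {set G}) (col : G -> 'I_p.+1) i j :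
  (0 < s)%N -> (2 * s <= m)%N -> (0 < p)%N ->
  extremal_pair (matching_join_turan m s p) l x -> (forall v, 0 < x v) ->
  #|Q| = s.-1 -> (forall u v, edge u v = join_edge Q col u v) ->
  (#|join_class Q col i| <= #|join_class Q col j| + 1)%N.
Proof.
move=> s0 sm p0 ext xpos Qs eE; have l0 := ep_gt0 ext; have x0 := ep_ge0 ext.
rewrite leqNgt; apply/negP => ab.
have ij : i != j by apply: contraTneq ab => ->; rewrite -leqNgt addn1 leqnSn.
pose K := join_class Q col.
have nbr v : v \notin Q -> weight x (nbrs v) = 1 - weight x (K (col v)).
  move=> vQ; rewrite -(ep_sum ext) (weightID x setT (K (col v))) setTI addrAC subrr add0r.
  congr (weight _); apply/setP=> u; rewrite !inE eE /join_edge (negbTE vQ) /= andbT.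
  rewrite negb_and negbK; case uQ: (u \in Q) => /=.
    by rewrite andbT; apply: contraNneq vQ => ->.
  by rewrite eq_sym [col v == _]eq_sym; case: (eqVneq u v) => [->|]; rewrite ?eqxx.
have xK v : v \notin Q -> l * x v = 1 - weight x (K (col v)).
  by move=> vQ; rewrite -nbr // (extremal_weight_nbrs ext).
have wK c : weight x (K c) * (l + #|K c|%:R) = #|K c|%:R.
  have h : l * weight x (K c) = \sum_(v in K c) (1 - weight x (K c)).
    rewrite /weight mulr_sumr; apply: eq_bigr => v; rewrite inE => /andP[vQ /eqP cv].
    by rewrite xK // cv.
  rewrite sumr_const -[_ *+ _]mulr_natr in h.
  by rewrite mulrDr mulrC h; ring.
have [v] : exists v, v \in K i by apply/set0Pn; rewrite -card_gt0; apply: leq_trans ab.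
rewrite inE => /andP[vQ /eqP vi].
pose col' u := if u == v then j else col u.
pose e := join_edge Q col'.
have es := join_edge_sym Q col'; have ei := join_edge_irrefl Q col'.
have Qs1 : (#|Q| < s)%N by rewrite Qs prednK.
have := extremal_max ext (@join_edge_free G p Q col' m s Qs1 sm p0).
rewrite (adj_form_vertex x v es ei) (adj_form_vertex x v (@edge_sym G) (@edge_irrefl G)).
have -> : \sum_(u | u != v) x u * (\sum_(w | (w != v) && join_edge Q col' u w) x w) =
          \sum_(u | u != v) x u * (\sum_(w | (w != v) && edge u w) x w).
  apply: eq_bigr => u uv; congr (_ * _); apply: eq_bigl => w.
  by case: (eqVneq w v) => //= wv; rewrite eE /join_edge /col' (negbTE uv) (negbTE wv).
rewrite lerD2r ler_pM2l // ler_pM2l // nbr_sum_nbrs nbr // vi.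
have -> : nbr_sum (join_edge Q col') x v = 1 - weight x (K j) - x v.
  have -> : nbr_sum (join_edge Q col') x v = weight x (~: (v |: K j)).
    apply: eq_bigl => u; rewrite !inE /join_edge /col' eqxx (negbTE vQ) /=.
    rewrite negb_or; case: (eqVneq u v) => [->|uv]; rewrite ?eqxx //=.
    by rewrite negb_and negbK [col u == _]eq_sym.
  have := weightID x setT (v |: K j); rewrite setTI (ep_sum ext) setTD.
  have := weightID x (v |: K j) [set v].
  rewrite (setIidPr _) ?sub1set ?inE ?eqxx // /weight big_set1.
  rewrite setDUl setDv set0U (_ : K j :\ v = K j); last first.
    apply/setP=> u; rewrite !inE; case: (eqVneq u v) => //= ->.
    by rewrite vi (negbTE ij) andbF.
  rewrite -/(weight x _) => -> ->; rewrite /weight; ring.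
have xv := xK v vQ; rewrite vi in xv.
have wij : weight x (K i) + weight x (K j) <= 1.
  rewrite -(ep_sum ext) (weightID x setT (K i)) setTI lerD2l.
  apply: weight_sub => //; apply/subsetP=> u; rewrite inE => /andP[uQ /eqP cu].
  by rewrite !inE uQ cu eq_sym (negbTE ij).
have [a aE] : exists a : R, a = #|K i|%:R by eexists.
have [b bE] : exists b : R, b = #|K j|%:R by eexists.
have ba : b + 2 <= a.
  by rewrite aE bE -natrD ler_nat; move: ab; rewrite addn1 addn2.
have b0 : 0 <= b by rewrite bE ler0n.
have := wK i; have := wK j; rewrite -aE -bE.
move: xv wij; move: (weight x (K i)) (weight x (K j)) (x v) => wi wj y xv wij wjE wiE h.
have yE : y * (l + a) = 1.
  apply: (mulfI (lt0r_neq0 l0)).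
  by rewrite mulrA xv mulrBl wiE mul1r mulr1; ring.
have d1 : 0 < l + a by lra.
have d2 : 0 < l + b by lra.
have d12 := ltW (mulr_gt0 d1 d2).
have e1 : wi * ((l + a) * (l + b)) = a * (l + b) by rewrite mulrA wiE.
have e2 : wj * ((l + a) * (l + b)) = b * (l + a).
  by rewrite [(l + a) * _]mulrC mulrA wjE.
have e3 : y * ((l + a) * (l + b)) = l + b by rewrite mulrA yE mul1r.
(* Since a >= b + 2, [p1] forces l <= b, whereas [p2] says a b <= l^2 and forces b < l. *)
have p1 : a * (l + b) <= b * (l + a) + (l + b).
  have h1 : wi <= wj + y by lra.
  by have := ler_wpM2r d12 h1; rewrite [(wj + y) * _]mulrDl e1 e2 e3.
have p2 : a * (l + b) + b * (l + a) <= (l + a) * (l + b).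
  by have := ler_wpM2r d12 wij; rewrite [(wi + wj) * _]mulrDl e1 e2 mul1r.
have lb : l <= b.
  have : 0 <= l * (a - b - 2) by rewrite mulr_ge0 ?(ltW l0) //; lra.
  lra.
have : 0 <= (b - l) * l by rewrite mulr_ge0 ?(ltW l0) //; lra.
have : 0 <= (b - l) * b by rewrite mulr_ge0 //; lra.
have : 0 <= b * (a - b - 2) by rewrite mulr_ge0 //; lra.
lra.
Qed.
End JoinStructure.

(** * Isomorphism with the join of a clique and a Turan graph *)

Lemma isomorphic_sym (G H : sgraph) : isomorphic G H -> isomorphic H G.
Proof.
move=> [f [[g fK gK] fe]]; exists g; split; first by exists f.
by move=> u v; rewrite -fe !gK.
Qed.

Lemma isomorphic_subgraph (G H F : sgraph) : isomorphic G H ->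
  has_subgraph G F -> has_subgraph H F.
Proof.
move=> [f [/bij_inj fi fe]] [h [hi he]]; exists (f \o h); split; first exact: inj_comp.
by move=> u v /he; rewrite /= fe.
Qed.

Lemma isomorphic_order (G H : sgraph) : isomorphic G H -> Defs.order G = Defs.order H.
Proof. by move=> [f [/bij_eq_card]]. Qed.

(** All values are the minimum or one more. The set [B] of larger ones is not everything, so the
    minimum and the size of [B] are the quotient and remainder of [N]. Listing [B] first matches the
    order in [turan_part]. *)
Lemma balanced_turan_part p N (n : 'I_p.+1 -> nat) :
  \sum_i n i = N -> (forall i j, n i <= n j + 1) ->
  exists t : 'I_p.+1 -> 'I_p.+1, injective t /\ forall i, n (t i) = turan_part N i.
Proof.
move=> nN bal; pose r := p.+1.
pose i0 := [arg min_(i < ord0 | true) n i].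
have min0 j : n i0 <= n j by rewrite /i0; case: arg_minnP => // i _; apply.
pose B := [set i | n i0 < n i].
have nE i : n i = n i0 + (i \in B).
  by rewrite inE; have := bal i i0; have := min0 i; case: ltnP; lia.
have Br : #|B| < r.
  rewrite -[X in _ < X](card_ord r) -cardsT; apply: proper_card.
  by rewrite properE subsetT /=; apply/subsetPn; exists i0; rewrite ?inE ?ltnn.
have NE : N = n i0 * r + #|B|.
  rewrite -nN (eq_bigr _ (fun i _ => nE i)) big_split /= sum_nat_const card_ord mulnC.
  by congr (_ + _); rewrite -sum1_card [RHS]big_mkcond; apply: eq_bigr => i _; case: (i \in B).
have Nq : N %/ r = n i0 by rewrite NE divnMDl // divn_small // addn0.
have Nm : N %% r = #|B| by rewrite NE modnMDl modn_small.
pose s := enum B ++ enum (~: B).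
have ss : size s = r by rewrite size_cat -!cardE cardsC card_ord.
have us : uniq s.
  rewrite cat_uniq !enum_uniq /= andbT; apply/hasPn => i.
  by rewrite !mem_enum inE.
exists (fun i => nth ord0 s i); split.
  move=> i j /eqP; rewrite nth_uniq ?ss // => /eqP; exact: val_inj.
move=> i; rewrite nE /turan_part -/r Nq Nm; congr (_ + nat_of_bool _).
rewrite nth_cat -cardE; case: ltnP => iB.
  by rewrite -mem_enum mem_nth // -cardE.
apply/negbTE; rewrite -in_setC -mem_enum mem_nth // -cardE.
by rewrite ltn_subLR // cardsC card_ord ltn_ord.
Qed.

Lemma join_edge_isomorphic (G : sgraph) p (Q : {set G}) (col : G -> 'I_p.+1) s N :
  #|Q| = s -> Defs.order G = s + N -> 0 < Defs.order G ->
  (forall u v, edge u v = join_edge Q col u v) ->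
  (forall i j, #|join_class Q col i| <= #|join_class Q col j| + 1) ->
  isomorphic G (graph_join (complete_graph s) (turan N p.+1)).
Proof.
move=> Qs ordG G0 eE bal; have d : G by case/card_gt0P/sigW: G0.
pose K := join_class Q col.
have KN : \sum_i #|K i| = N.
  have -> : \sum_i #|K i| = #|~: Q|.
    rewrite -sum1_card (partition_big col predT) //=; apply: eq_bigr => i _.
    by rewrite -sum1_card; apply: eq_bigl => v; rewrite !inE.
  by apply/eqP; rewrite -(eqn_add2l s) -ordG -Qs cardsC.
have [t [ti tE]] := balanced_turan_part KN bal.
pose H := graph_join (complete_graph s) (turan N p.+1).
pose g (z : H) : G := match z with
  | inl i => nth d (enum Q) i
  | inr (existT i a) => nth d (enum (K (t i))) a end.
have lQ (i : 'I_s) : i < #|Q| by rewrite Qs.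
have lK i (a : 'I_(@turan_part N p.+1 i)) : a < #|K (t i)|.
  by rewrite (tE i : #|K (t i)| = _) ltn_ord.
have gQ (i : 'I_s) : nth d (enum Q) i \in Q by exact: nth_enum_in.
have gK i (a : 'I_(@turan_part N p.+1 i)) : nth d (enum (K (t i))) a \in K (t i).
  exact: nth_enum_in.
have gK2 i (a : 'I_(@turan_part N p.+1 i)) :
    (nth d (enum (K (t i))) a \in Q = false) * (col (nth d (enum (K (t i))) a) = t i).
  by have := gK i a; rewrite inE => /andP[/negbTE -> /eqP].
have gi : injective g.
  case=> [i|[i a]] [j|[j b]] /= h.
  - by congr inl; apply: val_inj; apply: nth_enum_inj h.
  - by have := gQ i; rewrite h gK2.
  - by have := gQ j; rewrite -h gK2.
  - have ij : i = j by apply: ti; rewrite -(gK2 i a).2 h gK2.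
    subst j; congr (inr (existT _ _ _)); apply: val_inj; exact: nth_enum_inj h.
have gb : bijective g.
  apply: inj_card_bij => //; rewrite [X in X <= _]ordG.
  have := @order_turan N p.+1 isT; rewrite /Defs.order => hN.
  by rewrite card_sum card_ord hN.
apply: isomorphic_sym; exists g; split=> // u v.
rewrite eE /join_edge (inj_eq gi); case: u v => [i|[i a]] [j|[j b]] //=.
- by rewrite gQ andbT.
- by rewrite gQ.
- by rewrite gQ orbT.
- rewrite !gK2 /= (inj_eq ti).
  case: (boolP (i == j)) => ij /=; first by rewrite andbF.
  by rewrite andbT; apply/eqP => -[] h; case/eqP: ij.
Qed.

(** * Extremal graphs for the spectral radius *)

Section SpectralExtremal.
Local Open Scope ring_scope.
Variable R : realType.

Lemma spectral_radius_perron (G : sgraph) : (0 < Defs.order G)%N ->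
  exists x : G -> R, [/\ rayleigh_bound (@edge G) (spectral_radius R G),
    forall v, 0 <= x v, \sum_v x v = 1 & eigenvector (@edge G) (spectral_radius R G) x].
Proof.
move=> G0; have [l [x [rb x0 x1 ex]]] := @perron_eigenvector R G _ (@edge_sym G) G0.
by exists x; rewrite (spectral_radiusE rb x1 ex).
Qed.

Lemma isomorphic_spectral_radius (G H : sgraph) : (0 < Defs.order G)%N ->
  isomorphic G H -> spectral_radius R G = spectral_radius R H.
Proof.
move=> G0 [f [fb fe]]; have H0 : (0 < Defs.order H)%N by rewrite /Defs.order -(bij_eq_card fb).
have [y [rb _ y1 ey]] := spectral_radius_perron H0.
have nE (z : H -> R) u : nbr_sum (@edge G) (z \o f) u = nbr_sum (@edge H) z (f u).
  rewrite /nbr_sum [RHS](reindex f) /=; last exact: onW_bij.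
  by apply: eq_bigl => v; rewrite fe.
have [g fK gK] := fb.
apply: (@spectral_radiusE R G _ (y \o f)).
- move=> z; have zE : z = (z \o g) \o f by apply: funext => v /=; rewrite fK.
  have -> : adj_form (@edge G) z = adj_form (@edge H) (z \o g).
    rewrite /adj_form [RHS](reindex f) /=; last exact: onW_bij.
    by apply: eq_bigr => v _; rewrite -nE -zE fK.
  have -> : sqnorm z = sqnorm (z \o g).
    rewrite /sqnorm [RHS](reindex f) /=; last exact: onW_bij.
    by apply: eq_bigr => v _; rewrite fK.
  exact: rb.
- by rewrite -y1 [RHS](reindex f) //; exact: onW_bij.
- by move=> v; rewrite nE ey.
Qed.

Lemma SPEX_isomorphic n F (G H : sgraph) : (0 < n)%N -> isomorphic G H ->
  SPEX R n (family1 F) G -> SPEX R n (family1 F) H.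
Proof.
move=> n0 GH [Gn fG mG]; have Gn0 : (0 < Defs.order G)%N by rewrite Gn.
split; first by rewrite -(isomorphic_order GH).
  by move=> F' FF' hF; apply: (fG F' FF'); apply: isomorphic_subgraph hF; apply: isomorphic_sym.
by move=> H' H'n fH'; rewrite -(isomorphic_spectral_radius Gn0 GH) mG.
Qed.

(** Every graph of order n is isomorphic to one coded by a boolean function on pairs, made symmetric
    and loopless by [e]; the maximum is taken over this finite type of codes. *)
Lemma SPEX_exists n F (H : sgraph) : (0 < n)%N ->
  Defs.order H = n -> ~ has_subgraph H F -> exists G, SPEX R n (family1 F) G.
Proof.
move=> n0 Hn fH.
pose e (E : {ffun 'I_n * 'I_n -> bool}) : rel 'I_n :=
  fun u v => (u != v) && (E (u, v) || E (v, u)).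
have es E : symmetric (e E) by move=> u v; rewrite /e eq_sym orbC.
have ei E : irreflexive (e E) by move=> u; rewrite /e eqxx.
pose gr E := SGraph (es E) (ei E).
have iso (K : sgraph) : Defs.order K = n -> exists E, isomorphic K (gr E).
  move=> Kn; have nK : #|{: K}| = n by [].
  pose g (i : 'I_n) : K := enum_val (cast_ord (esym nK) i).
  pose f (v : K) : 'I_n := cast_ord nK (enum_rank v).
  have fK : cancel f g by move=> v; rewrite /g /f cast_ordK enum_rankK.
  have gK : cancel g f by move=> i; rewrite /g /f enum_valK cast_ordKV.
  exists [ffun z => edge (g z.1) (g z.2)]; exists f; split; first by exists g.
  move=> u v; rewrite /= /e !ffunE /= !fK [edge v u]edge_sym orbb (can_eq fK).
  by case: eqP => [->|]; rewrite ?edge_irrefl.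
have order_gr E : Defs.order (gr E) = n by rewrite /Defs.order card_ord.
pose P E := `[< ~ has_subgraph (gr E) F >].
have [E0 HE0] := iso H Hn.
have P0 : P E0.
  by apply/asboolP => h; apply: fH; apply: isomorphic_subgraph h; apply: isomorphic_sym.
case: (@Order.TotalTheory.arg_maxP _ _ _ E0 P (fun E => spectral_radius R (gr E)) P0) => E /asboolP PE Emax.
exists (gr E); split; first exact: order_gr.
  by move=> _ ->.
move=> K Kn fK; have [E' KE'] := iso K Kn.
rewrite (isomorphic_spectral_radius _ KE') ?Kn //; apply: Emax; apply/asboolP => h.
by apply: (fK F erefl); apply: isomorphic_subgraph h; apply: isomorphic_sym.
Qed.

(** A competitor on the same vertices has spectral radius at most that of [G], so it satisfies the
    same Rayleigh bound, and a tie makes [x] an eigenvector of it. *)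
Lemma SPEX_extremal_pair n F (G : sgraph) : (0 < n)%N -> SPEX R n (family1 F) G ->
  0 < spectral_radius R G ->
  exists x : G -> R, extremal_pair F (spectral_radius R G) x.
Proof.
move=> n0 [Gn fG mG] l0; have Gn0 : (0 < Defs.order G)%N by rewrite Gn.
have [x [rb x0 x1 ex]] := spectral_radius_perron Gn0.
exists x; split=> //.
- exact: fG.
- by rewrite -x1; apply: eq_bigl => v; rewrite inE.
move=> e es ei fe le; pose H := SGraph es ei.
apply: rayleigh_eigenvector => // y.
have [z [rbH _ _ _]] := @spectral_radius_perron H Gn0.
apply: le_trans (rbH y) _; apply: ler_wpM2r; first exact: sqnorm_ge0.
by apply: mG => // F' ->.
Qed.

End SpectralExtremal.

Section TuranJoin.
Variables (s N p : nat).

Notation H := (graph_join (complete_graph s) (turan N p.+1)).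

Lemma order_turan_join : Defs.order H = s + N.
Proof.
have := @order_turan N p.+1 isT; rewrite /Defs.order => hN.
by rewrite card_sum card_ord hN.
Qed.

Lemma turan_join_free m : 2 * s.+1 <= m -> 0 < p ->
  ~ has_subgraph H (matching_join_turan m s.+1 p).
Proof.
move=> sm p0; pose Q : {set H} := [set z | if z is inl _ then true else false].
pose col (z : H) : 'I_p.+1 := if z is inr a then tag a else ord0.
apply: (@matching_join_turan_free H m s.+1 p Q col) => //.
  have -> : Q = [set inl a | a : 'I_s].
    by apply/setP=> -[a|a]; rewrite inE; apply/esym; [apply/imsetP; exists a | apply/imsetP => -[]].
  by rewrite ltnS -[X in _ <= X]card_ord leq_imset_card.
by case=> [a|a] [b|b]; rewrite !inE.
Qed.

Lemma turan_join_degree (v : H) : s + N <= #|[pred u | edge v u]| + (N %/ p.+1 + 1).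
Proof.
rewrite -order_turan_join /Defs.order -(cardC [pred u | edge v u]) leq_add2l.
case: v => [a|[i a]].
  apply: (@leq_trans 1); last exact: leq_addl.
  have sub : predC [pred u : H | edge (inl a : H) u] \subset [set (inl a : H)].
    by apply/subsetP=> -[b|b]; rewrite !inE //= negbK => /eqP ->.
  by apply: leq_trans (subset_leq_card sub) _; rewrite cards1.
apply: (@leq_trans (turan_part N i)); last first.
  by rewrite /turan_part leq_add2l; case: ltnP.
rewrite -[X in _ <= X]card_ord.
have sub : predC [pred u : H | edge (inr (existT _ i a) : H) u] \subset
    [set inr (existT (fun i => 'I_(@turan_part N p.+1 i)) i b) | b : 'I_(@turan_part N p.+1 i)].
  apply/subsetP; case=> [b|[j b]]; rewrite !inE //= negbK => /eqP ij.
  by subst j; apply/imsetP; exists b.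
by apply: leq_trans (subset_leq_card sub) (leq_imset_card _ _).
Qed.

End TuranJoin.

Section Main.
Local Open Scope ring_scope.
Variable R : realType.

(** The all-ones vector in the Rayleigh bound: every degree is at least (1 - 1/r) n - 1. *)
Lemma turan_join_spectral_radius s N p : (0 < s + N)%N ->
  (1 - p.+1%:R^-1) * (s + N)%:R - 1 <=
    spectral_radius R (graph_join (complete_graph s) (turan N p.+1)).
Proof.
move=> sN0; set H := graph_join _ _; have Hn : Defs.order H = (s + N)%N := order_turan_join s N p.
have H0 : (0 < Defs.order H)%N by rewrite Hn.
have [x [rb _ _ _]] := @spectral_radius_perron R H H0.
have := rb (fun=> 1); rewrite /adj_form /sqnorm.
under [X in _ <= _ * X]eq_bigr do rewrite expr1n.
rewrite sumr_const; have -> : #|{: H}| = (s + N)%N := Hn.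
set l := spectral_radius R H; set n := (s + N)%N => h.
have n0 : 0 < n%:R :> R by rewrite ltr0n.
have : \sum_(v : H) ((1 - p.+1%:R^-1) * n%:R - 1) <= l * n%:R.
  apply: le_trans h; apply: ler_sum => v _; rewrite mul1r /nbr_sum sumr_const.
  have := turan_join_degree v; rewrite -(ler_nat R) -/n => h.
  rewrite natrD [(_ + 1)%:R]natrD in h.
  have : (N %/ p.+1)%:R <= p.+1%:R^-1 * n%:R :> R.
    rewrite -ler_pdivrMl ?invr_gt0 ?ltr0n // invrK -natrM ler_nat mulnC.
    by apply: leq_trans (leq_divM _ _) _; exact: leq_addl.
  have -> : 1 *+ #|edge v| = #|[pred u | edge v u]|%:R :> R.
    by congr (_ *+ _); apply: eq_card.
  move: h; move: (#|_|%:R : R) (n%:R : R) ((N %/ p.+1)%:R : R) (p.+1%:R^-1 : R) => a b c d.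
  lra.
rewrite sumr_const; have -> : #|{: H}| = n := Hn.
by rewrite -[_ *+ n]mulr_natr ler_pM2r.
Qed.

Lemma SPEX_turan_join (m s p : nat) :
  (0 < s)%N -> (2 * s <= m)%N -> (0 < p)%N ->
  exists N0 : nat, forall n, (N0 <= n)%N -> forall G,
    SPEX R n (family1 (matching_join_turan m s p)) G ->
    isomorphic G (graph_join (complete_graph (s - 1)) (turan (n - s + 1) p.+1)).
Proof.
move=> s0 sm p0; have [D [D0 HD]] := extremal_pair_join s0 sm p0.
(* As 1 - 1/r >= 1/2, comparison with [G0] gives l >= n / 2 - 1 >= D + 1. *)
exists (2 * D + 2 * s + 4)%N => n nN G SG.
have n0 : (0 < n)%N by lia.
have nE : n = (s - 1 + (n - s + 1))%N by lia.
set G0 := graph_join _ _.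
have oG0 : Defs.order G0 = n by rewrite [RHS]nE; exact: order_turan_join.
have fG0 : ~ has_subgraph G0 (matching_join_turan m s p).
  have := @turan_join_free (s - 1) (n - s + 1) p m.
  have -> : (s - 1).+1 = s by rewrite subn1 prednK.
  by move=> h; exact: h sm _.
have [Gn fG mG] := SG.
have n0' : 0 < n%:R :> R by rewrite ltr0n.
set l := spectral_radius R G.
have lG0 : (1 - p.+1%:R^-1) * n%:R - 1 <= l.
  apply: le_trans (mG G0 oG0 _); last by move=> _ ->.
  by rewrite {1}nE; apply: turan_join_spectral_radius; rewrite -nE.
have q2 : p.+1%:R^-1 <= 2^-1 :> R by rewrite lef_pV2 ?posrE ?ltr0n ?ler_nat.
have lD : D%:R + 1 <= l.
  have : (2 * D + 2 * s + 4)%:R <= n%:R :> R by rewrite ler_nat.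
  have : 0 <= s%:R :> R by rewrite ler0n.
  have : 0 <= (2^-1 - p.+1%:R^-1) * n%:R :> R by rewrite mulr_ge0 ?subr_ge0 // ltW.
  have -> : (2 * D + 2 * s + 4)%:R = 2 * D%:R + 2 * s%:R + 4 :> R by ring.
  move: lG0; move: (p.+1%:R^-1 : R) (n%:R : R) (D%:R : R) (s%:R : R) l => a b c d l.
  lra.
have D0' : 0 <= D%:R :> R by rewrite ler0n.
have l0 : 0 < l by lra.
have [x ext] := SPEX_extremal_pair n0 SG l0.
have cG : #|{: G}| = n by [].
have x1 : \sum_v x v = 1 by rewrite -(ep_sum ext); apply: eq_bigl => v; rewrite inE.
have ln : l <= n%:R.
  rewrite -[l]mulr1 -x1 mulr_sumr -cG -sumr_const; apply: ler_sum => v _.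
  have := weight_sub (ep_ge0 ext) (subsetT (nbrs v)).
  by rewrite (ep_sum ext) (extremal_weight_nbrs ext) x1.
(* The form is l times the squared norm, at least l / n by Cauchy-Schwarz; [lG0] bounds l / n below
   by 1 - 1/r - 1/n, and l <= n. *)
have dens : 1 - p.+1%:R^-1 - l^-1 <= adj_form (@edge G) x.
  rewrite (adj_form_eigenvector (ep_eigen ext)).
  have := @sqr_sum_le R G x; rewrite x1 expr1n cG => /(_ n0) h.
  have h1 : l * (1 / n%:R) <= l * sqnorm x by rewrite ler_pM2l.
  apply: le_trans h1.
  have h2 : 1 - p.+1%:R^-1 - n%:R^-1 <= l * (1 / n%:R).
    by rewrite mul1r ler_pdivlMr // mulrBl mulVf ?gt_eqF.
  by apply: le_trans h2; rewrite lerD2l lerN2 lef_pV2 ?posrE.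
have [|xpos [Q [col [Qs eE]]]] := HD R G l x ext _ dens; first by lra.
apply: (@join_edge_isomorphic G p Q col) => //.
- by rewrite Qs subn1.
- by rewrite Gn.
- by rewrite Gn.
- by move=> i j; apply: (extremal_join_balanced i j s0 sm p0 ext xpos Qs eE).
Qed.
End Main.

Theorem theorem1p6 (R : realType) (m s r : nat) :
  1 <= s -> 2 * s <= m -> 2 <= r ->
  let F := graph_join
             (disjoint_union (copies s (complete_graph 2))
                             (edgeless_graph (m - 2 * s)))
             (turan (m * (r - 1)) (r - 1)) in
  exists N : nat, forall n : nat, N <= n ->
    let G0 := graph_join (complete_graph (s - 1)) (turan (n - s + 1) r) in
    SPEX R n (family1 F) G0 /\
    forall G : sgraph, SPEX R n (family1 F) G -> isomorphic G G0.
Proof.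
case: r => [|[|p]] // s0 sm _; rewrite subn1 /=.
have [N HN] := SPEX_turan_join R s0 sm (ltn0Sn p).
exists (N + s + 1) => n nN; set G0 := graph_join _ (turan (n - s + 1) _).
have uniq_ext G : SPEX R n (family1 (matching_join_turan m s p.+1)) G -> isomorphic G G0.
  by apply: HN; lia.
split=> //; have n0 : 0 < n by lia.
have oG0 : Defs.order G0 = n.
  by rewrite [RHS](_ : n = s - 1 + (n - s + 1)); [exact: order_turan_join | lia].
have fG0 : ~ has_subgraph G0 (matching_join_turan m s p.+1).
  have := @turan_join_free (s - 1) (n - s + 1) p.+1 m.
  have -> : (s - 1).+1 = s by rewrite subn1 prednK.
  by move=> h; exact: h sm _.
(* Some extremal graph exists and is isomorphic to [G0], so [G0] is extremal as well. *)
have [G SG] := SPEX_exists R n0 oG0 fG0.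
exact: SPEX_isomorphic n0 (uniq_ext G SG) SG.
Qed.
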